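(* Assume that $\gamma\in\mathcal L\mathbb S^3(\mathbf 1,-\mathbf 1)$ is convex. Then its left part $\gamma_l\in\mathcal L\mathbb S^2(\mathbf 1)$ is contained in an open hemisphere and its rotation number is equal to $2$.
   Context: For $n\in\{2,3\}$, a smooth curve $\gamma:[0,1]\to\mathbb S^n\subset\mathbb R^{n+1}$ is locally convex if $\det(\gamma(t),\gamma'(t),\dots,\gamma^{(n)}(t))>0$ for all $t\in[0,1]$; its Frenet frame $\mathcal F_\gamma(t)\in SO_{n+1}$ is the orthogonal matrix obtained by Gram–Schmidt orthonormalization of $(\gamma(t),\gamma'(t),\dots,\gamma^{(n)}(t))$. A smooth curve $\gamma:[0,1]\to\mathbb S^n$ is convex (globally convex) if every hyperplane $H\subset\mathbb R^{n+1}$ through the origin intersects the image of $\gamma$ in at most $n$ points counted with multiplicity. Here endpoints of the curve are not counted, and for $t\in(0,1)$ with $\gamma(t)\in H$ the multiplicity is the smallest $k\ge1$ such that $\gamma^{(j)}(t)\in H$ for $0\le j\le k-1$ and $\gamma^{(k)}(t)\notin H$. $\mathbb H$ denotes the quaternions with basis $\mathbf 1,\mathbf i,\mathbf j,\mathbf k$, and $\mathbb S^3$ is identified with the unit quaternions. $\mathrm{Spin}_3\simeq\mathbb S^3$ with covering $\Pi_3:\mathbb S^3\to SO_3$, $\Pi_3(z)h=zh\bar z$ for $h\in\mathrm{Im}\,\mathbb H\simeq\mathbb R^3$ (basis $\mathbf i,\mathbf j,\mathbf k$); $\mathrm{Spin}_4\simeq\mathbb S^3\times\mathbb S^3$ with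 covering $\Pi_4(z_l,z_r)q=z_lq\bar z_r$ for $q\in\mathbb H\simeq\mathbb R^4$ (basis $\mathbf 1,\mathbf i,\mathbf j,\mathbf k$). If $\mathcal F_\gamma(0)=I$, the lifted Frenet frame $\tilde{\mathcal F}_\gamma:[0,1]\to\mathrm{Spin}_{n+1}$ is the continuous lift of $\mathcal F_\gamma$ starting at the unit element. $\mathcal L\mathbb S^2(z)$ (resp. $\mathcal L\mathbb S^3(z_l,z_r)$) is the set of locally convex curves in $\mathbb S^2$ (resp. $\mathbb S^3$) with $\mathcal F_\gamma(0)=I$ and $\tilde{\mathcal F}_\gamma(1)=z$ (resp. $(z_l,z_r)$). Left part: for $\gamma\in\mathcal L\mathbb S^3(z_l,z_r)$ write $\tilde{\mathcal F}_\gamma(t)=(\tilde\Gamma_l(t),\tilde\Gamma_r(t))\in\mathbb S^3\times\mathbb S^3$; the left part is $\gamma_l(t)=\Pi_3(\tilde\Gamma_l(t))e_1$, a curve in $\mathcal L\mathbb S^2(z_l)$. An open hemisphere is a set $H_h=\{x\in\mathbb S^2: h\cdot x>0\}$ and a closed hemisphere is $\bar H_h=\{x\in\mathbb S^2: h\cdot x\ge0\}$, $h\in\mathbb S^2$. Rotation number: for a closed immersed curve $\gamma$ in $\mathbb S^2$ contained in a closed hemisphere, let $h_\gamma$ be the barycenter of the (geodesically convex) set of all $h$ with $\gamma\subset\bar H_h$, and let $\eta_\gamma$ be the plane curve obtained by stereographic projection of $\gamma$ from $-h_\gamma$ (any other $h$ in the set gives the same number). Then $\mathrm{rot}(\gamma):=-\mathrm{rot}(\eta_\gamma)\in\mathbb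 Z$, where $\mathrm{rot}(\eta_\gamma)$ is the degree of $t\mapsto\eta_\gamma'(t)/\|\eta_\gamma'(t)\|\in\mathbb S^1$; the plane is oriented so that a small circle traversed once with positive geodesic curvature (i.e. with the enclosed disc on the side of $\gamma\times\gamma'$) has $\mathrm{rot}=+1$. *)

(* Defs.v *)
From HB Require Import structures.
From mathcomp Require Import all_boot all_order all_algebra.
From mathcomp Require Import all_classical all_reals all_analysis.
Set Implicit Arguments.
Unset Strict Implicit.
Unset Printing Implicit Defensive.
Import Order.TTheory GRing.Theory Num.Theory.
Import numFieldNormedType.Exports.
Local Open Scope classical_set_scope.
Local Open Scope ring_scope.

(* A curve on [0, 1] is a function on R of which only the values on [0, 1]
   are ever used. *)

Section Curves.
Context {R : realType}.

Definition unit_itv : set R := `[0, 1].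

Definition diff_quotient (V : normedModType R) (f : R -> V) (t s : R) : V :=
  (s - t)^-1 *: (f s - f t).

(* Derivative of a function on [0, 1]: two-sided at interior points, one-sided
   at 0 and at 1. *)
Definition deriv01 (V : normedModType R) (f : R -> V) (t : R) : V :=
  lim (diff_quotient f t s @[s --> within unit_itv t^']).

Definition deriv01n (V : normedModType R) (k : nat) (f : R -> V) : R -> V :=
  iter k (@deriv01 V) f.

Definition smooth01 (V : normedModType R) (f : R -> V) : Prop :=
  forall (k : nat) (t : R), unit_itv t ->
    cvg (diff_quotient (deriv01n k f) t s @[s --> within unit_itv t^']).

Definition dot n (u v : 'cV[R]_n) : R := \sum_i u i 0 * v i 0.

Definition normalize n (v : 'cV[R]_n) : 'cV[R]_n :=
  (Num.sqrt (dot v v))^-1 *: v.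

Definition sphere n : set 'cV[R]_n := [set v | dot v v = 1].

Definition gram_schmidt n (vs : seq 'cV[R]_n) : seq 'cV[R]_n :=
  foldl (fun us v => rcons us (normalize (v - \sum_(u <- us) dot u v *: u)))
    [::] vs.

Definition cols n (vs : seq 'cV[R]_n) : 'M[R]_n := \matrix_(i, j) vs`_j i 0.

Definition jet n (gamma : R -> 'cV[R]_n.+1) (t : R) : seq 'cV[R]_n.+1 :=
  [seq deriv01n k gamma t | k <- iota 0 n.+1].

Definition frenet n (gamma : R -> 'cV[R]_n.+1) (t : R) : 'M[R]_n.+1 :=
  cols (gram_schmidt (jet gamma t)).

Definition spherical_curve n (gamma : R -> 'cV[R]_n.+1) : Prop :=
  smooth01 gamma /\ forall t, unit_itv t -> sphere (gamma t).

Definition locally_convex n (gamma : R -> 'cV[R]_n.+1) : Prop :=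
  spherical_curve gamma /\
  forall t, unit_itv t -> 0 < \det (cols (jet gamma t)).

(* A hyperplane through the origin is given by a normal vector a != 0.  At
   most one k satisfies the condition below; the multiplicity is +oo when
   there is none, i.e. when all the derivatives at t lie in the hyperplane. *)
Definition multiplicity n (gamma : R -> 'cV[R]_n.+1) (a : 'cV[R]_n.+1)
    (t : R) : \bar R :=
  ereal_inf [set (k%:R)%:E | k in
    [set k : nat | [/\ (1 <= k)%N,
      forall j : nat, (j < k)%N -> dot a (deriv01n j gamma t) = 0 &
      dot a (deriv01n k gamma t) <> 0]]].

Definition intersection_times n (gamma : R -> 'cV[R]_n.+1)
    (a : 'cV[R]_n.+1) : set R :=
  [set t | 0 < t < 1 /\ dot a (gamma t) = 0].

Definition globally_convex n (gamma : R -> 'cV[R]_n.+1) : Prop :=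
  spherical_curve gamma /\
  forall a : 'cV[R]_n.+1, a != 0 ->
    (\esum_(t in intersection_times gamma a) multiplicity gamma a t
       <= (n%:R)%:E)%E.

(* Quaternions are the vectors of R^4, in the basis 1, i, j, k.  The indices
   1, 2 and 3 below are ring numerals in 'I_3 or 'I_4, with these values. *)
Definition quat (a b c d : R) : 'cV[R]_4 := \col_i [:: a; b; c; d]`_i.

Definition qone : 'cV[R]_4 := quat 1 0 0 0.

Definition qmul (p q : 'cV[R]_4) : 'cV[R]_4 :=
  quat (p 0 0 * q 0 0 - p 1 0 * q 1 0 - p 2 0 * q 2 0 - p 3 0 * q 3 0)
       (p 0 0 * q 1 0 + p 1 0 * q 0 0 + p 2 0 * q 3 0 - p 3 0 * q 2 0)
       (p 0 0 * q 2 0 - p 1 0 * q 3 0 + p 2 0 * q 0 0 + p 3 0 * q 1 0)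
       (p 0 0 * q 3 0 + p 1 0 * q 2 0 - p 2 0 * q 1 0 + p 3 0 * q 0 0).

Definition qconj (q : 'cV[R]_4) : 'cV[R]_4 :=
  quat (q 0 0) (- q 1 0) (- q 2 0) (- q 3 0).

Definition imag_quat (h : 'cV[R]_3) : 'cV[R]_4 :=
  quat 0 (h 0 0) (h 1 0) (h 2 0).

Definition imag_part (q : 'cV[R]_4) : 'cV[R]_3 :=
  \col_i q (lift ord0 i) 0.

Definition Pi3 (z : 'cV[R]_4) (h : 'cV[R]_3) : 'cV[R]_3 :=
  imag_part (qmul (qmul z (imag_quat h)) (qconj z)).

Definition Pi4 (z : 'cV[R]_4 * 'cV[R]_4) (q : 'cV[R]_4) : 'cV[R]_4 :=
  qmul (qmul z.1 q) (qconj z.2).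

Definition lifted_frenet3 (gamma : R -> 'cV[R]_3) (G : R -> 'cV[R]_4) : Prop :=
  [/\ {within unit_itv, continuous G},
      G 0 = qone,
      forall t, unit_itv t -> sphere (G t) &
      forall t, unit_itv t -> forall h, Pi3 (G t) h = frenet gamma t *m h].

Definition lifted_frenet4 (gamma : R -> 'cV[R]_4)
    (G : R -> 'cV[R]_4 * 'cV[R]_4) : Prop :=
  [/\ {within unit_itv, continuous G},
      G 0 = (qone, qone),
      forall t, unit_itv t -> sphere (G t).1 /\ sphere (G t).2 &
      forall t, unit_itv t -> forall q, Pi4 (G t) q = frenet gamma t *m q].

Definition LS2 (z : 'cV[R]_4) : set (R -> 'cV[R]_3) :=
  [set gamma | [/\ locally_convex gamma, frenet gamma 0 = 1%:M &
    exists2 G, lifted_frenet3 gamma G & G 1 = z]].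

Definition LS3 (zl zr : 'cV[R]_4) : set (R -> 'cV[R]_4) :=
  [set gamma | [/\ locally_convex gamma, frenet gamma 0 = 1%:M &
    exists2 G, lifted_frenet4 gamma G & G 1 = (zl, zr)]].

(* In terms of the lifted Frenet frame G = (Gl, Gr). *)
Definition left_part (G : R -> 'cV[R]_4 * 'cV[R]_4) (t : R) : 'cV[R]_3 :=
  Pi3 (G t).1 (delta_mx 0 0).

Definition open_hemisphere (h : 'cV[R]_3) : set 'cV[R]_3 :=
  [set x | sphere x /\ 0 < dot h x].

Definition closed_hemisphere (h : 'cV[R]_3) : set 'cV[R]_3 :=
  [set x | sphere x /\ 0 <= dot h x].

Definition hemisphere_poles (gamma : R -> 'cV[R]_3) : set 'cV[R]_3 :=
  [set h | sphere h /\ gamma @` unit_itv `<=` closed_hemisphere h].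

Definition vec3 (p : R * R * R) : 'cV[R]_3 :=
  \col_i [:: p.1.1; p.1.2; p.2]`_i.

(* The solid cone over A, cut by the unit ball. *)
Definition solid_cone (A : set 'cV[R]_3) : set (R * R * R) :=
  [set p | exists r h, [/\ 0 <= r <= 1, A h & vec3 p = r *: h]].

(* For A a subset of the sphere, integration in polar coordinates shows that
   the integral of x dx over the solid cone is 1/4 times the integral of x
   over A with respect to the area; its direction is the barycenter of A.
   This is meaningful when A has positive area; for A = hemisphere_poles gamma
   this holds exactly when gamma lies in an open hemisphere. *)
Definition barycenter (A : set 'cV[R]_3) : 'cV[R]_3 :=
  normalize (\col_i
    Rintegral ((lebesgue_measure \x lebesgue_measure) \x lebesgue_measure)%E
      (solid_cone A) (fun p => vec3 p i 0)).

(* Stereographic projection from - h to the plane orthogonal to h, in the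
   coordinates given by the orthonormal basis (u, v) of this plane. *)
Definition stereographic (u v h x : 'cV[R]_3) : 'cV[R]_2 :=
  (1 + dot h x)^-1 *: \col_i [:: dot u x; dot v x]`_i.

Definition circle_degree (tau : R -> 'cV[R]_2) (m : int) : Prop :=
  exists theta : R -> R,
    [/\ {within unit_itv, continuous theta},
        forall t, unit_itv t ->
          tau t = \col_i [:: cos (theta t); sin (theta t)]`_i &
        theta 1 - theta 0 = 2 * pi * m%:~R].

Definition plane_rotation_number (eta : R -> 'cV[R]_2) (m : int) : Prop :=
  [/\ eta 0 = eta 1,
      forall t, unit_itv t -> deriv01 eta t != 0 &
      circle_degree (fun t => normalize (deriv01 eta t)) m].

(* rot(gamma) = m.  The plane orthogonal to h is oriented by the bases (u, v)
   such that (u, v, h) is a negative basis of R^3: a small positively curved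
   circle turns counterclockwise around h when seen from outside the sphere, so
   its projection has rotation number -1 and the circle itself has +1. *)
Definition rotation_number (gamma : R -> 'cV[R]_3) (m : int) : Prop :=
  let h := barycenter (hemisphere_poles gamma) in
  hemisphere_poles gamma h /\
  exists u v : 'cV[R]_3,
    [/\ (cols [:: u; v; h])^T *m cols [:: u; v; h] = 1%:M,
        \det (cols [:: u; v; h]) = -1 &
        plane_rotation_number (stereographic u v h \o gamma) (- m)].

End Curves.

(* Main.v *)
Require Import Defs.
From HB Require Import structures.
From mathcomp Require Import all_boot all_order all_algebra.
From mathcomp Require Import all_classical all_reals all_analysis.
From mathcomp Require Import measurable_realfun.
From mathcomp Require Import ring lra.
Set Implicit Arguments.
Unset Strict Implicit.
Unset Printing Implicit Defensive.
Import Order.TTheory GRing.Theory Num.Theory.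
Import numFieldNormedType.Exports.
Local Open Scope classical_set_scope.
Local Open Scope ring_scope.

(* Write the lifted frame as (z_l, z_r) and let gamma_l, gamma_r be the spherical
   curves z_l i z_l^-1 and z_r i z_r^-1. Up to a positive factor, gamma_l and
   gamma_r are the self-dual and anti-self-dual parts of the bivector
   gamma /\ gamma', so that det(gamma(s), gamma'(s), gamma(t), gamma'(t)) is a
   positive multiple of gamma_l(s).gamma_l(t) - gamma_r(s).gamma_r(t). Convexity
   forbids 2 + 2 zeros of a linear form on gamma, hence this gap is positive for
   s <> t in (0, 1). The point of least norm |x| of the convex hull of
   (gamma_l, gamma_r), on which |x| >= |y|, then gives a strict pole of gamma_l,
   and the barycenter of all the poles is again a strict pole h.

   Let z_1 be the projection of z_l on the complex line of the first two
   coordinates, once h is rotated to the first axis. The stereographic velocity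
   of gamma_l is a positive multiple of the conjugate of z_1^2, and z_1 is a
   closed curve of some winding number d, so that rot(gamma_l) = 2 d. The
   velocity of the central projection of gamma_l is never opposite to z_1^2, so
   that it turns by 4 pi d; it turns positively, because gamma_l is locally
   convex, so d > 0. For s near 0 and c = gamma(s), compare it
   with the projections at gamma_l(t), and then at gamma_l(s), of the vector
   Im(gamma(t) c^-1): the directions are never parallel for the first comparison
   (3 + 1 zeros) and never opposite for the second one, and the last one is the
   direction of a plane curve which is linear in gamma, so turns by at most 3 pi
   (4 zeros). Hence 4 pi d < (1 + 2 + 3 + 2) pi, the last term accounting for the
   ends of the interval, and d = 1. *)

(** * Derivatives on the unit interval *)

Section Calculus01.
Context {R : realType}.
Implicit Types (f g : R -> R) (s t l m : R) (V : normedModType R).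

(** Two projections of gamma_l are needed because neither is enough. The stereographic one is
    conformal: its velocity is read off from the lift as a square, and since the left lift closes up
    this makes the rotation number even; but its direction need not turn monotonically. The central
    one sends great circles to lines, so that local convexity makes its direction turn monotonically
    and a comparison of directions becomes a determinant that convexity controls. Evenness makes the
    final estimate cheap: only d >= 2 has to be excluded, that is, a turning of at least 8 pi, and
    the three crude comparisons together stay strictly below this.

    The recurring obstacle is that intersections are counted on (0, 1) only. Every strict inequality
    given by convexity is interior, whereas the conclusions concern a closed curve with its end
    point. Hence the special treatment of the ends in [functional_gt0] and the 2 pi lost at the ends
    of the interval. *)

Lemma unit_itvP t : unit_itv t <-> 0 <= t <= 1.
Proof. by rewrite /unit_itv /= in_itv. Qed.

(** This makes limits of difference quotients unique, also at 0 and 1: from any point the interval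
    extends by at least 1/2 to one of the two sides. *)
Lemma within01_proper t : unit_itv t -> ProperFilter (within unit_itv t^').
Proof.
move/unit_itvP => /andP[t0 t1]; apply: Build_ProperFilter_ex => A.
rewrite /within /= => /nbhs_ballP[e /= e0 eA].
pose d := Num.min (e / 2) (1 / 2).
have d0 : 0 < d by rewrite lt_min; apply/andP; split; lra.
have de : d <= e / 2 by rewrite ge_min lexx.
have dh : d <= 1 / 2 by rewrite ge_min lexx orbT.
have [th|th] := leP t (1 / 2).
- exists (t + d); apply: eA; last 1 first.
  + by apply/unit_itvP; lra.
  + rewrite /ball/= opprD addrA subrr sub0r normrN gtr0_norm//; lra.
  + by apply/eqP => H; lra.
- exists (t - d); apply: eA; last 1 first.
  + by apply/unit_itvP; lra.
  + rewrite /ball/= opprB addrCA subrr addr0 gtr0_norm//; lra.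
  + by apply/eqP => H; lra.
Qed.

(** [deriv01] is a [lim], which says nothing where the limit does not exist. The relational form
    carries existence, and [deriv01_eq] returns to the function. *)
Definition has_deriv01 V (f : R -> V) t (l : V) : Prop :=
  diff_quotient f t s @[s --> within unit_itv t^'] --> l.

Lemma deriv01_eq V (f : R -> V) t (l : V) :
  unit_itv t -> has_deriv01 f t l -> deriv01 f t = l.
Proof.
move=> /within01_proper Ft fl; apply: cvg_lim => //.
Qed.

Lemma near_within01 t (P : R -> Prop) :
  (forall s, unit_itv s -> s != t -> P s) ->
  \forall s \near within unit_itv t^', P s.
Proof.
move=> H; have := nbhs_dnbhs_neq t.
by apply: filterS => s st Is; exact: H.
Qed.

Lemma has_deriv01_ext V (f g : R -> V) t (l : V) : unit_itv t ->
  {in unit_itv, f =1 g} -> has_deriv01 f t l -> has_deriv01 g t l.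
Proof.
move=> It fg; apply: cvg_trans; apply: near_eq_cvg.
apply: near_within01 => s Is st.
by rewrite /diff_quotient !fg// inE.
Qed.

Lemma has_deriv01_cst V (c : V) t : has_deriv01 (fun=> c) t 0.
Proof.
rewrite /has_deriv01 /diff_quotient.
under eq_fun do rewrite subrr scaler0.
exact: cvg_cst.
Qed.

Lemma has_deriv01D V (f g : R -> V) t (l m : V) : has_deriv01 f t l ->
  has_deriv01 g t m -> has_deriv01 (fun s => f s + g s) t (l + m).
Proof.
move=> fl gm; rewrite /has_deriv01.
rewrite (_ : diff_quotient _ t =
   fun s => diff_quotient f t s + diff_quotient g t s); first exact: cvgD.
by apply/funext => s; rewrite /diff_quotient -scalerDr opprD addrACA.
Qed.

Lemma has_deriv01_cvg f t l : has_deriv01 f t l ->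
  f s @[s --> within unit_itv t^'] --> f t.
Proof.
move=> fl.
have idt : (s - t) @[s --> within unit_itv t^'] --> (0 : R).
  rewrite -(subrr t); apply: cvgB; last exact: cvg_cst.
  by apply: cvg_trans (@nbhs_dnbhs R t); exact: cvg_within.
have : (s - t) * diff_quotient f t s + f t @[s --> within unit_itv t^'] --> 0 * l + f t.
  by apply: cvgD; [exact: cvgM idt fl|exact: cvg_cst].
rewrite mul0r add0r; apply: cvg_trans; apply: near_eq_cvg.
apply: near_within01 => s Is st.
rewrite /diff_quotient /= /GRing.scale /= mulrA divff ?subr_eq0// mul1r; ring.
Qed.

Lemma has_deriv01M f g t l m : has_deriv01 f t l -> has_deriv01 g t m ->
  has_deriv01 (fun s => f s * g s) t (l * g t + f t * m).
Proof.
move=> fl gm; rewrite /has_deriv01.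
have H : diff_quotient f t s * g s + f t * diff_quotient g t s
    @[s --> within unit_itv t^'] --> l * g t + f t * m.
  apply: cvgD; first by apply: cvgM => //; exact: has_deriv01_cvg gm.
  by apply: cvgM => //; exact: cvg_cst.
apply: cvg_trans H; apply: near_eq_cvg.
apply: near_within01 => s Is st.
rewrite /diff_quotient /= /GRing.scale /=; ring.
Qed.

(** The value is written as a product of the derivative of f and three copies of the function
    itself, the shape on which the induction of [differentiable01n_rsqrt] closes. *)
Lemma has_deriv01_rsqrt f t l : 0 < f t -> has_deriv01 f t l ->
  has_deriv01 (fun s => (Num.sqrt (f s))^-1) t
    (- (1 / 2) * (l * ((Num.sqrt (f t))^-1 * ((Num.sqrt (f t))^-1 * (Num.sqrt (f t))^-1)))).
Proof.
move=> ft fl; rewrite /has_deriv01.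
have fc := has_deriv01_cvg fl.
have sc : Num.sqrt (f s) @[s --> within unit_itv t^'] --> Num.sqrt (f t).
  by apply: continuous_cvg fc; exact: sqrt_continuous.
have s0 : 0 < Num.sqrt (f t) by rewrite sqrtr_gt0.
have fpos : \forall s \near within unit_itv t^', 0 < f s.
  exact: (@cvgr_gt _ R _ _ f (f t) fc).
have ic : (Num.sqrt (f s))^-1 @[s --> within unit_itv t^'] --> (Num.sqrt (f t))^-1.
  by apply: cvgV => //; rewrite gt_eqF.
have jc : (Num.sqrt (f s) + Num.sqrt (f t))^-1 @[s --> within unit_itv t^'] -->
    (Num.sqrt (f t) + Num.sqrt (f t))^-1.
  apply: cvgV; first by rewrite gt_eqF// addr_gt0.
  by apply: cvgD => //; exact: cvg_cst.
(* Rationalization: 1/sqrt a - 1/sqrt b = (b - a) / (sqrt a sqrt b (sqrt a + sqrt b)). *)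
have : - diff_quotient f t s * ((Num.sqrt (f s))^-1 * (Num.sqrt (f t))^-1 *
    (Num.sqrt (f s) + Num.sqrt (f t))^-1) @[s --> within unit_itv t^'] -->
    - l * ((Num.sqrt (f t))^-1 * (Num.sqrt (f t))^-1 *
    (Num.sqrt (f t) + Num.sqrt (f t))^-1).
  apply: cvgM; first exact: cvgN.
  by apply: cvgM => //; apply: cvgM => //; exact: cvg_cst.
rewrite (_ : - l * _ = - (1 / 2) * (l * ((Num.sqrt (f t))^-1 * ((Num.sqrt (f t))^-1 * (Num.sqrt (f t))^-1)))); last first.
  have n0 : Num.sqrt (f t) != 0 by rewrite gt_eqF.
  by field; rewrite n0 /= ; rewrite gt_eqF// addr_gt0.
apply: cvg_trans; apply: near_eq_cvg.
near=> s.
have fs : 0 < f s by near: s.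
have ss : 0 < Num.sqrt (f s) by rewrite sqrtr_gt0.
rewrite /diff_quotient /= /GRing.scale /=.
have Es : f s = Num.sqrt (f s) ^+ 2 by rewrite sqr_sqrtr// ltW.
have Et : f t = Num.sqrt (f t) ^+ 2 by rewrite sqr_sqrtr// ltW.
rewrite {1}Es {1}Et.
have st : s != t by near: s; exact: near_within01.
move: (Num.sqrt (f s)) (Num.sqrt (f t)) ss s0 => a b a0 b0.
have ab0 : a + b != 0 by rewrite gt_eqF// addr_gt0.
by field; rewrite ab0 (gt_eqF a0) (gt_eqF b0) subr_eq0 st.
Unshelve. all: by end_near. Qed.

Lemma has_deriv01_coordP n (f : R -> 'cV[R]_n) t (l : 'cV[R]_n) :
  has_deriv01 f t l <-> forall i, has_deriv01 (fun s => f s i 0) t (l i 0).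
Proof.
split=> [fl i|fl].
  have H : diff_quotient f t s i 0 @[s --> within unit_itv t^'] --> l i 0.
    apply: (cvg_comp (diff_quotient f t) (fun M : 'cV[R]_n => M i 0) fl).
    exact: coord_continuous.
  apply: cvg_trans H.
  by apply: near_eq_cvg; apply: near_within01 => s _ _; rewrite /diff_quotient /= !mxE.
apply/cvg_ballP => e e0.
have H : \forall s \near within unit_itv t^', forall i : 'I_n,
    ball (l i 0) e (diff_quotient (fun s => f s i 0) t s).
  apply: filter_forall => i.
  by move/cvg_ballP : (fl i); exact.
near=> s; split => // i j; rewrite (ord1 j).
have : forall i : 'I_n, ball (l i 0) e (diff_quotient (fun s => f s i 0) t s) by near: s.
by move/(_ i); rewrite /diff_quotient /= !mxE.
Unshelve. all: by end_near. Qed.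

Lemma has_deriv01_is_derive f t l : 0 < t < 1 -> has_deriv01 f t l ->
  is_derive t 1 f l.
Proof.
move=> t01 fl.
have H : h^-1 *: (f (h + t) - f t) @[h --> 0^'] --> l.
  have fl' : diff_quotient f t s @[s --> t^'] --> l.
    apply: cvg_trans fl => A /=; rewrite /nbhs/= /within /= => H.
    near=> s; have : unit_itv s -> A (diff_quotient f t s) by near: s.
    apply; apply/unit_itvP; near: s; apply: (@nbhs_dnbhs R t).
    near=> s; apply/andP; split; apply: ltW; near: s.
      by apply: lt_nbhsr; lra.
    by apply: lt_nbhsl; lra.
  have : (diff_quotient f t \o (fun h => h + t)) h @[h --> 0^'] --> l.
    apply: cvg_comp fl' => A /= /nbhs_ballP[e /= e0 eA]; apply/nbhs_ballP; exists e => //= h.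
    rewrite /ball/= sub0r normrN => he h0; apply: eA.
      by rewrite /ball /= opprD addrCA subrr addr0 normrN.
    by apply/eqP => ht; move/eqP: h0; apply; lra.
  by under eq_fun do rewrite /diff_quotient /= addrK.
apply: DeriveDef; last by rewrite /derive; apply: cvg_lim => //; under eq_fun do rewrite /GRing.scale/= mulr1.
apply/cvg_ex; exists l; rewrite /=; under eq_fun do rewrite /GRing.scale/= mulr1.
exact: H.
Unshelve. all: by end_near. Qed.

End Calculus01.

(** * Smoothness of finite order, and extension from the unit interval to the line *)

Section Smooth01.
Context {R : realType}.
Implicit Types (f g : R -> R) (s t : R) (V : normedModType R).

(** Smoothness cut at a finite order, so that closure under products and inverse square roots goes
    by induction on the order. *)
Definition differentiable01n V n (f : R -> V) : Prop :=
  forall k, (k < n)%N -> forall t, unit_itv t ->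
    cvg (diff_quotient (deriv01n k f) t s @[s --> within unit_itv t^']).

Lemma smooth01P V (f : R -> V) :
  smooth01 f <-> forall n, differentiable01n n f.
Proof.
split=> [H n k _ t It|H k t It]; first exact: H.
exact: (H k.+1 k (ltnSn k) t It).
Qed.

Lemma differentiable01nS V n (f : R -> V) : differentiable01n n.+1 f <->
  (forall t, unit_itv t -> has_deriv01 f t (deriv01 f t)) /\
  differentiable01n n (deriv01 f).
Proof.
split=> [H|[H0 H] [|k] kn t It].
- split=> [t It|k kn t It]; first exact: (H 0%N).
  by have := H k.+1 kn t It; rewrite /deriv01n iterSr.
- by have := H0 t It => /cvgP.
- by rewrite /deriv01n iterSr; exact: H.
Qed.

Lemma differentiable01n_ext V n (f g : R -> V) : {in unit_itv, f =1 g} ->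
  differentiable01n n f -> differentiable01n n g.
Proof.
elim: n f g => [//|n IH] f g fg /differentiable01nS[f1 fn].
have H t : unit_itv t -> has_deriv01 g t (deriv01 f t).
  by move=> It; apply: has_deriv01_ext fg _ => //; exact: f1.
have E : {in unit_itv, deriv01 f =1 deriv01 g}.
  by move=> t; rewrite inE => It; rewrite (deriv01_eq It (H t It)).
apply/differentiable01nS; split=> [t It|]; last exact: IH fn.
by rewrite -E ?inE//; exact: H.
Qed.

Lemma differentiable01n_leq V m n (f : R -> V) : (m <= n)%N ->
  differentiable01n n f -> differentiable01n m f.
Proof. by move=> mn H k km; apply: H; exact: leq_trans mn. Qed.

Lemma differentiable01n_step V n (f g : R -> V) :
  (forall t, unit_itv t -> has_deriv01 f t (g t)) ->
  differentiable01n n g -> differentiable01n n.+1 f.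
Proof.
move=> fg gn; have E : {in unit_itv, g =1 deriv01 f}.
  by move=> t; rewrite inE => It; rewrite (deriv01_eq It (fg t It)).
apply/differentiable01nS; split=> [t It|]; last exact: differentiable01n_ext gn.
by rewrite -E ?inE//; exact: fg.
Qed.

Lemma differentiable01n_cst V n (c : V) : differentiable01n n (fun=> c).
Proof.
elim: n c => [//|n IH] c.
by apply: differentiable01n_step (IH 0) => t _; exact: has_deriv01_cst.
Qed.

Lemma differentiable01nD V n (f g : R -> V) : differentiable01n n f ->
  differentiable01n n g -> differentiable01n n (fun s => f s + g s).
Proof.
elim: n f g => [f g _ _ k //|n IH] f g /differentiable01nS[f1 fn] /differentiable01nS[g1 gn].
apply: differentiable01n_step (IH _ _ fn gn) => t It.
by apply: has_deriv01D; [exact: f1|exact: g1].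
Qed.

Lemma differentiable01nM n f g : differentiable01n n f ->
  differentiable01n n g -> differentiable01n n (fun s => f s * g s).
Proof.
elim: n f g => [f g _ _ k //|n IH] f g fn' gn'.
have /differentiable01nS[f1 fn] := fn'.
have /differentiable01nS[g1 gn] := gn'.
have fl := differentiable01n_leq (leqnSn n) fn'.
have gl := differentiable01n_leq (leqnSn n) gn'.
apply: (@differentiable01n_step _ n _ (fun t => deriv01 f t * g t + f t * deriv01 g t)).
  by move=> t It; apply: has_deriv01M; [exact: f1|exact: g1].
exact: (differentiable01nD (IH _ _ fn gl) (IH _ _ fl gn)).
Qed.

Lemma differentiable01n_rsqrt n f : (forall t, unit_itv t -> 0 < f t) ->
  differentiable01n n f -> differentiable01n n (fun s => (Num.sqrt (f s))^-1).
Proof.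
move=> f0; elim: n => [_ k //|n IH] fn'.
have /differentiable01nS[f1 fn] := fn'.
have fl := differentiable01n_leq (leqnSn n) fn'.
have w := IH fl.
pose g s : R := (Num.sqrt (f s))^-1.
apply: (@differentiable01n_step _ n _
    (fun t => - (1 / 2) * (deriv01 f t * (g t * (g t * g t))))).
  by move=> t It; exact: (has_deriv01_rsqrt (f0 t It) (f1 t It)).
have H := differentiable01nM fn (differentiable01nM w (differentiable01nM w w)).
have c : differentiable01n n (fun=> - (1 / 2) : R) by exact: differentiable01n_cst.
exact: (differentiable01nM c H).
Qed.

Lemma differentiable01n_coordP m n (f : R -> 'cV[R]_m) :
  differentiable01n n f <-> forall i, differentiable01n n (fun s => f s i 0).
Proof.
elim: n f => [f|n IH f]; first by split.
split=> [/differentiable01nS[f1 /IH fn] i|H].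
  apply: differentiable01n_step (fn i) => t It.
  by have /has_deriv01_coordP := f1 t It; exact.
have E t : unit_itv t -> has_deriv01 f t (\col_i deriv01 (fun s => f s i 0) t).
  move=> It; apply/has_deriv01_coordP => i; rewrite mxE.
  by have /differentiable01nS[+ _] := H i; exact.
apply: differentiable01n_step E _; apply/IH => i.
apply: (@differentiable01n_ext _ _ (deriv01 (fun s => f s i 0))) => [t _|].
  by rewrite mxE.
by have /differentiable01nS[] := H i.
Qed.

Lemma differentiable01n_deriv V k n (f : R -> V) : smooth01 f ->
  differentiable01n n (deriv01n k f).
Proof.
move=> sf j jn t It; have := sf (j + k)%N t It.
by rewrite /deriv01n iterD.
Qed.

Lemma smooth01_has_deriv V k (f : R -> V) t : smooth01 f -> unit_itv t ->
  has_deriv01 (deriv01n k f) t (deriv01n k.+1 f t).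
Proof. by move=> sf It; exact: sf. Qed.

(** Precomposition with this retraction turns continuity on [0, 1] into continuity on the whole
    line, where the intermediate and extreme value theorems and the arguments of plane curves are
    then used without one-sided limits. *)
Definition clamp01 t : R := Num.max 0 (Num.min 1 t).

Lemma clamp01_itv t : unit_itv (clamp01 t).
Proof.
apply/unit_itvP; rewrite /clamp01 le_max lexx/= ge_max ler01/=.
by rewrite ge_min lexx.
Qed.

Lemma clamp01_id t : unit_itv t -> clamp01 t = t.
Proof.
by move=> /unit_itvP/andP[t0 t1]; rewrite /clamp01 min_r// max_r.
Qed.

Lemma clamp01_continuous : continuous clamp01.
Proof.
move=> t; apply: (@continuous_max R R (fun=> 0) (fun t => Num.min 1 t)).
  exact: cvg_cst.
by apply: (@continuous_min R R (fun=> 1) id); [exact: cvg_cst|exact: cvg_id].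
Qed.

Lemma within_continuous_clamp (T : topologicalType) (f : R -> T) :
  {within unit_itv, continuous f} -> continuous (fun t => f (clamp01 t)).
Proof.
move=> /subspace_continuousP fc t.
have := fc _ (clamp01_itv t).
apply: (@cvg_comp _ _ _ clamp01 f) => A wA.
have wA' : \forall s \near t, unit_itv (clamp01 s) -> A (clamp01 s).
  exact: clamp01_continuous wA.
change (\forall s \near t, A (clamp01 s)).
by apply: filterS wA' => s; apply; exact: clamp01_itv.
Qed.

Lemma has_deriv01_within f (df : R -> R) :
  (forall t, unit_itv t -> has_deriv01 f t (df t)) ->
  {within unit_itv, continuous f}.
Proof.
move=> H; apply/subspace_continuousP => t It A fA.
have K : \forall s \near t, s != t -> unit_itv s -> A (f s).
  exact: has_deriv01_cvg (H t It) A fA.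
change (\forall s \near t, unit_itv s -> A (f s)).
apply: filterS K => s sA Is.
by have [->|st] := eqVneq s t; [exact: nbhs_singleton|exact: sA].
Qed.

Lemma has_deriv01_continuous_clamp f (df : R -> R) :
  (forall t, unit_itv t -> has_deriv01 f t (df t)) ->
  continuous (fun t => f (clamp01 t)).
Proof. by move=> /has_deriv01_within/within_continuous_clamp. Qed.

Lemma derive_gt0_right f (df : R -> R) s e :
  (forall t, s <= t < e -> is_derive t 1 f (df t)) -> f s = 0 ->
  (forall t, s < t < e -> 0 < df t) -> forall t, s < t < e -> 0 < f t.
Proof.
move=> fd fs0 df0 t /andP[st te].
have [||c] := @MVT R f df s t st.
- move=> x; rewrite in_itv /= => /andP[sx xt]; apply: fd; apply/andP; split; lra.
- apply: derivable_within_continuous => x; rewrite in_itv /= => /andP[sx xt].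
  by apply: (@ex_derive _ _ _ _ _ _ (df x)); apply: fd; apply/andP; split; lra.
rewrite in_itv/= fs0 subr0 => /andP[sc ct] ->.
by apply: mulr_gt0; [apply: df0; apply/andP; split; lra|rewrite subr_gt0].
Qed.

End Smooth01.

(** * Quaternions and frames *)

Section Quaternions.
Context {R : realType}.
Implicit Types (p q r z : 'cV[R]_4) (u v h : 'cV[R]_3) (a b c d : R).

Lemma ord4P (P : 'I_4 -> Prop) : P 0 -> P 1 -> P 2 -> P 3 -> forall i, P i.
Proof.
move=> P0 P1 P2 P3 [[|[|[|[|//]]]] im]; [move: P0|move: P1|move: P2|move: P3];
by congr P; apply: val_inj.
Qed.

Lemma ord3P (P : 'I_3 -> Prop) : P 0 -> P 1 -> P 2 -> forall i, P i.
Proof.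
move=> P0 P1 P2 [[|[|[|//]]] im]; [move: P0|move: P1|move: P2];
by congr P; apply: val_inj.
Qed.

Lemma quatE a b c d : (quat a b c d 0 0 = a) * (quat a b c d 1 0 = b) *
  (quat a b c d 2 0 = c) * (quat a b c d 3 0 = d).
Proof. by rewrite /quat !mxE. Qed.

Lemma vec3E a b c : (vec3 (a, b, c) 0 0 = a) * (vec3 (a, b, c) 1 0 = b) *
  (vec3 (a, b, c) 2 0 = c).
Proof. by rewrite /vec3 !mxE. Qed.

Lemma vec3P u v : u 0 0 = v 0 0 -> u 1 0 = v 1 0 -> u 2 0 = v 2 0 -> u = v.
Proof. by move=> h0 h1 h2; apply/colP; apply: ord3P. Qed.

Lemma quatP p q : p 0 0 = q 0 0 -> p 1 0 = q 1 0 -> p 2 0 = q 2 0 ->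
  p 3 0 = q 3 0 -> p = q.
Proof. by move=> h0 h1 h2 h3; apply/colP; apply: ord4P. Qed.

Lemma dotE4 p q : dot p q = p 0 0 * q 0 0 + p 1 0 * q 1 0 + p 2 0 * q 2 0 + p 3 0 * q 3 0.
Proof.
rewrite /dot !big_ord_recl big_ord0 addr0 !addrA.
by do ! congr (_ + _); congr (_ * _); congr fun_of_matrix; apply: val_inj.
Qed.

Lemma dotE3 u v : dot u v = u 0 0 * v 0 0 + u 1 0 * v 1 0 + u 2 0 * v 2 0.
Proof.
rewrite /dot !big_ord_recl big_ord0 addr0 !addrA.
by do ! congr (_ + _); congr (_ * _); congr fun_of_matrix; apply: val_inj.
Qed.

Lemma imag_partE q : imag_part q = vec3 (q 1 0, q 2 0, q 3 0).
Proof.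
by apply: vec3P; rewrite /vec3 !mxE /=; congr fun_of_matrix; apply: val_inj.
Qed.

Definition qi : 'cV[R]_4 := quat 0 1 0 0.
Definition qj : 'cV[R]_4 := quat 0 0 1 0.
Definition qk : 'cV[R]_4 := quat 0 0 0 1.

Definition det3 u v h : R :=
  u 0 0 * (v 1 0 * h 2 0 - v 2 0 * h 1 0) -
  v 0 0 * (u 1 0 * h 2 0 - u 2 0 * h 1 0) +
  h 0 0 * (u 1 0 * v 2 0 - u 2 0 * v 1 0).

Definition det4 p q r z : R :=
  p 0 0 * det3 (imag_part q) (imag_part r) (imag_part z) -
  q 0 0 * det3 (imag_part p) (imag_part r) (imag_part z) +
  r 0 0 * det3 (imag_part p) (imag_part q) (imag_part z) -
  z 0 0 * det3 (imag_part p) (imag_part q) (imag_part r).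

Lemma det_cols3 u v h : \det (cols [:: u; v; h]) = det3 u v h.
Proof.
rewrite (expand_det_row _ 0) !big_ord_recl big_ord0 /cofactor.
rewrite ![\det (row' _ _)](expand_det_row _ 0) !big_ord_recl !big_ord0 /cofactor.
rewrite !det_mx11 !mxE /= /det3.
have E (w : 'cV[R]_3) (i j : 'I_3) : val i = val j -> w i 0 = w j 0.
  by move=> ij; congr fun_of_matrix; exact: val_inj.
rewrite !(E _ (lift 0 (lift 0 0)) 2)// !(E _ (lift 0 0) 1)//.
rewrite /bump /=; set e1 := u 1 0.
ring.
Qed.

Lemma qmulA p q r : qmul p (qmul q r) = qmul (qmul p q) r.
Proof. by apply: quatP; rewrite /qmul !quatE; ring. Qed.

Lemma qmul1 p : qmul p qone = p.
Proof. by apply: quatP; rewrite /qmul /qone !quatE; ring. Qed.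

Lemma q1mul p : qmul qone p = p.
Proof. by apply: quatP; rewrite /qmul /qone !quatE; ring. Qed.

Lemma qconjM p q : qconj (qmul p q) = qmul (qconj q) (qconj p).
Proof. by apply: quatP; rewrite /qmul /qconj !quatE; ring. Qed.

Lemma qconjK p : qconj (qconj p) = p.
Proof. by apply: quatP; rewrite /qconj !quatE; ring. Qed.

Lemma qmul_conj p : sphere p -> qmul p (qconj p) = qone.
Proof.
rewrite /sphere /= dotE4 => p1.
by apply: quatP; rewrite /qmul /qconj /qone !quatE -?p1; ring.
Qed.

Lemma conj_qmul p : sphere p -> qmul (qconj p) p = qone.
Proof.
rewrite /sphere /= dotE4 => p1.
by apply: quatP; rewrite /qmul /qconj /qone !quatE -?p1; ring.
Qed.

Lemma dot_qmul2l z p q : dot (qmul z p) (qmul z q) = dot z z * dot p q.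
Proof. by rewrite !dotE4 /qmul !quatE; ring. Qed.

Lemma dot_qmul2r z p q : dot (qmul p z) (qmul q z) = dot z z * dot p q.
Proof. by rewrite !dotE4 /qmul !quatE; ring. Qed.

Lemma det4_qmul2r z p q r s : det4 (qmul p z) (qmul q z) (qmul r z) (qmul s z) =
  dot z z ^+ 2 * det4 p q r s.
Proof.
rewrite /det4 /det3 !imag_partE !vec3E dotE4 /qmul !quatE.
ring.
Qed.

(* The self-dual and anti-self-dual parts of the bivector p ^ q. *)
Definition sdual p q := imag_part (qmul q (qconj p)).
Definition asdual p q := imag_part (qmul (qconj p) q).

(** The wedge product is a quadratic form of signature (3, 3) on bivectors of R^4: it is positive on
    the self-dual ones and negative on the anti-self-dual ones. *)
Lemma det4_sdual p q r s : det4 p q r s *+ 2 =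
  dot (sdual p q) (sdual r s) - dot (asdual p q) (asdual r s).
Proof.
rewrite /det4 /det3 /sdual /asdual !imag_partE !dotE3 !vec3E /qmul /qconj !quatE.
ring.
Qed.

End Quaternions.

(** * Inner products and Gram-Schmidt *)

Section Frenet.
Context {R : realType}.
Implicit Types (p q r z : 'cV[R]_4) (u v h : 'cV[R]_3) (a b c d : R).

Lemma det_cols4 p q r z : \det (cols [:: p; q; r; z]) = det4 p q r z.
Proof.
set A := cols _.
have E0 : row' 0 (col' 0 A) = cols [:: imag_part q; imag_part r; imag_part z].
  by apply/matrixP => i; apply: ord3P; rewrite !mxE.
have E1 : row' 0 (col' (lift 0 0) A) = cols [:: imag_part p; imag_part r; imag_part z].
  by apply/matrixP => i; apply: ord3P; rewrite !mxE.
have E2 : row' 0 (col' (lift 0 (lift 0 0)) A) =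
    cols [:: imag_part p; imag_part q; imag_part z].
  by apply/matrixP => i; apply: ord3P; rewrite !mxE.
have E3 : row' 0 (col' (lift 0 (lift 0 (lift 0 0))) A) =
    cols [:: imag_part p; imag_part q; imag_part r].
  by apply/matrixP => i; apply: ord3P; rewrite !mxE.
rewrite (expand_det_row _ 0) !big_ord_recl big_ord0 /cofactor.
rewrite E0 E1 E2 E3 !det_cols3 !mxE /= /det4 /bump /=.
ring.
Qed.

Lemma det4_eq0 p q r z : det4 p q r z = 0 -> exists2 a : 'cV[R]_4, a != 0 &
  [/\ dot a p = 0, dot a q = 0, dot a r = 0 & dot a z = 0].
Proof.
rewrite -det_cols4 => /eqP/det0P[w w0 wA]; exists w^T.
  by apply: contra w0 => /eqP/(congr1 trmx); rewrite trmxK trmx0 => ->.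
have H (j : 'I_4) : dot w^T ([:: p; q; r; z]`_j) = 0.
  have := congr1 (fun A : 'M[R]_(1, 4) => A 0 j) wA; rewrite !mxE => wj.
  rewrite -[RHS]wj.
  by apply: eq_bigr => i _; rewrite !mxE.
by split; [exact: (H 0)|exact: (H 1)|exact: (H 2)|exact: (H 3)].
Qed.

Lemma dotC n (x y : 'cV[R]_n) : dot x y = dot y x.
Proof. by apply: eq_bigr => i _; rewrite mulrC. Qed.

Lemma dotDr n (x y z : 'cV[R]_n) : dot x (y + z) = dot x y + dot x z.
Proof. by rewrite /dot -big_split /=; apply: eq_bigr => i _; rewrite mxE mulrDr. Qed.

Lemma dotZr n (x y : 'cV[R]_n) a : dot x (a *: y) = a * dot x y.
Proof. by rewrite /dot mulr_sumr; apply: eq_bigr => i _; rewrite mxE mulrCA. Qed.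

Lemma dotDl n (x y z : 'cV[R]_n) : dot (x + y) z = dot x z + dot y z.
Proof. by rewrite dotC dotDr !(dotC z). Qed.

Lemma dotZl n (x y : 'cV[R]_n) a : dot (a *: x) y = a * dot x y.
Proof. by rewrite dotC dotZr dotC. Qed.

Lemma dotNl n (x y : 'cV[R]_n) : dot (- x) y = - dot x y.
Proof. by rewrite -scaleN1r dotZl mulN1r. Qed.

Lemma dot0r n (x : 'cV[R]_n) : dot x 0 = 0.
Proof. by rewrite /dot big1 // => i _; rewrite mxE mulr0. Qed.

Lemma dot_ge0 n (x : 'cV[R]_n) : 0 <= dot x x.
Proof. by apply: sumr_ge0 => i _; rewrite -expr2 sqr_ge0. Qed.

Lemma dot_eq0 n (x : 'cV[R]_n) : dot x x = 0 -> x = 0.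
Proof.
move=> /eqP; rewrite psumr_eq0; last by move=> i _; rewrite -expr2 sqr_ge0.
move=> /allP H; apply/colP => i; rewrite mxE; apply/eqP.
by have := H i (mem_index_enum _); rewrite mulf_eq0 orbb.
Qed.

Lemma dot_gt0 n (x : 'cV[R]_n) : x != 0 -> 0 < dot x x.
Proof.
by move=> x0; rewrite lt_neqAle dot_ge0 andbT eq_sym; apply: contra x0 => /eqP/dot_eq0 ->.
Qed.

Lemma normalize_neq0 n (w : 'cV[R]_n) : normalize w != 0 ->
  exists2 r, 0 < r & w = r *: normalize w.
Proof.
move=> w0; have {}w0 : w != 0.
  by apply: contra w0 => /eqP ->; rewrite /normalize scaler0.
exists (Num.sqrt (dot w w)); first by rewrite sqrtr_gt0 dot_gt0.
by rewrite /normalize scalerA divff ?scale1r// gt_eqF// sqrtr_gt0 dot_gt0.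
Qed.

Lemma sphere_normalize n (w : 'cV[R]_n) : w != 0 -> sphere (normalize w).
Proof.
move=> w0; rewrite /sphere /= /normalize dotZl dotZr mulrA -invfM -expr2.
by rewrite sqr_sqrtr ?dot_ge0// mulVf// gt_eqF// dot_gt0.
Qed.

Lemma normalizeZ n (w : 'cV[R]_n) (r : R) : 0 < r -> sphere w -> normalize (r *: w) = w.
Proof.
move=> r0 w1; rewrite /normalize dotZl dotZr w1 mulr1 -expr2 sqrtr_sqr gtr0_norm//.
by rewrite scalerA mulVf ?scale1r// gt_eqF.
Qed.

Lemma gram_schmidt_upper3 n (e0 e1 e2 : 'cV[R]_n) a00 a01 a11 a02 a12 a22 :
  sphere e0 -> sphere e1 -> sphere e2 ->
  dot e0 e1 = 0 -> dot e0 e2 = 0 -> dot e1 e2 = 0 ->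
  0 < a00 -> 0 < a11 -> 0 < a22 ->
  gram_schmidt [:: a00 *: e0; a01 *: e0 + a11 *: e1;
                   a02 *: e0 + a12 *: e1 + a22 *: e2] = [:: e0; e1; e2].
Proof.
move=> h0 h1 h2 h01 h02 h12 p0 p1 p2; rewrite /gram_schmidt /= big_nil subr0.
rewrite normalizeZ// !big_cons big_nil.
rewrite !dotDr !dotZr h0 h01 mulr1 mulr0 !addr0 addrAC subrr add0r normalizeZ//.
rewrite !big_nil h02 h12 (dotC e1 e0) h01 h1.
rewrite !mulr1 !mulr0 !addr0 !add0r addrC addrA.
by rewrite addNr add0r normalizeZ.
Qed.

(** Gram-Schmidt read backwards. Independence of the vectors is not assumed: [normalize 0] is 0, so
    nonzero outputs already force nonzero residues. *)
Lemma gram_schmidt4 n (v0 v1 v2 v3 c0 c1 c2 c3 : 'cV[R]_n) :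
  gram_schmidt [:: v0; v1; v2; v3] = [:: c0; c1; c2; c3] ->
  c0 != 0 -> c1 != 0 -> c2 != 0 -> c3 != 0 ->
  exists a00 a01 a11 a02 a12 a22 a03 a13 a23 a33,
  [/\ [/\ 0 < a00, 0 < a11, 0 < a22 & 0 < a33],
    v0 = a00 *: c0, v1 = a01 *: c0 + a11 *: c1,
    v2 = a02 *: c0 + a12 *: c1 + a22 *: c2 &
    v3 = a03 *: c0 + a13 *: c1 + a23 *: c2 + a33 *: c3].
Proof.
rewrite /gram_schmidt /= big_nil subr0.
case=> <-; rewrite !big_cons !big_nil !addr0.
set e0 := normalize v0.
set w1 := v1 - _; case=> <-; set e1 := normalize w1.
set w2 := v2 - _; case=> <-; set e2 := normalize w2.
set w3 := v3 - _; case=> <-; set e3 := normalize w3.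
move=> /normalize_neq0[a00 p0 E0] /normalize_neq0[a11 p1 E1].
move=> /normalize_neq0[a22 p2 E2] /normalize_neq0[a33 p3 E3].
exists a00, (dot e0 v1), a11, (dot e0 v2), (dot e1 v2), a22.
exists (dot e0 v3), (dot e1 v3), (dot e2 v3), a33.
split=> //; rewrite -?E1 -?E2 -?E3 /w1 /w2 /w3.
- by rewrite addrCA subrr addr0.
- by rewrite addrCA subrr addr0.
- by rewrite addrCA -(addrA (_ *: e0)) subrr addr0.
Qed.

End Frenet.

(** * The two coverings acting on bivectors *)

Section Pi34.
Context {R : realType}.
Implicit Types (p q r z : 'cV[R]_4) (u v h : 'cV[R]_3) (a b c d : R).

Lemma entryD n (x y : 'cV[R]_n) i : (x + y) i 0 = x i 0 + y i 0.
Proof. by rewrite mxE. Qed.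
Lemma entryZ n a (x : 'cV[R]_n) i : (a *: x) i 0 = a * x i 0.
Proof. by rewrite mxE. Qed.
Lemma entryN n (x : 'cV[R]_n) i : (- x) i 0 = - x i 0.
Proof. by rewrite mxE. Qed.
Lemma entry0 n i : (0 : 'cV[R]_n) i 0 = 0.
Proof. by rewrite mxE. Qed.
Definition entryE := (entryD, entryZ, entryN, entry0).

Lemma sdualDl p q r : sdual (p + q) r = sdual p r + sdual q r.
Proof. by rewrite /sdual !imag_partE; apply: vec3P; rewrite !entryE !vec3E /qmul /qconj !quatE ?entryE; ring. Qed.
Lemma sdualDr p q r : sdual r (p + q) = sdual r p + sdual r q.
Proof. by rewrite /sdual !imag_partE; apply: vec3P; rewrite !entryE !vec3E /qmul /qconj !quatE ?entryE; ring. Qed.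
Lemma sdualZl a p q : sdual (a *: p) q = a *: sdual p q.
Proof. by rewrite /sdual !imag_partE; apply: vec3P; rewrite !entryE !vec3E /qmul /qconj !quatE ?entryE; ring. Qed.
Lemma sdualZr a p q : sdual p (a *: q) = a *: sdual p q.
Proof. by rewrite /sdual !imag_partE; apply: vec3P; rewrite !entryE !vec3E /qmul /qconj !quatE ?entryE; ring. Qed.
Lemma sdualxx p : sdual p p = 0.
Proof. by rewrite /sdual !imag_partE; apply: vec3P; rewrite !entryE !vec3E /qmul /qconj !quatE ?entryE; ring. Qed.
Lemma sdualC p q : sdual p q = - sdual q p.
Proof. by rewrite /sdual !imag_partE; apply: vec3P; rewrite !entryE !vec3E /qmul /qconj !quatE ?entryE; ring. Qed.

Lemma asdualZr a p q : asdual p (a *: q) = a *: asdual p q.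
Proof. by rewrite /asdual !imag_partE; apply: vec3P; rewrite !entryE !vec3E /qmul /qconj !quatE ?entryE; ring. Qed.
Lemma asdualDr p q r : asdual r (p + q) = asdual r p + asdual r q.
Proof. by rewrite /asdual !imag_partE; apply: vec3P; rewrite !entryE !vec3E /qmul /qconj !quatE ?entryE; ring. Qed.
Lemma asdualxx p : asdual p p = 0.
Proof. by rewrite /asdual !imag_partE; apply: vec3P; rewrite !entryE !vec3E /qmul /qconj !quatE ?entryE; ring. Qed.

(** The columns of the rotation [Pi3 z]. For the left lift they are the point, the unit tangent and
    the unit normal of the left part. *)
Definition frame1 z : 'cV[R]_3 := Pi3 z (delta_mx 0 0).
Definition frame2 z : 'cV[R]_3 := Pi3 z (delta_mx 1 0).
Definition frame3 z : 'cV[R]_3 := Pi3 z (delta_mx 2 0).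

Lemma delta3E : (delta_mx 0 0 = vec3 (1, 0, 0) :> 'cV[R]_3) *
  (delta_mx 1 0 = vec3 (0, 1, 0) :> 'cV[R]_3) * (delta_mx 2 0 = vec3 (0, 0, 1) :> 'cV[R]_3).
Proof. by do ! split; apply: vec3P; rewrite vec3E mxE. Qed.

Lemma delta4E : (delta_mx 0 0 = qone :> 'cV[R]_4) * (delta_mx 1 0 = qi :> 'cV[R]_4) *
  (delta_mx 2 0 = qj :> 'cV[R]_4) * (delta_mx 3 0 = qk :> 'cV[R]_4).
Proof. by do ! split; apply: quatP; rewrite /qone /qi /qj /qk quatE mxE. Qed.

Lemma frame1E z : frame1 z = vec3
  (z 0 0 ^+ 2 + z 1 0 ^+ 2 - z 2 0 ^+ 2 - z 3 0 ^+ 2,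
   (z 1 0 * z 2 0 + z 0 0 * z 3 0) *+ 2, (z 1 0 * z 3 0 - z 0 0 * z 2 0) *+ 2).
Proof.
rewrite /frame1 delta3E /Pi3 imag_partE /imag_quat !vec3E /qmul /qconj !quatE.
by congr vec3; congr (_, _, _); ring.
Qed.

Lemma frame2E z : frame2 z = vec3
  ((z 1 0 * z 2 0 - z 0 0 * z 3 0) *+ 2,
   z 0 0 ^+ 2 - z 1 0 ^+ 2 + z 2 0 ^+ 2 - z 3 0 ^+ 2,
   (z 2 0 * z 3 0 + z 0 0 * z 1 0) *+ 2).
Proof.
rewrite /frame2 delta3E /Pi3 imag_partE /imag_quat !vec3E /qmul /qconj !quatE.
by congr vec3; congr (_, _, _); ring.
Qed.

Lemma frame3E z : frame3 z = vec3
  ((z 1 0 * z 3 0 + z 0 0 * z 2 0) *+ 2, (z 2 0 * z 3 0 - z 0 0 * z 1 0) *+ 2,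
   z 0 0 ^+ 2 - z 1 0 ^+ 2 - z 2 0 ^+ 2 + z 3 0 ^+ 2).
Proof.
rewrite /frame3 delta3E /Pi3 imag_partE /imag_quat !vec3E /qmul /qconj !quatE.
by congr vec3; congr (_, _, _); ring.
Qed.

Lemma Pi3_frame z h : Pi3 z h =
  h 0 0 *: frame1 z + h 1 0 *: frame2 z + h 2 0 *: frame3 z.
Proof.
rewrite frame1E frame2E frame3E /Pi3 imag_partE.
by apply: vec3P; rewrite !entryE !vec3E /imag_quat /qmul /qconj !quatE; ring.
Qed.

Lemma frame_orthonormal z : sphere z ->
  [/\ sphere (frame1 z), sphere (frame2 z) & sphere (frame3 z)] /\
  [/\ dot (frame1 z) (frame2 z) = 0, dot (frame1 z) (frame3 z) = 0 &
      dot (frame2 z) (frame3 z) = 0].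
Proof.
rewrite /sphere /= => z1.
have E1 : 1 = dot z z ^+ 2 by rewrite z1 expr1n.
by split; split; rewrite ?{}E1 ?dotE4 ?frame1E ?frame2E ?frame3E dotE3 !vec3E; ring.
Qed.

Lemma det3_frame z : det3 (frame1 z) (frame2 z) (frame3 z) = dot z z ^+ 3.
Proof. rewrite frame1E frame2E frame3E dotE4 /det3 !vec3E; ring. Qed.

(** In (z q w^-1)(z p w^-1)^-1 the factor w cancels, so that only z acts, by conjugation, on
    self-dual parts. In [asdual_Pi4] it is z that cancels. *)
Lemma sdual_Pi4 (z w : 'cV[R]_4) : sphere w ->
  [/\ sdual (Pi4 (z, w) qone) (Pi4 (z, w) qi) = frame1 z,
      sdual (Pi4 (z, w) qone) (Pi4 (z, w) qj) = frame2 z,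
      sdual (Pi4 (z, w) qone) (Pi4 (z, w) qk) = frame3 z &
      sdual (Pi4 (z, w) qi) (Pi4 (z, w) qj) = frame3 z].
Proof.
move=> w1.
have E p q : sdual (Pi4 (z, w) p) (Pi4 (z, w) q) =
    imag_part (qmul (qmul z (qmul q (qconj p))) (qconj z)).
  rewrite /sdual /Pi4 /= !qconjM qconjK !qmulA -(qmulA (qmul z q)) conj_qmul//.
  by rewrite qmul1.
have H1 : qmul qi (qconj qone) = imag_quat (delta_mx 0 0) :> 'cV[R]_4.
  by rewrite delta3E /imag_quat !vec3E; apply: quatP; rewrite /qmul /qconj !quatE; ring.
have H2 : qmul qj (qconj qone) = imag_quat (delta_mx 1 0) :> 'cV[R]_4.
  by rewrite delta3E /imag_quat !vec3E; apply: quatP; rewrite /qmul /qconj !quatE; ring.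
have H3 : qmul qk (qconj qone) = imag_quat (delta_mx 2 0) :> 'cV[R]_4.
  by rewrite delta3E /imag_quat !vec3E; apply: quatP; rewrite /qmul /qconj !quatE; ring.
have H4 : qmul qj (qconj qi) = imag_quat (delta_mx 2 0) :> 'cV[R]_4.
  by rewrite delta3E /imag_quat !vec3E; apply: quatP; rewrite /qmul /qconj !quatE; ring.
by split; rewrite E ?H1 ?H2 ?H3 ?H4.
Qed.

Lemma asdual_Pi4 (z w : 'cV[R]_4) : sphere z ->
  asdual (Pi4 (z, w) qone) (Pi4 (z, w) qi) = frame1 w.
Proof.
move=> z1; rewrite /asdual /Pi4 /= !qconjM qconjK !qmulA -(qmulA _ (qconj z) z).
rewrite conj_qmul// qmul1 /frame1 /Pi3; congr (imag_part (qmul _ _)).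
rewrite -qmulA; congr qmul.
by rewrite delta3E /imag_quat !vec3E; apply: quatP; rewrite /qmul /qconj !quatE; ring.
Qed.

End Pi34.

(** * The left part *)

Section LeftPart.
Context {R : realType} (gamma : R -> 'cV[R]_4) (G : R -> 'cV[R]_4 * 'cV[R]_4).
Context (gsmooth : smooth01 gamma) (gsphere : forall t, unit_itv t -> sphere (gamma t)).
Context (lift : lifted_frenet4 gamma G).
Implicit Types (s t : R).

Let g k := deriv01n k gamma.

Lemma dot_Pi4 (z w p q : 'cV[R]_4) : sphere z -> sphere w ->
  dot (Pi4 (z, w) p) (Pi4 (z, w) q) = dot p q.
Proof.
move=> z1 w1; have w1' : sphere (qconj w).
  by move: w1; rewrite /sphere /= !dotE4 /qconj !quatE !mulrNN.
by rewrite /Pi4 /= dot_qmul2r dot_qmul2l z1 w1' !mul1r.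
Qed.

Lemma sphere_lift t : unit_itv t -> sphere (G t).1 /\ sphere (G t).2.
Proof. by have [_ _ + _] := lift; exact. Qed.

Lemma frenet_lift t (j : 'I_4) : unit_itv t ->
  (gram_schmidt (jet gamma t))`_j = Pi4 (G t) (delta_mx j 0).
Proof.
move=> It; have [_ _ _ /(_ t It) ->] := lift.
by rewrite -colE; apply/colP => i; rewrite !mxE.
Qed.

Lemma jet4E t : jet gamma t = [:: g 0 t; g 1 t; g 2 t; g 3 t].
Proof. by []. Qed.

Lemma frame_neq0 t (q : 'cV[R]_4) : unit_itv t -> sphere q -> Pi4 (G t) q != 0.
Proof.
move=> It q1; have [z1 w1] := sphere_lift It; apply/eqP => H.
have := dot_Pi4 q q z1 w1; rewrite -surjective_pairing H dot0r q1 => /esym/eqP.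
by rewrite oner_eq0.
Qed.

Lemma sphere_qbasis : [/\ sphere (qone : 'cV[R]_4), sphere (qi : 'cV[R]_4),
  sphere (qj : 'cV[R]_4) & sphere (qk : 'cV[R]_4)].
Proof.
by rewrite /sphere /= !dotE4 /qone /qi /qj /qk !quatE; split; ring.
Qed.

Lemma jet_frame t : unit_itv t -> exists a01 a11 a02 a12 a22 a03 a13 a23 a33,
  [/\ [/\ 0 < a11, 0 < a22 & 0 < a33],
    g 0 t = Pi4 (G t) qone,
    g 1 t = a01 *: Pi4 (G t) qone + a11 *: Pi4 (G t) qi,
    g 2 t = a02 *: Pi4 (G t) qone + a12 *: Pi4 (G t) qi + a22 *: Pi4 (G t) qj &
    g 3 t = a03 *: Pi4 (G t) qone + a13 *: Pi4 (G t) qi + a23 *: Pi4 (G t) qj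
             + a33 *: Pi4 (G t) qk].
Proof.
move=> It.
have [n0 n1 n2 n3] := sphere_qbasis.
have := frenet_lift 0 It; have := frenet_lift 1 It.
have := frenet_lift 2 It; have := frenet_lift 3 It.
rewrite !delta4E jet4E.
case E : (gram_schmidt _) => [|c0 [|c1 [|c2 [|c3 [|]]]]]; try by rewrite /gram_schmidt /= in E.
move=> /= E3 E2 E1 E0; move: E; rewrite E0 E1 E2 E3 => /gram_schmidt4.
move=> /(_ (frame_neq0 It n0) (frame_neq0 It n1) (frame_neq0 It n2) (frame_neq0 It n3)).
move=> [a00 [a01 [a11 [a02 [a12 [a22 [a03 [a13 [a23 [a33 [[p0 p1 p2 p3] H0 H1 H2 H3]]]]]]]]]]].
exists a01, a11, a02, a12, a22, a03, a13, a23, a33; split => //.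
have [z1 w1] := sphere_lift It.
(* The unit norm of gamma gives a00 ^+ 2 = 1, and positivity selects a00 = 1. *)
have : dot (g 0 t) (g 0 t) = 1 by exact: gsphere.
rewrite {1 2}H0 dotZl dotZr [G t]surjective_pairing dot_Pi4// n0 mulr1 => /eqP.
rewrite -expr2 sqrf_eq1 => /orP[/eqP a1|/eqP a1]; last by move: p0; rewrite a1 ltr0N1.
by rewrite -surjective_pairing -[LHS]/(g 0 t) H0 a1 scale1r.
Qed.

Lemma has_deriv_jet k t : unit_itv t -> has_deriv01 (g k) t (g k.+1 t).
Proof. exact: smooth01_has_deriv. Qed.

Lemma has_deriv01_congr (f h : R -> R) t (l m : R) : f =1 h -> l = m ->
  has_deriv01 f t l -> has_deriv01 h t m.
Proof. by move=> /funext -> ->. Qed.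

Lemma has_deriv01_sdual (f h : R -> 'cV[R]_4) t (f' h' : 'cV[R]_4) :
  has_deriv01 f t f' -> has_deriv01 h t h' ->
  has_deriv01 (fun s => sdual (f s) (h s)) t (sdual f' (h t) + sdual (f t) h').
Proof.
move=> /has_deriv01_coordP fd /has_deriv01_coordP hd.
pose m (i j : 'I_4) := has_deriv01M (fd i) (hd j).
pose mN (i j : 'I_4) := has_deriv01M (has_deriv01_cst (-1 : R) t) (m i j).
apply/has_deriv01_coordP; apply: ord3P.
- apply: has_deriv01_congr (has_deriv01D (has_deriv01D (m 0 1) (mN 1 0)) (has_deriv01D (m 2 3) (mN 3 2))).
    by move=> s; rewrite /sdual imag_partE vec3E /qmul /qconj !quatE; ring.
  by rewrite entryE /sdual !imag_partE !vec3E /qmul /qconj !quatE; ring.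
- apply: has_deriv01_congr (has_deriv01D (has_deriv01D (m 0 2) (mN 2 0)) (has_deriv01D (m 3 1) (mN 1 3))).
    by move=> s; rewrite /sdual imag_partE vec3E /qmul /qconj !quatE; ring.
  by rewrite entryE /sdual !imag_partE !vec3E /qmul /qconj !quatE; ring.
- apply: has_deriv01_congr (has_deriv01D (has_deriv01D (m 0 3) (mN 3 0)) (has_deriv01D (m 1 2) (mN 2 1))).
    by move=> s; rewrite /sdual imag_partE vec3E /qmul /qconj !quatE; ring.
  by rewrite entryE /sdual !imag_partE !vec3E /qmul /qconj !quatE; ring.
Qed.

Lemma has_deriv01Z n (f : R -> R) (h : R -> 'cV[R]_n) t (f' : R) (h' : 'cV[R]_n) :
  has_deriv01 f t f' -> has_deriv01 h t h' ->
  has_deriv01 (fun s => f s *: h s) t (f' *: h t + f t *: h').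
Proof.
move=> fd /has_deriv01_coordP hd; apply/has_deriv01_coordP => i.
rewrite entryD !entryZ (_ : (fun s => _) = fun s => f s * h s i 0).
  exact: has_deriv01M.
by apply/funext => s; rewrite entryZ.
Qed.

Definition sd s := sdual (g 0 s) (g 1 s).
Definition isd s : R := (Num.sqrt (dot (sd s) (sd s)))^-1.

(** The three left-hand sides are [sd] and its first two derivatives. The bivectors e0 ^ e3 and e1 ^
    e2 have the same self-dual part [frame3], so their positive coefficients a33 and a11 * a22 add
    up in b3: this is how local convexity passes to the left part. *)
Lemma sd_frame t : unit_itv t -> exists a11 a12 a22 b1 b2 b3,
  [/\ [/\ 0 < a11, 0 < a22 & 0 < b3], sd t = a11 *: frame1 (G t).1,
    sdual (g 0 t) (g 2 t) = a12 *: frame1 (G t).1 + a22 *: frame2 (G t).1 &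
    sdual (g 0 t) (g 3 t) + sdual (g 1 t) (g 2 t) =
      b1 *: frame1 (G t).1 + b2 *: frame2 (G t).1 + b3 *: frame3 (G t).1].
Proof.
move=> It; have [z1 w1] := sphere_lift It.
have [a01 [a11 [a02 [a12 [a22 [a03 [a13 [a23 [a33 [[p1 p2 p3] H0 H1 H2 H3]]]]]]]]]] := jet_frame It.
have [S1 S2 S3 S4] := sdual_Pi4 (G t).1 w1.
rewrite -!surjective_pairing in S1 S2 S3 S4.
exists a11, a12, a22, (a13 + (a01 * a12 - a11 * a02)), (a23 + a01 * a22), (a33 + a11 * a22).
split.
- by split=> //; rewrite addr_gt0// mulr_gt0.
- by rewrite /sd H0 H1 sdualDr !sdualZr sdualxx S1 scaler0 add0r.
- by rewrite H0 H2 !sdualDr !sdualZr sdualxx S1 S2 scaler0 add0r.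
rewrite H0 H1 H2 H3 !(sdualDr, sdualDl) !sdualZr !sdualZl !sdualxx S1 S2 S3 S4.
rewrite (sdualC (Pi4 _ qi) (Pi4 _ qone)) S1.
by apply/colP => i; rewrite !entryE; ring.
Qed.

Lemma dot_sd_gt0 t : unit_itv t -> 0 < dot (sd t) (sd t).
Proof.
move=> It; have [z1 w1] := sphere_lift It.
have [a11 [a12 [a22 [b1 [b2 [b3 [[p1 p2 p3] H1 H2 H3]]]]]]] := sd_frame It.
have [[f1 _ _] _] := frame_orthonormal z1.
by rewrite H1 dotZl dotZr f1 mulr1 mulr_gt0.
Qed.

Lemma isd_gt0 t : unit_itv t -> 0 < isd t.
Proof. by move=> It; rewrite invr_gt0 sqrtr_gt0 dot_sd_gt0. Qed.

(** The lift is only continuous; this formula in the jet of gamma is the source of the smoothness of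
    the left part. *)
Lemma left_partE t : unit_itv t -> left_part G t = isd t *: sd t.
Proof.
move=> It; have [z1 w1] := sphere_lift It.
have [a11 [a12 [a22 [b1 [b2 [b3 [[p1 p2 p3] H1 H2 H3]]]]]]] := sd_frame It.
have [[f1 _ _] _] := frame_orthonormal z1.
by rewrite -[RHS]/(normalize (sd t)) H1 normalizeZ.
Qed.

Lemma differentiable01n_sd n : differentiable01n n sd.
Proof.
apply/differentiable01n_coordP.
have d k (i : 'I_4) : differentiable01n n (fun s => g k s i 0).
  by have /differentiable01n_coordP := @differentiable01n_deriv R _ k n _ gsmooth; exact.
pose m (i j : 'I_4) := differentiable01nM (d 0%N i) (d 1%N j).
pose mN (i j : 'I_4) := differentiable01nM (@differentiable01n_cst R _ n (-1 : R)) (m i j).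
apply: ord3P.
- apply: differentiable01n_ext (differentiable01nD (differentiable01nD (m 0 1) (mN 1 0)) (differentiable01nD (m 2 3) (mN 3 2))).
  by move=> s _; rewrite /sd /sdual imag_partE vec3E /qmul /qconj !quatE; ring.
- apply: differentiable01n_ext (differentiable01nD (differentiable01nD (m 0 2) (mN 2 0)) (differentiable01nD (m 3 1) (mN 1 3))).
  by move=> s _; rewrite /sd /sdual imag_partE vec3E /qmul /qconj !quatE; ring.
- apply: differentiable01n_ext (differentiable01nD (differentiable01nD (m 0 3) (mN 3 0)) (differentiable01nD (m 1 2) (mN 2 1))).
  by move=> s _; rewrite /sd /sdual imag_partE vec3E /qmul /qconj !quatE; ring.
Qed.

Lemma differentiable01n_isd n : differentiable01n n isd.
Proof.
apply: differentiable01n_rsqrt; first exact: dot_sd_gt0.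
have /differentiable01n_coordP d := @differentiable01n_sd n.
apply: differentiable01n_ext (differentiable01nD (differentiable01nD
  (differentiable01nM (d 0) (d 0)) (differentiable01nM (d 1) (d 1))) (differentiable01nM (d 2) (d 2))).
by move=> s _; rewrite dotE3.
Qed.

Lemma left_part_smooth : smooth01 (left_part G).
Proof.
apply/smooth01P => n; apply/differentiable01n_coordP => i.
have /differentiable01n_coordP d := @differentiable01n_sd n.
apply: differentiable01n_ext (differentiable01nM (@differentiable01n_isd n) (d i)).
by move=> s; rewrite inE => Is; rewrite left_partE// entryZ.
Qed.

Lemma left_part_jet t : unit_itv t -> exists b01 b11 b02 b12 b22,
  [/\ 0 < b11, 0 < b22, deriv01n 1 (left_part G) t = b01 *: frame1 (G t).1 + b11 *: frame2 (G t).1 &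
    deriv01n 2 (left_part G) t = b02 *: frame1 (G t).1 + b12 *: frame2 (G t).1 + b22 *: frame3 (G t).1].
Proof.
have i1 s : unit_itv s -> has_deriv01 isd s (deriv01 isd s).
  by have /differentiable01nS[+ _] := @differentiable01n_isd 1; exact.
have i2 s : unit_itv s -> has_deriv01 (deriv01 isd) s (deriv01n 2 isd s).
  by have /differentiable01nS[_ /differentiable01nS[+ _]] := @differentiable01n_isd 2; exact.
pose sd1 s := sdual (g 0 s) (g 2 s).
pose sd2 s := sdual (g 0 s) (g 3 s) + sdual (g 1 s) (g 2 s).
have d1 s : unit_itv s -> has_deriv01 sd s (sd1 s).
  move=> Is; have := has_deriv01_sdual (@has_deriv_jet 0 _ Is) (@has_deriv_jet 1 _ Is).
  by rewrite sdualxx add0r.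
have d2 s : unit_itv s -> has_deriv01 sd1 s (sd2 s).
  move=> Is; have := has_deriv01_sdual (@has_deriv_jet 0 _ Is) (@has_deriv_jet 2 _ Is).
  by rewrite addrC.
have l1 s : unit_itv s -> has_deriv01 (left_part G) s (deriv01 isd s *: sd s + isd s *: sd1 s).
  move=> Is; apply: (has_deriv01_ext Is _ (has_deriv01Z (i1 s Is) (d1 s Is))).
  by move=> x; rewrite inE => Ix; rewrite left_partE.
have l2 s : unit_itv s -> has_deriv01 (deriv01 (left_part G)) s
    (deriv01n 2 isd s *: sd s + deriv01 isd s *: sd1 s + (deriv01 isd s *: sd1 s + isd s *: sd2 s)).
  move=> Is; apply: (has_deriv01_ext Is _ (has_deriv01D (has_deriv01Z (i2 s Is) (d1 s Is))
    (has_deriv01Z (i1 s Is) (d2 s Is)))).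
  by move=> x; rewrite inE => Ix; rewrite (deriv01_eq Ix (l1 x Ix)).
move=> It; have iP := isd_gt0 It.
have [a11 [a12 [a22 [b1 [b2 [b3 [[p1 p2 p3] H1 H2 H3]]]]]]] := sd_frame It.
have E1 : deriv01n 1 (left_part G) t = _ := deriv01_eq It (l1 t It).
have E2 : deriv01n 2 (left_part G) t = _ := deriv01_eq It (l2 t It).
have H2' : sd1 t = _ := H2.
have H3' : sd2 t = _ := H3.
rewrite {}E1 {}E2 {}H1 {}H2' {}H3' {H2 H3}.
move: (deriv01n 2 isd t) (deriv01 isd t) (isd t) iP => x2 x1 x0 iP.
move: (frame1 _) (frame2 _) (frame3 _) => f1 f2 f3.
exists (x1 * a11 + x0 * a12), (x0 * a22).
exists (x2 * a11 + x1 * a12 *+ 2 + x0 * b1), (x1 * a22 *+ 2 + x0 * b2), (x0 * b3).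
split; first exact: mulr_gt0; first exact: mulr_gt0.
- by apply/colP => i; rewrite !entryE; ring.
- by apply/colP => i; rewrite !entryE; ring.
Qed.

Lemma frenet_left_part t : unit_itv t ->
  frenet (left_part G) t = cols [:: frame1 (G t).1; frame2 (G t).1; frame3 (G t).1].
Proof.
move=> It; have [z1 w1] := sphere_lift It.
have [b01 [b11 [b02 [b12 [b22 [p1 p2 H1 H2]]]]]] := left_part_jet It.
have [[f1 f2 f3] [f12 f13 f23]] := frame_orthonormal z1.
rewrite /frenet; congr cols.
rewrite -(@gram_schmidt_upper3 _ _ (frame1 (G t).1) (frame2 (G t).1) (frame3 (G t).1) 1 b01 b11 b02 b12 b22)//.
by rewrite scale1r -H1 -H2.
Qed.

Lemma frenet_left_part_Pi3 t h : unit_itv t -> Pi3 (G t).1 h = frenet (left_part G) t *m h.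
Proof.
move=> It; rewrite frenet_left_part// Pi3_frame; apply/colP => i.
rewrite !entryE [in RHS]mxE !big_ord_recl big_ord0 ![cols _ _ _]mxE /= addr0 !addrA.
by congr (_ + _ + _); rewrite mulrC; congr (_ * _); congr fun_of_matrix; apply: val_inj.
Qed.

Lemma det3_left_part t : unit_itv t ->
  0 < det3 (left_part G t) (deriv01n 1 (left_part G) t) (deriv01n 2 (left_part G) t).
Proof.
move=> It; have [z1 w1] := sphere_lift It.
have [b01 [b11 [b02 [b12 [b22 [p1 p2 -> ->]]]]]] := left_part_jet It.
rewrite -[left_part G t]/(frame1 (G t).1).
rewrite [X in _ < X](_ : _ = b11 * b22 * det3 (frame1 (G t).1) (frame2 (G t).1) (frame3 (G t).1)).
  by rewrite det3_frame z1 expr1n mulr1 mulr_gt0.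
by rewrite /det3 !entryE; ring.
Qed.

Lemma left_part_locally_convex : Defs.locally_convex (left_part G).
Proof.
split; first split.
- exact: left_part_smooth.
- move=> t It; have [z1 w1] := sphere_lift It.
  by have [[f1 _ _] _] := frame_orthonormal z1.
- move=> t It; rewrite (_ : jet _ _ = [:: left_part G t; deriv01n 1 (left_part G) t; deriv01n 2 (left_part G) t])//.
  by rewrite det_cols3 det3_left_part.
Qed.

End LeftPart.

(** * Convexity *)

Section Lifts.
Context {R : realType}.

(** The kernel of the covering is (1, 1) up to sign: with p = z'^-1 z and r = w'^-1 w the hypothesis
    reads p q = q r for all q, hence p = r is central, that is, real. *)
Lemma Pi4_eq (z w z' w' : 'cV[R]_4) :
  sphere z -> sphere w -> sphere z' -> sphere w' ->
  (forall q, Pi4 (z, w) q = Pi4 (z', w') q) ->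
  [/\ dot z z' ^+ 2 = 1, z = dot z z' *: z' & w = dot z z' *: w'].
Proof.
move=> z1 w1 z1' w1' H.
pose p := qmul (qconj z') z; pose r := qmul (qconj w') w.
have pr q : qmul p q = qmul q r.
  have := congr1 (fun x => qmul (qmul (qconj z') x) w) (H q).
  rewrite /Pi4 /= !qmulA -(qmulA _ (qconj w) w) conj_qmul// qmul1 => ->.
  by rewrite conj_qmul// q1mul -qmulA.
have p_r : p = r by have := pr qone; rewrite qmul1 q1mul.
have pC q : qmul p q = qmul q p by rewrite {2}p_r pr.
have [p1 p2 p3] : [/\ p 1 0 = 0, p 2 0 = 0 & p 3 0 = 0].
  have := congr1 (fun x : 'cV[R]_4 => x 3 0) (pC qi).
  have := congr1 (fun x : 'cV[R]_4 => x 2 0) (pC qi).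
  have := congr1 (fun x : 'cV[R]_4 => x 3 0) (pC qj).
  rewrite /qmul /qi /qj !quatE => h1 h2 h3; split; lra.
have p0 : p 0 0 = dot z z'.
  by rewrite /p dotE4 /qmul /qconj !quatE; ring.
have pE : p = quat (dot z z') 0 0 0 by apply: quatP; rewrite quatE.
have zE : z = dot z z' *: z'.
  rewrite -[LHS]q1mul -(qmul_conj z1') -qmulA -/p pE; apply: quatP;
  by rewrite entryE /qmul !quatE; ring.
have wE : w = dot z z' *: w'.
  rewrite -[LHS]q1mul -(qmul_conj w1') -qmulA -/r -p_r pE; apply: quatP;
  by rewrite entryE /qmul !quatE; ring.
split => //; move: z1; rewrite /sphere /= {1 2}zE dotZl dotZr z1' mulr1 => <-.
by rewrite expr2.
Qed.

Lemma lift_continuous (gamma : R -> 'cV[R]_4) (G : R -> 'cV[R]_4 * 'cV[R]_4)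
  (i : 'I_4) : lifted_frenet4 gamma G ->
  continuous (fun t => (G (clamp01 t)).1 i 0) /\
  continuous (fun t => (G (clamp01 t)).2 i 0).
Proof.
move=> [/within_continuous_clamp Gc _ _ _]; split=> t.
- apply: (@cvg_comp _ _ _ (fun t => (G (clamp01 t)).1) (fun M : 'cV[R]_4 => M i 0)); last exact: coord_continuous.
  by apply: (@cvg_comp _ _ _ (fun t => G (clamp01 t)) fst); [exact: Gc|exact: cvg_fst].
- apply: (@cvg_comp _ _ _ (fun t => (G (clamp01 t)).2) (fun M : 'cV[R]_4 => M i 0)); last exact: coord_continuous.
  by apply: (@cvg_comp _ _ _ (fun t => G (clamp01 t)) snd); [exact: Gc|exact: cvg_snd].
Qed.

(** Two lifts differ by a sign which is continuous in t and equal to 1 at 0; by the intermediate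
    value theorem it cannot jump to -1. *)
Lemma lift_unique (gamma : R -> 'cV[R]_4) (G G' : R -> 'cV[R]_4 * 'cV[R]_4) :
  lifted_frenet4 gamma G -> lifted_frenet4 gamma G' -> G 1 = G' 1.
Proof.
move=> L L'; have [_ G0 Gs GF] := L; have [_ G0' Gs' GF'] := L'.
have I0 : unit_itv (0 : R) by apply/unit_itvP; rewrite lexx ler01.
have I1 : unit_itv (1 : R) by apply/unit_itvP; rewrite lexx ler01.
have E t : unit_itv t -> [/\ dot (G t).1 (G' t).1 ^+ 2 = 1,
    (G t).1 = dot (G t).1 (G' t).1 *: (G' t).1 &
    (G t).2 = dot (G t).1 (G' t).1 *: (G' t).2].
  move=> It; have [z1 w1] := Gs t It; have [z1' w1'] := Gs' t It.
  apply: Pi4_eq => // q; rewrite -!surjective_pairing.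
  by rewrite GF// GF'.
pose sg t := dot (G (clamp01 t)).1 (G' (clamp01 t)).1.
have sgc : continuous sg.
  have c i := (lift_continuous i L).1; have c' i := (lift_continuous i L').1.
  rewrite /sg => t; under eq_fun do rewrite dotE4.
  by do 3 (apply: cvgD; last (apply: cvgM; [exact: c|exact: c'])); apply: cvgM; [exact: c|exact: c'].
have s0 : sg 0 = 1.
  by rewrite /sg clamp01_id// G0 G0' /= dotE4 /qone !quatE; ring.
have [e1 e2 e3] := E 1 I1.
have : sg 1 = 1.
  have /eqP := e1; rewrite sqrf_eq1 /sg clamp01_id// => /orP[/eqP->//|/eqP s1].
  have [||c cI] := @IVT R sg 0 1 0 ler01.
  - by apply: continuous_subspaceT.
  - by rewrite s0 {1 2}/sg clamp01_id// s1 ge_min le_max lerN10 ler01 orbT.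
  rewrite /sg clamp01_id; last by rewrite /unit_itv /= -topredE.
  have Ic : unit_itv c by [].
  have [+ _ _] := E c Ic => + c0; rewrite c0 expr0n => /eqP.
  by rewrite eq_sym oner_eq0.
rewrite /sg clamp01_id// => s1; rewrite s1 !scale1r in e2 e3.
by rewrite [G 1]surjective_pairing e2 e3 -surjective_pairing.
Qed.

Lemma itv01W (t : R) : 0 < t < 1 -> unit_itv t.
Proof. by move=> /andP[t0 t1]; apply/unit_itvP; rewrite !ltW. Qed.

(* With q k l = det4 (g s) (g' s) (g^(k) t) (g^(l) t), the derivatives of q 0 1
   up to order 3 vanish at s and the fourth one is 2 q 2 3. *)
Lemma fourth_order_gt0_right (q : nat -> nat -> R -> R) (s : R) : 0 < s < 1 ->
  (forall k l t, unit_itv t -> has_deriv01 (q k l) t (q k.+1 l t + q k l.+1 t)) ->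
  (forall k t, q k k t = 0) -> (forall l, q 0 l s = 0) -> (forall l, q 1 l s = 0) ->
  0 < q 2 3 s ->
  exists2 e, s < e < 1 & forall t, s < t < e -> 0 < q 0 1 t.
Proof.
move=> s01 dq qkk z0 z1 q23.
pose f0 := q 0 1; pose f1 := q 0 2.
pose f2 t := q 1 2 t + q 0 3 t.
pose f3 t := q 1 3 t + q 1 3 t + q 0 4 t.
pose f4 t := (q 2 3 t + q 1 4 t) + (q 2 3 t + q 1 4 t) + (q 1 4 t + q 0 5 t).
have d0 t : unit_itv t -> has_deriv01 f0 t (f1 t).
  by move=> It; have := dq 0 1 t It; rewrite qkk add0r.
have d1 t : unit_itv t -> has_deriv01 f1 t (f2 t) by exact: dq.
have d2 t : unit_itv t -> has_deriv01 f2 t (f3 t).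
  move=> It; have := has_deriv01D (dq 1 2 t It) (dq 0 3 t It).
  by rewrite qkk add0r addrA.
have d3 t : unit_itv t -> has_deriv01 f3 t (f4 t).
  by move=> It; exact: has_deriv01D (has_deriv01D (dq 1 3 t It) (dq 1 3 t It)) (dq 0 4 t It).
(* A derivative of [f4] at s is wanted only for the continuity that keeps [f4] positive just after
   s. *)
have [df d4] : exists df, has_deriv01 f4 s df.
  have Is := itv01W s01; eexists.
  exact: (has_deriv01D (has_deriv01D (has_deriv01D (dq 2 3 s Is) (dq 1 4 s Is))
    (has_deriv01D (dq 2 3 s Is) (dq 1 4 s Is)))
    (has_deriv01D (dq 1 4 s Is) (dq 0 5 s Is))).
have f4s : 0 < f4 s by rewrite /f4 z0 !z1 !addr0 addr_gt0.
have [e /andP[se e1] He] : exists2 e, s < e < 1 & forall t, s < t < e -> 0 < f4 t.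
  have : \forall t \near within unit_itv s^', 0 < f4 t.
    exact: (@cvgr_gt _ R _ _ f4 (f4 s) (has_deriv01_cvg d4) 0 f4s).
  rewrite near_withinE => /nbhs_ballP[e /= e0 eH].
  move/andP: s01 => [s0 s1].
  exists (Num.min (s + e) ((s + 1) / 2)).
    rewrite lt_min gt_min; apply/andP; split; first (apply/andP; split); try lra.
  move=> t; rewrite lt_min => /and3P[st te t1].
  apply: eH.
  - by rewrite /ball /= distrC gtr0_norm ?subr_gt0//; lra.
  - by rewrite gt_eqF.
  - by apply/unit_itvP; apply/andP; split; lra.
exists e; first by rewrite se.
have st01 t : s <= t < e -> 0 < t < 1.
  by move=> /andP[st te]; move/andP: s01 => [s0 s1]; apply/andP; split; lra.
have up (f df' : R -> R) : (forall t, unit_itv t -> has_deriv01 f t (df' t)) ->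
    f s = 0 -> (forall t, s < t < e -> 0 < df' t) -> forall t, s < t < e -> 0 < f t.
  move=> fd; apply: derive_gt0_right => t ste.
  by apply: has_deriv01_is_derive (st01 t ste) (fd t _); exact: itv01W (st01 t ste).
have p3 : forall t, s < t < e -> 0 < f3 t.
  by apply: up d3 _ He; rewrite /f3 !z1 z0 !addr0.
have p2 : forall t, s < t < e -> 0 < f2 t.
  by apply: up d2 _ p3; rewrite /f2 z1 z0 addr0.
have p1 : forall t, s < t < e -> 0 < f1 t by exact: up d1 (z0 _) p2.
exact: up d0 (z0 _) p1.
Qed.

End Lifts.

Section Convexity.
Context {R : realType} (gamma : R -> 'cV[R]_4) (G : R -> 'cV[R]_4 * 'cV[R]_4).
Context (glc : Defs.locally_convex gamma) (gconvex : globally_convex gamma).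
Context (lift : lifted_frenet4 gamma G).
Implicit Types (s t : R).

Let gsmooth : smooth01 gamma. Proof. by case: glc => -[]. Qed.
Let gsphere t : unit_itv t -> sphere (gamma t). Proof. by case: glc => -[_ +] _; exact. Qed.
Let g k := deriv01n k gamma.

(** Convexity in the form in which it is applied: lower bounds on the multiplicities at finitely
    many interior times are enough, and a time of infinite contact, where the infimum is over the
    empty set, satisfies them too. *)
Lemma contact_le (a : 'cV[R]_4) (r : seq R) (m : R -> nat) : a != 0 -> uniq r ->
  (forall t, t \in r -> 0 < t < 1 /\
    ((0 < m t)%N /\ forall j, (j < m t)%N -> dot a (g j t) = 0)) ->
  (\sum_(t <- r) m t <= 3)%N.
Proof.
move=> a0 ur H; have [_ /(_ a a0)] := gconvex.
move=> /(le_trans _) K.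
have : ((\sum_(t <- r) (m t)%:R)%:E <= (3%:R : R)%:E)%E.
  apply: K; apply: esum_ge; exists [set` r].
    split; first exact: finite_seq.
    move=> t /= tr; have [t01 [m0 mt]] := H t tr; split => //.
    exact: (mt 0%N).
  rewrite -fsbig_seq// -sumEFin big_seq [leRHS]big_seq; apply: lee_sum => t tr.
  apply: le_ereal_inf_tmp => _ [k [k1 kz knz] <-]; rewrite lee_fin ler_nat.
  have [t01 [m0 mt]] := H t tr.
  by rewrite leqNgt; apply/negP => km; apply: knz; exact: mt.
by rewrite lee_fin -natr_sum ler_nat.
Qed.

Definition contact s t : R := det4 (g 0 s) (g 1 s) (g 0 t) (g 1 t).

Lemma contact_neq0 s t : 0 < s < 1 -> 0 < t < 1 -> s != t -> contact s t != 0.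
Proof.
move=> s01 t01 st; apply/eqP => /det4_eq0[a a0 [h0 h1 h2 h3]].
have := @contact_le a [:: s; t] (fun=> 2%N) a0; rewrite /= inE st !big_cons big_nil.
move=> /(_ erefl) H; suff : (2 + (2 + 0) <= 3)%N by [].
apply: H => x; rewrite !inE => /orP[] /eqP ->.
- split; first exact: s01.
  by split=> [|[|[|j]] jm]; [|exact: h0|exact: h1|move: jm; clear].
- split; first exact: t01.
  by split=> [|[|[|j]] jm]; [|exact: h2|exact: h3|move: jm; clear].
Qed.

Lemma has_deriv01_sum n (f : 'I_n -> R -> R) t (l : 'I_n -> R) :
  (forall i, has_deriv01 (f i) t (l i)) ->
  has_deriv01 (fun s => \sum_i f i s) t (\sum_i l i).
Proof.
move=> H; elim: (index_enum _) => [|i r IH].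
  by rewrite big_nil; under eq_fun do rewrite big_nil; exact: has_deriv01_cst.
rewrite big_cons; under eq_fun do rewrite big_cons.
exact: has_deriv01D.
Qed.

Lemma has_deriv01_dotr n (a : 'cV[R]_n) (f : R -> 'cV[R]_n) t (f' : 'cV[R]_n) :
  has_deriv01 f t f' -> has_deriv01 (fun s => dot a (f s)) t (dot a f').
Proof.
move=> /has_deriv01_coordP fd; apply: has_deriv01_sum => i.
apply: has_deriv01_congr (has_deriv01M (has_deriv01_cst (a i 0) t) (fd i)) => //.
by rewrite mul0r add0r.
Qed.

Lemma asdual_sdual (p q : 'cV[R]_4) : asdual p q = sdual (qconj q) (qconj p).
Proof. by rewrite /asdual /sdual qconjK. Qed.

Lemma has_deriv01_qconj (f : R -> 'cV[R]_4) t (f' : 'cV[R]_4) :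
  has_deriv01 f t f' -> has_deriv01 (fun s => qconj (f s)) t (qconj f').
Proof.
move=> /has_deriv01_coordP fd; apply/has_deriv01_coordP.
have fN i : has_deriv01 (fun s => - f s i 0) t (- f' i 0).
  apply: has_deriv01_congr (has_deriv01M (has_deriv01_cst (-1 : R) t) (fd i)).
    by move=> s; rewrite mulN1r.
  by rewrite mul0r add0r mulN1r.
by apply: ord4P; rewrite /qconj quatE; under eq_fun do rewrite quatE;
  [exact: fd|exact: fN|exact: fN|exact: fN].
Qed.

(** Through [det4_sdual] the determinant becomes linear in the two bivector parts, whose derivatives
    are known; this avoids differentiating the expanded determinant. *)
Lemma has_deriv01_det4 (p q : 'cV[R]_4) (f h : R -> 'cV[R]_4) t (f' h' : 'cV[R]_4) :
  has_deriv01 f t f' -> has_deriv01 h t h' ->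
  has_deriv01 (fun s => det4 p q (f s) (h s)) t (det4 p q f' (h t) + det4 p q (f t) h').
Proof.
move=> fd hd.
have S := @has_deriv01_dotr _ (2^-1 *: sdual p q) _ _ _ (has_deriv01_sdual fd hd).
have A := @has_deriv01_dotr _ (- 2^-1 *: asdual p q) _ _ _
  (has_deriv01_sdual (has_deriv01_qconj hd) (has_deriv01_qconj fd)).
have E (u v : 'cV[R]_4) : det4 p q u v =
    dot (2^-1 *: sdual p q) (sdual u v) +
    dot (- 2^-1 *: asdual p q) (sdual (qconj v) (qconj u)).
  have := det4_sdual p q u v; rewrite -asdual_sdual !dotZl.
  move: (dot _ _) (dot _ _) => x y; rewrite mulr2n => H.
  by rewrite mulNr -mulrBr -H -mulr2n -[det4 p q u v *+ 2]mulr_natl mulrA mulVf ?mul1r// pnatr_eq0.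
apply: has_deriv01_congr (has_deriv01D S A) => [s|]; first by rewrite E.
by rewrite !E !dotDr; ring.
Qed.

Let q s k l t : R := det4 (g 0 s) (g 1 s) (g k t) (g l t).

Lemma det4xx (p r u : 'cV[R]_4) : det4 p r u u = 0.
Proof. by rewrite /det4 /det3; ring. Qed.
Lemma det4_13 (p r u : 'cV[R]_4) : det4 p r p u = 0.
Proof. by rewrite /det4 /det3; ring. Qed.
Lemma det4_23 (p r u : 'cV[R]_4) : det4 p r r u = 0.
Proof. by rewrite /det4 /det3; ring. Qed.

Lemma has_deriv_q s k l t : unit_itv t -> has_deriv01 (q s k l) t (q s k.+1 l t + q s k l.+1 t).
Proof. by move=> It; apply: has_deriv01_det4; exact: has_deriv_jet. Qed.

Lemma contact_gt0_near s : 0 < s < 1 -> exists2 e, s < e < 1 &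
  forall t, s < t < e -> 0 < contact s t.
Proof.
move=> s01; apply: (@fourth_order_gt0_right _ (q s) s s01).
- by move=> k l t; exact: has_deriv_q.
- by move=> k t; exact: det4xx.
- by move=> l; exact: det4_13.
- by move=> l; exact: det4_23.
- have [_ /(_ s (itv01W s01))] := glc.
  by rewrite (_ : jet gamma s = [:: g 0 s; g 1 s; g 2 s; g 3 s])// det_cols4.
Qed.

(** The contact is positive just after s and has no zero on (s, 1), so its sign persists. *)
Lemma contact_gt0 s t : 0 < s -> s < t -> t < 1 -> 0 < contact s t.
Proof.
move=> s0 st t1; have s01 : 0 < s < 1 by apply/andP; split; lra.
have [e /andP[se e1] He] := contact_gt0_near s01.
rewrite ltNge; apply/negP => ct.
pose u := (s + Num.min t e) / 2.
have ut : s < u /\ u < t /\ u < e.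
  have : Num.min t e <= t by rewrite ge_min lexx.
  have : Num.min t e <= e by rewrite ge_min lexx orbT.
  have : s < Num.min t e by rewrite lt_min st.
  by rewrite /u => *; split; [lra|split; lra].
have [su [ut' ue]] := ut.
have cu : 0 < contact s u by apply: He; rewrite su.
have [||c] := @IVT R (contact s) u t 0 (ltW ut').
- apply: derivable_within_continuous => x; rewrite in_itv /= => /andP[ux xt].
  have x01 : 0 < x < 1 by apply/andP; split; lra.
  apply: (@ex_derive _ _ _ _ _ _ (q s 1 1 x + q s 0 2 x)).
  by apply: has_deriv01_is_derive x01 (@has_deriv_q s 0%N 1%N x (itv01W x01)).
- by rewrite ge_min le_max ct (ltW cu) orbT.
rewrite in_itv /= => /andP[uc ct'] /eqP; apply/negP; apply: contact_neq0 => //.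
  by apply/andP; split; lra.
by rewrite lt_eqF//; lra.
Qed.

Definition dual_gap s t : R :=
  dot (frame1 (G s).1) (frame1 (G t).1) - dot (frame1 (G s).2) (frame1 (G t).2).

(** The two parts of gamma ^ gamma' carry the same positive factor, the coefficient a11 of
    [jet_frame], so a single k serves for both products. *)
Lemma contact_dual_gap s t : unit_itv s -> unit_itv t ->
  exists2 k, 0 < k & contact s t *+ 2 = k * dual_gap s t.
Proof.
have E x : unit_itv x -> exists2 k, 0 < k & sdual (g 0 x) (g 1 x) = k *: frame1 (G x).1 /\
    asdual (g 0 x) (g 1 x) = k *: frame1 (G x).2.
  move=> Ix; have [z1 w1] := sphere_lift lift Ix.
  have [a01 [a11 [a02 [a12 [a22 [a03 [a13 [a23 [a33 [[p1 p2 p3] H0 H1 H2 H3]]]]]]]]]] :=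
    jet_frame gsphere lift Ix.
  have [S1 S2 S3 S4] := sdual_Pi4 (G x).1 w1; have A1 := asdual_Pi4 (G x).2 z1.
  rewrite -!surjective_pairing in S1 A1.
  exists a11 => //; rewrite /g H0 H1; split.
    by rewrite sdualDr !sdualZr sdualxx S1 scaler0 add0r.
  by rewrite asdualDr !asdualZr asdualxx A1 scaler0 add0r.
move=> /E[k k0 [s1 s2]] /E[l l0 [t1 t2]]; exists (k * l); first exact: mulr_gt0.
rewrite det4_sdual s1 s2 t1 t2 !(dotZl, dotZr) /dual_gap.
by ring.
Qed.

Lemma dual_gap_gt0 s t : 0 < s < 1 -> 0 < t < 1 -> s != t -> 0 < dual_gap s t.
Proof.
wlog st : s t / s < t.
  move=> H s01 t01 st; have [lt_st|lt_ts] := ltP s t; first exact: H.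
  have {}lt_ts : t < s by rewrite lt_neqAle eq_sym st.
  have : 0 < dual_gap t s by apply: H => //; rewrite eq_sym.
  by rewrite /dual_gap dotC [X in _ - X]dotC.
move=> s01 t01 _; have [k k0] := contact_dual_gap (itv01W s01) (itv01W t01).
have : 0 < contact s t by move/andP: s01 => [s0 _]; move/andP: t01 => [_ t1]; exact: contact_gt0.
by rewrite -(pmulrn_lgt0 _ (ltn0Sn 1)) => + E; rewrite E pmulr_rgt0.
Qed.

End Convexity.

(** * Poles and their barycenter *)

Section Hemisphere.
Context {R : realType}.
Implicit Types (s t : R).

Lemma continuous_ge0_closure (f : R -> R) : continuous f ->
  (forall t, 0 < t < 1 -> 0 <= f t) -> forall t, unit_itv t -> 0 <= f t.
Proof.
move=> fc f0 t /unit_itvP/andP[t0 t1]; rewrite leNgt; apply/negP => ft.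
have : \forall s \near t, f s < 0.
  exact: (@cvgr_lt _ R _ _ f (f t) (fc t) 0 ft).
move=> /nbhs_ballP[e /= e0 eH].
pose d := Num.min (e / 2) (1 / 4).
have d0 : 0 < d by rewrite lt_min; apply/andP; split; lra.
have de : d <= e / 2 by rewrite ge_min lexx.
have d4 : d <= 1 / 4 by rewrite ge_min lexx orbT.
have [th|th] := leP t (1 / 2).
- have : 0 <= f (t + d) by apply: f0; apply/andP; split; lra.
  rewrite leNgt => /negP; apply; apply: eH.
  by rewrite /ball /= distrC addrAC subrr add0r gtr0_norm//; lra.
- have : 0 <= f (t - d) by apply: f0; apply/andP; split; lra.
  rewrite leNgt => /negP; apply; apply: eH.
  by rewrite /ball /= opprB addrCA subrr addr0 gtr0_norm//; lra.
Qed.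

Lemma dot_geN1 n (u v : 'cV[R]_n) : sphere u -> sphere v -> -1 <= dot u v.
Proof.
move=> u1 v1; have := dot_ge0 (u + v).
by rewrite !(dotDl, dotDr) u1 v1 (dotC v u); lra.
Qed.

Lemma dot_young n (u v : 'cV[R]_n) (a : R) : 0 < a ->
  dot u v *+ 2 <= a * dot u u + a^-1 * dot v v.
Proof.
move=> a0; have := dot_ge0 (a *: u - v).
rewrite -scaleN1r !(dotDl, dotDr) !(dotZl, dotZr) (dotC v u) => H.
rewrite -subr_ge0 -(pmulr_rge0 _ a0).
have E : a * (a^-1 * dot v v) = dot v v by rewrite mulrA divff ?gt_eqF// mul1r.
by move: H; rewrite mulrBr mulrDr E mulr2n; lra.
Qed.

Section Hull.
Context (gl gr : R -> 'cV[R]_3).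
Context (gl1 : forall t, unit_itv t -> sphere (gl t)) (gr1 : forall t, unit_itv t -> sphere (gr t)).
Context (glc : forall i, continuous (fun t => gl (clamp01 t) i 0)).
Context (grc : forall i, continuous (fun t => gr (clamp01 t) i 0)).
Context (gl_loop : gl 1 = gl 0).

Let gap s t := dot (gl s) (gl t) - dot (gr s) (gr t).

Context (gap_gt0 : forall s t, 0 < s < 1 -> 0 < t < 1 -> s != t -> 0 < gap s t).

Lemma continuous_dot (a : 'cV[R]_3) (f : R -> 'cV[R]_3) :
  (forall i, continuous (fun t => f t i 0)) -> continuous (fun t => dot a (f t)).
Proof.
move=> fc t; rewrite (_ : (fun t => _) = fun t => a 0 0 * f t 0 0 + a 1 0 * f t 1 0 + a 2 0 * f t 2 0).
  by apply: cvgD; first apply: cvgD; apply: cvgM; (exact: cvg_cst || exact: fc).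
by apply/funext => s; rewrite dotE3.
Qed.

Lemma gap_continuous s : continuous (fun t => gap s (clamp01 t)).
Proof. by move=> t; apply: cvgB; apply: continuous_dot. Qed.

Lemma gapC s t : gap s t = gap t s.
Proof. by rewrite /gap dotC [X in _ - X]dotC. Qed.

(** The inequality is carried from the open to the closed square by closing one variable at a
    time. *)
Lemma gap_ge0 s t : unit_itv s -> unit_itv t -> 0 <= gap s t.
Proof.
have int_ge0 x y : 0 < x < 1 -> 0 < y < 1 -> 0 <= gap x y.
  move=> x01 y01; have [->|xy] := eqVneq x y; last exact/ltW/gap_gt0.
  by rewrite /gap gl1 ?gr1 ?subrr//; exact: itv01W.
have half_ge0 x y : 0 < x < 1 -> unit_itv y -> 0 <= gap x y.
  move=> x01 Iy; rewrite -(clamp01_id Iy).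
  apply: (continuous_ge0_closure (@gap_continuous x)) Iy => z z01.
  by rewrite (clamp01_id (itv01W z01)); exact: int_ge0.
move=> Is It; rewrite gapC -(clamp01_id Is).
apply: (continuous_ge0_closure (@gap_continuous t)) Is => z z01.
by rewrite (clamp01_id (itv01W z01)) gapC; exact: half_ge0.
Qed.

(** The convex hull in R^3 x R^3 of the curve of pairs. Closure under segments lets affine bounds be
    proved by induction, without finite convex combinations. *)
Inductive hull : 'cV[R]_3 -> 'cV[R]_3 -> Prop :=
| hull_point t : unit_itv t -> hull (gl t) (gr t)
| hull_segment (a : R) x y x' y' : 0 <= a <= 1 -> hull x y -> hull x' y' ->
    hull ((1 - a) *: x + a *: x') ((1 - a) *: y + a *: y').

Lemma hull_ge (h q : 'cV[R]_3) (m : R) :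
  (forall t, unit_itv t -> m <= dot h (gl t) - dot q (gr t)) ->
  forall x y, hull x y -> m <= dot h x - dot q y.
Proof.
move=> H x y; elim=> {x y} [t|a x y x' y' /andP[a0 a1] _ IH _ IH']; first exact: H.
have ha : 0 <= 1 - a by lra.
have := lerD (ler_wpM2l ha IH) (ler_wpM2l a0 IH').
by rewrite !dotDr !dotZr; lra.
Qed.

(** The gap extends to a bilinear form on pairs. Nonnegative on two points of the curve, it is
    nonnegative on two points of the hull by linearity in each argument, and its diagonal is |x|^2 -
    |y|^2. *)
Lemma hull_norm_le x y : hull x y -> dot y y <= dot x x.
Proof.
move=> xy; rewrite -subr_ge0; apply: hull_ge (xy) => t It.
rewrite dotC [X in _ - X]dotC; apply: hull_ge (xy) => s Is.
exact: gap_ge0.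
Qed.

(* The gap with two interior points is positive on (0, 1), and gl 0 is positive
   on gl near both ends. *)
Lemma functional_gt0 : exists h q m, 0 < m /\
  forall t, unit_itv t -> m <= dot h (gl t) - dot q (gr t).
Proof.
have I0 : unit_itv (0 : R) by apply/unit_itvP; rewrite lexx ler01.
have I1 : unit_itv (1 : R) by apply/unit_itvP; rewrite lexx ler01.
pose s1 : R := 1 / 3; pose s2 : R := 2 / 3.
have s1i : 0 < s1 < 1 by apply/andP; rewrite /s1; split; lra.
have s2i : 0 < s2 < 1 by apply/andP; rewrite /s2; split; lra.
(* [gap s1] vanishes at s1; the second point makes the sum positive there as well. *)
pose e t := gap s1 t + gap s2 t.
have e_ge0 t : unit_itv t -> 0 <= e t.
  by move=> It; apply: addr_ge0; apply: gap_ge0 => //; exact: itv01W.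
have e_gt0 t : 0 < t < 1 -> 0 < e t.
  move=> t01; have It := itv01W t01.
  have [ts|ts] := eqVneq s1 t.
  - apply: ltr_wpDl; first by apply: gap_ge0 => //; exact: itv01W.
    by apply: gap_gt0 => //; rewrite -ts /s1 /s2; apply/eqP; lra.
  - apply: ltr_wpDr; first by apply: gap_ge0 => //; exact: itv01W.
    exact: gap_gt0.
have ec : continuous (fun t => e (clamp01 t)).
  by move=> t; apply: cvgD; exact: gap_continuous.
pose p t := dot (gl 0) (gl (clamp01 t)).
have pc : continuous p by exact: continuous_dot.
have p0 : p 0 = 1 by rewrite /p clamp01_id// gl1.
have p1 : p 1 = 1 by rewrite /p clamp01_id// gl_loop gl1.
have [d d0 pd] : exists2 d, 0 < d & forall t, unit_itv t -> t < d \/ 1 - d < t -> 1 / 2 < p t.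
  have h0 : (1 / 2 : R) < p 0 by rewrite p0; lra.
  have h1 : (1 / 2 : R) < p 1 by rewrite p1; lra.
  have : \forall s \near (0 : R), 1 / 2 < p s.
    exact: (@cvgr_gt _ R _ _ p (p 0) (pc 0) (1 / 2) h0).
  have : \forall s \near (1 : R), 1 / 2 < p s.
    exact: (@cvgr_gt _ R _ _ p (p 1) (pc 1) (1 / 2) h1).
  move=> /nbhs_ballP[b /= b0 bH] /nbhs_ballP[a /= a0 aH].
  exists (Num.min a b); first by rewrite lt_min a0.
  move=> t /unit_itvP/andP[t0 t1] [td|td].
  - apply: aH; rewrite /ball /= sub0r normrN ger0_norm//.
    by move: td; rewrite lt_min => /andP[].
  - apply: bH; rewrite /ball /= ger0_norm ?subr_ge0//.
    have : Num.min a b <= b by rewrite ge_min lexx orbT.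
    lra.
pose d' := Num.min d (1 / 2).
have d'0 : 0 < d' by rewrite lt_min d0; lra.
have d'd : d' <= d by rewrite ge_min lexx.
have d'2 : d' <= 1 / 2 by rewrite ge_min lexx orbT.
have [||c cI cm] := @EVT_min R (fun t => e (clamp01 t)) d' (1 - d'); first lra.
  exact: continuous_subspaceT.
have c01 : 0 < c < 1.
  by move: cI; rewrite in_itv /= => /andP[*]; apply/andP; split; lra.
pose m := e c; have m0 : 0 < m by exact: e_gt0.
(* On [d', 1 - d'] this makes k * e t >= 2, which outweighs p t >= -1; nearer to the ends p t > 1/2
   is enough by itself. *)
pose k := 2 / m; have k0 : 0 < k by rewrite divr_gt0.
exists (gl 0 + k *: (gl s1 + gl s2)), (k *: (gr s1 + gr s2)), (1 / 2); split; first by lra.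
move=> t It; rewrite [X in _ <= X](_ : _ = p t + k * e t); last first.
  by rewrite !(dotDl, dotZl) /p clamp01_id// /e /gap; ring.
have kt : 0 <= k * e t by exact: mulr_ge0 (ltW k0) (e_ge0 t It).
have [td|td] := ltP t d'.
  have : 1 / 2 < p t by apply: pd => //; left; lra.
  lra.
have [td'|td'] := ltP (1 - d') t.
  have : 1 / 2 < p t by apply: pd => //; right; lra.
  lra.
have : -1 <= p t by apply: dot_geN1; [exact: gl1|apply: gl1; exact: clamp01_itv].
have : m <= e t.
  rewrite /m -(clamp01_id It) -{1}(clamp01_id (itv01W c01)); apply: cm.
  by rewrite in_itv /= td.
move=> /(ler_wpM2l (ltW k0)); rewrite {1}/k mulfVK ?gt_eqF//.
by lra.
Qed.

(** If x were small, y would be small too by [hull_norm_le], and the functional bounded below on the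
    hull could not be. *)
Lemma hull_norm_ge : exists2 d, 0 < d & forall x y, hull x y -> d <= dot x x.
Proof.
have [h [q [m [m0 H]]]] := functional_gt0.
pose b := dot h h + dot q q; have b0 : 0 <= b by rewrite addr_ge0// dot_ge0.
(* Chosen so that a b <= m: then 2 m <= a b + a^-1 (|x|^2 + |y|^2) <= m + 2 a^-1 |x|^2, whence |x|^2
   >= a m / 2. *)
pose a := m / (1 + b); have b1 : 0 < 1 + b by lra.
have a0 : 0 < a by rewrite divr_gt0.
have am : 0 < a * m by exact: mulr_gt0.
exists (a * m / 2); first lra.
move=> x y xy; have := hull_ge H xy; have := hull_norm_le xy.
have := dot_young h x a0; have := dot_young (- q) y a0.
rewrite -scaleN1r !(dotZl, dotZr) => h1 h2 h3 h4.
have ab : a * b <= m.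
  by rewrite -subr_ge0 (_ : m - a * b = a) ?ltW// /a; field; rewrite gt_eqF.
have h5 : a^-1 * dot y y <= a^-1 * dot x x by rewrite ler_pM2l ?invr_gt0.
have h6 : m <= 2 * (a^-1 * dot x x) by move: ab; rewrite /b !mulr2n in h1 h2 *; lra.
have := ler_wpM2l (ltW a0) h6.
by rewrite mulrCA (mulrA a) divff ?gt_eqF// mul1r; lra.
Qed.

Lemma strict_pole : exists2 h : 'cV[R]_3, sphere h &
  forall t, unit_itv t -> 0 < dot h (gl t).
Proof.
have I0 : unit_itv (0 : R) by apply/unit_itvP; rewrite lexx ler01.
have [d0 d0_gt0 d0H] := hull_norm_ge.
pose S : set R := [set r | exists x y, hull x y /\ r = dot x x].
have S1 : S 1 by exists (gl 0), (gr 0); split; [exact: hull_point|rewrite gl1].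
have Slb : lbound S d0 by move=> _ [x [y [xy ->]]]; exact: d0H xy.
have Sinf : has_inf S by split; [exists 1|exists d0].
pose d := inf S.
have d_gt0 : 0 < d by apply: lt_le_trans d0_gt0 _; exact: lb_le_inf (ex_intro _ 1 S1) Slb.
have d_le1 : d <= 1 by apply: ge_inf S1; exists d0.
(* An almost minimal point replaces a minimizer, so no compactness of the hull is needed. If x . gl
   t <= 0, moving x by the fraction d/8 towards gl t leaves a squared norm of at most (1 - d/8)^2 (d
   + d^2/16) + d^2/64, which is below d because d <= 1. *)
have e0 : 0 < d ^+ 2 / 16 by rewrite divr_gt0 ?exprn_gt0//; lra.
have [_ [x [y [xy ->]]] xd] := inf_adherent e0 Sinf.
have dx : d <= dot x x by apply: ge_inf; [exists d0|exists x, y].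
have x0 : x != 0 by apply/eqP => xE; move: dx; rewrite xE dot0r; lra.
exists (normalize x); first exact: sphere_normalize.
move=> t It; rewrite /normalize dotZl mulr_gt0 ?invr_gt0 ?sqrtr_gt0 ?dot_gt0//.
rewrite ltNge; apply/negP => c0.
have la : 0 <= d / 8 <= 1 by apply/andP; split; lra.
have : d <= dot ((1 - d / 8) *: x + (d / 8) *: gl t) ((1 - d / 8) *: x + (d / 8) *: gl t).
  apply: ge_inf; first by exists d0.
  by eexists; eexists; split; [exact: (hull_segment la xy (hull_point It))|].
rewrite !(dotDl, dotDr) !(dotZl, dotZr) gl1// (dotC (gl t) x).
rewrite -/d in xd.
move: (dot x x) (dot x (gl t)) c0 xd dx d_gt0 d_le1 => P c c0 xd dx dg dl.
clear - c0 xd dx dg dl => H.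
have c' : (1 - d / 8) * ((d / 8) * c) <= 0.
  by rewrite mulr_ge0_le0 ?mulr_ge0_le0//; lra.
have P' : (1 - d / 8) * ((1 - d / 8) * P) <= (1 - d / 8) * ((1 - d / 8) * (d + d ^+ 2 / 16)).
  by rewrite !ler_wpM2l//; lra.
have d2 : 0 < d ^+ 2 by rewrite exprn_gt0.
have d3 : d ^+ 3 <= d ^+ 2 by rewrite exprS ger_pMl.
have d4 : d ^+ 4 <= d ^+ 2 by rewrite (_ : 4 = 2 + 2)%N// exprD ger_pMl// expr_le1// ltW.
have d3' : 0 < d ^+ 3 by rewrite exprn_gt0.
lra.
Qed.

End Hull.
End Hemisphere.

(** * Integration over the cone of poles *)

Section Barycenter.
Context {R : realType} (gl : R -> 'cV[R]_3).
Context (gl1 : forall t, unit_itv t -> sphere (gl t)).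
Context (glc : forall i, continuous (fun t => gl (clamp01 t) i 0)).
Context (h0 : 'cV[R]_3) (h0_sphere : sphere h0).
Context (h0_pole : forall t, unit_itv t -> 0 < dot h0 (gl t)).

Local Notation mu := ((lebesgue_measure \x lebesgue_measure) \x lebesgue_measure)%E.
Let C := solid_cone (hemisphere_poles gl).

Lemma solid_coneE : C = [set p | dot (vec3 p) (vec3 p) <= 1 /\
  forall t, 0 <= dot (vec3 p) (gl (clamp01 t))].
Proof.
apply/seteqP; split => p.
  move=> [r [h [/andP[r0 r1] [h1 hP] pE]]]; rewrite /= pE; split.
    by rewrite dotZl dotZr h1 mulr1 mulr_ile1.
  move=> t; rewrite dotZl mulr_ge0//.
  have : closed_hemisphere h (gl (clamp01 t)).
    by apply: hP; exists (clamp01 t) => //; exact: clamp01_itv.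
  by case.
move=> [p1 pP]; have [p0|p0] := eqVneq (vec3 p) 0.
  (* The apex must still be written as a multiple of some pole. *)
  exists 0, h0; rewrite lexx ler01 p0 scale0r; split=> //; split=> //.
  by move=> _ [t It <-]; split; [exact: gl1|exact/ltW/h0_pole].
have n0 : 0 < Num.sqrt (dot (vec3 p) (vec3 p)) by rewrite sqrtr_gt0 dot_gt0.
exists (Num.sqrt (dot (vec3 p) (vec3 p))), (normalize (vec3 p)); split.
- by rewrite ltW//= -sqrtr1 ler_wsqrtr.
- split; first exact: sphere_normalize.
  move=> _ [t It <-]; split; first exact: gl1.
  rewrite /normalize dotZl; apply: mulr_ge0; first by rewrite invr_ge0 ltW.
  by have := pP t; rewrite clamp01_id.
- by rewrite /normalize scalerA divff ?scale1r// gt_eqF.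
Qed.

Lemma measurable_vec3 (i : 'I_3) D : measurable_fun D (fun p : R * R * R => vec3 p i 0).
Proof.
apply: measurable_funTS; move: i; apply: ord3P.
- rewrite (_ : (fun p => _) = fun p : R * R * R => p.1.1).
    by apply: measurableT_comp; [exact: measurable_fst|exact: measurable_fst].
  by apply/funext => -[[a b] c]; rewrite vec3E.
- rewrite (_ : (fun p => _) = fun p : R * R * R => p.1.2).
    by apply: measurableT_comp; [exact: measurable_snd|exact: measurable_fst].
  by apply/funext => -[[a b] c]; rewrite vec3E.
- rewrite (_ : (fun p => _) = fun p : R * R * R => p.2).
    exact: measurable_snd.
  by apply/funext => -[[a b] c]; rewrite vec3E.
Qed.

Lemma measurable_dot_vec3 (f g : R * R * R -> 'cV[R]_3) D :
  (forall i, measurable_fun D (fun p => f p i 0)) ->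
  (forall i, measurable_fun D (fun p => g p i 0)) ->
  measurable_fun D (fun p => dot (f p) (g p)).
Proof.
move=> mf mg; rewrite (_ : (fun p => _) = fun p =>
  f p 0 0 * g p 0 0 + f p 1 0 * g p 1 0 + f p 2 0 * g p 2 0).
  by do 2 (apply: measurable_funD; last exact: measurable_funM); exact: measurable_funM.
by apply/funext => p; rewrite dotE3.
Qed.

(** By continuity in t, the half-spaces at rational t cut out the same set, and these are countably
    many. Integers that encode no rational repeat the condition at 0. *)
Lemma measurable_solid_cone : measurable C.
Proof.
have mge (f : R * R * R -> R) : measurable_fun setT f -> measurable [set p | 0 <= f p].
  move=> mf; rewrite (_ : [set _ | _] = f @^-1` `[0, +oo[).
    by rewrite -[X in measurable X]setTI; exact: mf.
  by apply/seteqP; split => p /=; rewrite in_itv /= andbT.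
rewrite solid_coneE.
have -> : [set p | dot (vec3 p) (vec3 p) <= 1 /\ forall t, 0 <= dot (vec3 p) (gl (clamp01 t))] =
   [set p | 0 <= 1 - dot (vec3 p) (vec3 p)] `&`
   \bigcap_(n : nat) [set p : R * R * R | 0 <= dot (vec3 p) (gl (clamp01 (ratr (odflt 0 (unpickle n : option rat)))))].
  apply/seteqP; split => p /=.
    by move=> [p1 pP]; split; [lra|move=> n _ /=; exact: pP].
  move=> [p1 pP]; split; first by lra.
  move=> t; rewrite leNgt; apply/negP => pt.
  have pc : continuous (fun t => dot (vec3 p) (gl (clamp01 t))) by exact: continuous_dot.
  have : \forall s \near t, dot (vec3 p) (gl (clamp01 s)) < 0.
    exact: (@cvgr_lt _ R _ _ _ _ (pc t) 0 pt).
  move=> /nbhs_ballP[e /= e0 eH].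
  have /rat_in_itvoo[q] : t < t + e by lra.
  rewrite in_itv /= => /andP[tq qe].
  have := pP (pickle q) I; rewrite /mkset pickleK [odflt _ _]/= leNgt => /negP pq; case: pq; apply: eH.
  by rewrite /ball /= distrC gtr0_norm; lra.
apply: measurableI.
  apply: mge; apply: measurable_funB; first exact: measurable_cst.
  by apply: measurable_dot_vec3 => i; exact: measurable_vec3.
apply: bigcapT_measurable => n; apply: mge.
by apply: measurable_dot_vec3 => i; [exact: measurable_vec3|exact: measurable_cst].
Qed.

Lemma measure_box (a0 b0 a1 b1 a2 b2 : R) : a0 < b0 -> a1 < b1 -> a2 < b2 ->
  mu (`[a0, b0] `*` `[a1, b1] `*` `[a2, b2]) = ((b0 - a0) * (b1 - a1) * (b2 - a2))%:E.
Proof.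
move=> h1 h2 h3; rewrite product_measure1E//=; last exact: measurableX.
rewrite product_measure1E//=.
by rewrite !lebesgue_measure_itv/= !lte_fin h1 h2 h3 -!EFinD -!EFinM.
Qed.

Lemma solid_cone_vec3_le (i : 'I_3) p : C p -> `|vec3 p i 0| <= 1.
Proof.
rewrite solid_coneE => -[p1 _]; rewrite -(expr_le1 (n := 2))// -normrX.
rewrite ger0_norm ?sqr_ge0//; apply: le_trans p1; rewrite /dot (bigD1 i)//= -expr2.
by rewrite lerDl sumr_ge0// => j _; rewrite -expr2 sqr_ge0.
Qed.

Lemma measure_solid_cone : (mu C < +oo)%E.
Proof.
have lt11 : (-1 : R) < 1 by lra.
apply: (@le_lt_trans _ _ (mu (`[-1, 1] `*` `[-1, 1] `*` `[-1, 1]))); last first.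
  by rewrite measure_box// ltry.
apply: le_measure; rewrite ?inE//=.
- exact: measurable_solid_cone.
- by apply: measurableX => //; exact: measurableX.
move=> [[a b] c] Cp.
have := solid_cone_vec3_le 0 Cp; have := solid_cone_vec3_le 1 Cp; have := solid_cone_vec3_le 2 Cp.
by rewrite !vec3E !ler_norml /= !in_itv /= => -> -> ->.
Qed.

Lemma integrable_vec3 (i : 'I_3) : mu.-integrable C (EFin \o (fun p => vec3 p i 0)).
Proof.
apply: measurable_bounded_integrable.
- exact: measurable_solid_cone.
- exact: measure_solid_cone.
- exact: measurable_vec3.
exists 1; split; rewrite ?num_real // => x x1 p Cp /=.
by apply: le_trans (ltW x1); exact: solid_cone_vec3_le.
Qed.

Let moment := \col_i Rintegral mu C (fun p => vec3 p i 0).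

Lemma dot_moment (x : 'cV[R]_3) :
  dot moment x = Rintegral mu C (fun p => dot (vec3 p) x) /\
  mu.-integrable C (EFin \o (fun p => dot (vec3 p) x)).
Proof.
have mC := measurable_solid_cone.
have iZ (i : 'I_3) : mu.-integrable C (EFin \o (fun p => x i 0 * vec3 p i 0)).
  move: (x i 0) => y.
  rewrite (_ : _ \o _ = fun p => (y%:E * (EFin \o (fun p => vec3 p i (0 : 'I_1)%R)) p)%E).
    exact: integrableZl (integrable_vec3 i).
  by apply/funext => p /=; rewrite EFinM.
have iD (f g : R * R * R -> R) : mu.-integrable C (EFin \o f) -> mu.-integrable C (EFin \o g) ->
    mu.-integrable C (EFin \o (fun p => f p + g p)).
  move=> fi gi; rewrite (_ : _ \o _ = ((EFin \o f) \+ (EFin \o g))%E).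
    exact: integrableD.
  by apply/funext => p /=; rewrite EFinD.
have E : (fun p => dot (vec3 p) x) = fun p : R * R * R => x 0 0 * vec3 p 0 0 + x 1 0 * vec3 p 1 0 + x 2 0 * vec3 p 2 0.
  by apply/funext => p; rewrite dotE3; ring.
have i2 := iD _ _ (iZ 0) (iZ 1); have i3 := iD _ _ i2 (iZ 2).
rewrite E; split; last exact: i3.
have z0 := iZ 0; have z1 := iZ 1; have z2 := iZ 2.
rewrite RintegralD// RintegralD// !RintegralZl//; try exact: integrable_vec3.
by rewrite dotE3 !mxE; ring.
Qed.

(** The integrand is nonnegative on the cone and at least m/4 on a box around h0/2 that lies in the
    cone. *)
Lemma dot_moment_gt0 t : unit_itv t -> 0 < dot moment (gl t).
Proof.
move=> It.
have hc : continuous (fun t => dot h0 (gl (clamp01 t))) by exact: continuous_dot.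
have [||c cI cm] := @EVT_min R (fun t => dot h0 (gl (clamp01 t))) 0 1; first exact: ler01.
  exact: continuous_subspaceT.
have Ic : unit_itv c by apply/unit_itvP; rewrite in_itv /= in cI.
pose m := dot h0 (gl c); have m0 : 0 < m by exact: h0_pole.
have hm s : unit_itv s -> m <= dot h0 (gl s).
  move=> Is; rewrite /m -(clamp01_id Ic) -(clamp01_id Is); apply: cm.
  by move/unit_itvP : Is; rewrite in_itv.
(* Half the side of the box. A perturbation e with entries at most d changes a product with a unit
   vector by at most 3 d: d <= m/12 keeps the integrand above m/2 - m/4, and d <= 1/8 keeps the box
   in the unit ball. *)
pose d := Num.min (1 / 8) (m / 12).
have d0 : 0 < d by rewrite lt_min; apply/andP; split; lra.
have d4 : d <= 1 / 8 by rewrite ge_min lexx.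
have dm : d <= m / 12 by rewrite ge_min lexx orbT.
pose a i := h0 i 0 / 2 - d; pose b i := h0 i 0 / 2 + d.
have ab i : a i < b i by rewrite /a /b; lra.
pose B : set (R * R * R) := `[a 0, b 0] `*` `[a 1, b 1] `*` `[a 2, b 2].
have mB : measurable B by apply: measurableX => //; exact: measurableX.
have Bd p : B p -> exists e : 'cV[R]_3, vec3 p = 2^-1 *: h0 + e /\ forall i, `|e i 0| <= d.
  move=> [[/=]]; rewrite /a /b !in_itv /= => /andP[p1 p2] /andP[p3 p4] /andP[p5 p6].
  exists (vec3 p - 2^-1 *: h0); split; first by rewrite addrC subrK.
  by move: p p1 p2 p3 p4 p5 p6 => [[x y] z] /= *;
    apply: (@ord3P (fun i => `|(vec3 (x, y, z) - 2^-1 *: h0) i 0| <= d));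
    rewrite !entryE vec3E ler_norml; apply/andP; split; lra.
have xle (x : 'cV[R]_3) i : sphere x -> `|x i 0| <= 1.
  move=> x1; rewrite -(expr_le1 (n := 2))// -normrX ger0_norm ?sqr_ge0// -[leRHS]x1.
  by rewrite /dot (bigD1 i)//= -expr2 lerDl sumr_ge0// => j _; rewrite -expr2 sqr_ge0.
have edot (e x : 'cV[R]_3) : sphere x -> (forall i, `|e i 0| <= d) -> `|dot e x| <= 3 * d.
  move=> x1 ed; have k i : `|e i 0 * x i 0| <= d.
    by rewrite normrM -[leRHS]mulr1 ler_pM//; exact: xle.
  rewrite dotE3; apply: le_trans (ler_normD _ _) _.
  have := ler_normD (e 0 0 * x 0 0) (e 1 0 * x 1 0).
  have := k 0; have := k 1; have := k 2; lra.
have Bge p s : B p -> unit_itv s -> m / 4 <= dot (vec3 p) (gl s).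
  move=> /Bd[e [-> ed]] Is; rewrite dotDl dotZl.
  have := edot e _ (gl1 Is) ed; rewrite ler_norml => /andP[+ _].
  by have := hm s Is; lra.
have BC : B `<=` C.
  move=> p Bp; rewrite solid_coneE; split; last first.
    by move=> s; apply: le_trans (Bge p _ Bp (clamp01_itv s)); lra.
  have [e [-> ed]] := Bd p Bp.
  have ee : dot e e <= 3 * (d * d).
    rewrite dotE3; have k i : e i 0 * e i 0 <= d * d.
      by rewrite -expr2 -real_normK ?num_real// expr2 ler_pM.
    by have := k 0; have := k 1; have := k 2; lra.
  have := edot e _ h0_sphere ed; rewrite ler_norml => /andP[_].
  rewrite !(dotDl, dotDr) !(dotZl, dotZr) h0_sphere (dotC h0 e).
  have : d * d <= 1 / 8 * (1 / 8) by rewrite ler_pM// ltW.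
  lra.
have [-> fi] := dot_moment (gl t).
have mC := measurable_solid_cone.
have CE : C = B `|` (C `\` B) by rewrite setDUK.
have mCB : measurable (C `\` B) by exact: measurableD.
rewrite CE Rintegral_setU//; last 2 first.
- by rewrite setDUK.
- by apply/disj_set2P; rewrite setIDA setIC -setIDA setDv setI0.
apply: ltr_wpDr.
  apply: Rintegral_ge0 => p [Cp _]; move: Cp; rewrite solid_coneE => -[_ /(_ t)].
  by rewrite clamp01_id.
have fB : mu.-integrable B (EFin \o (fun p => dot (vec3 p) (gl t))).
  exact: integrableS fi.
have vB : mu B = ((b 0 - a 0) * (b 1 - a 1) * (b 2 - a 2))%:E by exact: measure_box.
have cB : mu.-integrable B (EFin \o (fun=> m / 4)).
  apply: measurable_bounded_integrable => //.
  - by have : (mu B < +oo)%E by rewrite vB ltry.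
  - exact: bounded_cst.
apply: (@lt_le_trans _ _ (\int[mu]_(p in B) (m / 4))); last first.
  by apply: le_Rintegral => // p Bp; exact: Bge.
rewrite Rintegral_cst//; suff : 0 < m / 4 * fine (mu B) by [].
rewrite vB /=.
by rewrite !mulr_gt0 ?subr_gt0//; lra.
Qed.

Lemma barycenter_pole : sphere (barycenter (hemisphere_poles gl)) /\
  forall t, unit_itv t -> 0 < dot (barycenter (hemisphere_poles gl)) (gl t).
Proof.
have I0 : unit_itv (0 : R) by apply/unit_itvP; rewrite lexx ler01.
have m0 : moment != 0.
  by apply/eqP => mE; have := dot_moment_gt0 I0; rewrite mE dotC dot0r ltxx.
split; first exact: (sphere_normalize m0).
move=> t It; rewrite -[barycenter _]/(normalize moment) /normalize dotZl.
by rewrite mulr_gt0 ?invr_gt0 ?sqrtr_gt0 ?dot_gt0// dot_moment_gt0.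
Qed.

End Barycenter.

(** * Angles of plane curves *)

Section Angles.
Context {R : realType}.
Implicit Types (x y theta phi psi : R -> R) (a b s t : R).

Lemma sinD2pi_int t (m : int) : sin (t + pi *+ 2 * m%:~R) = sin t.
Proof.
case: m => n; first by rewrite -pmulrn mulr_natr (periodicn (@sinD2pi R)).
rewrite NegzE mulrNz mulrN -pmulrn mulr_natr.
by rewrite -(periodicn (@sinD2pi R) n.+1 (t - pi *+ 2 *+ n.+1)) subrK.
Qed.

Lemma cosD2pi_int t (m : int) : cos (t + pi *+ 2 * m%:~R) = cos t.
Proof. by rewrite -!(sinDpihalf) addrAC sinD2pi_int. Qed.

Lemma sinpi_int (m : int) : sin (pi * m%:~R : R) = 0.
Proof.
apply/eqP; rewrite -sqrf_eq0 sin2cos2.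
have := cosD (pi * m%:~R : R) (pi * m%:~R); rewrite -mulr2n.
rewrite (_ : (pi * m%:~R) *+ 2 = 0 + pi *+ 2 * m%:~R :> R); last by ring.
rewrite cosD2pi_int cos0 -!expr2 sin2cos2 => H.
by apply/eqP; lra.
Qed.

Lemma cos_eq1 t : cos t = 1 -> exists m : int, t = pi *+ 2 * m%:~R.
Proof.
move=> t1; have p2 : 0 < pi *+ 2 :> R by rewrite mulrn_wgt0// pi_gt0.
pose m := Num.floor (t / (pi *+ 2)); exists m.
have /andP[m1 m2] := real_floor_itv (num_real (t / (pi *+ 2))).
rewrite -/m ler_pdivlMr// in m1; rewrite -/m ltr_pdivrMr// in m2.
pose d := (t - pi *+ 2 * m%:~R) / 2.
have d0 : 0 <= d by rewrite /d divr_ge0// subr_ge0 mulrC.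
have dpi : d < pi.
  by rewrite intrD mulrDl mul1r in m2; rewrite /d; lra.
have : cos (d + d) = 1.
  rewrite -t1 -(cosD2pi_int _ m) /d; congr cos; lra.
rewrite cosD -!expr2 cos2sin2 => sd.
have /eqP : sin d ^+ 2 = 0 by lra.
rewrite sqrf_eq0 => /eqP sd0.
have : ~~ (0 < d).
  by apply/negP => dgt; have := @sin_gt0_pi R d; rewrite dgt dpi sd0 ltxx => /(_ erefl).
by rewrite -leNgt /d => dle; apply/eqP; rewrite -subr_eq0; apply/eqP; rewrite /d in d0; lra.
Qed.

Lemma unit_angle (c s : R) : c ^+ 2 + s ^+ 2 = 1 -> exists t, c = cos t /\ s = sin t.
Proof.
move=> cs; have c1 : -1 <= c <= 1.
  rewrite -ler_norml -(expr_le1 (n := 2))// -normrX ger0_norm ?sqr_ge0//.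
  by rewrite -cs lerDl sqr_ge0.
have sE : Num.sqrt (1 - c ^+ 2) = `|s| by rewrite -cs addrAC subrr add0r sqrtr_sqr.
have [s0|s0] := leP 0 s.
  exists (acos c); rewrite acosK ?in_itv//; split=> //.
  by rewrite sin_acos// sE ger0_norm.
exists (- acos c); rewrite cosN acosK ?in_itv//; split=> //.
by rewrite sinN sin_acos// sE ltr0_norm// opprK.
Qed.

Definition polar (u v r t : R) : Prop := [/\ 0 < r, u = r * cos t & v = r * sin t].

(** Continuity is asked on the whole line and the polar form on [a, b] only, so that restriction to
    a subinterval is immediate. *)
Definition is_arg a b x y theta : Prop := continuous theta /\
  forall t, a <= t <= b -> exists r, polar (x t) (y t) r (theta t).

(** Two vectors with positive inner product differ by an angle less than pi/2 in absolute value,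
    which is the arctangent of cross product over inner product. *)
Lemma polar_rotate (u v u' v' r t : R) : polar u v r t -> 0 < u * u' + v * v' ->
  exists r', polar u' v' r' (t + atan ((u * v' - v * u') / (u * u' + v * v'))).
Proof.
move=> [r0 uE vE]; set D := u * u' + v * v'; set X := u * v' - v * u' => D0.
pose k := Num.sqrt (1 + (X / D) ^+ 2).
have k0 : 0 < k by rewrite sqrtr_gt0 ltr_pwDl// sqr_ge0.
have cE : cos (atan (X / D)) = k^-1 by rewrite cos_atan.
have sE : sin (atan (X / D)) = X / D * k^-1.
  have H := atanK (X / D); rewrite /tan cE invrK in H.
  by rewrite -[X in _ = X * _]H mulfK// gt_eqF.
have cs := cos2Dsin2 t; have rn0 : r != 0 by rewrite gt_eqF.
exists (D * k / r); split; first by rewrite divr_gt0 ?mulr_gt0.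
  rewrite cosD cE sE.
  have -> : D * k / r * (cos t / k - sin t * (X / D / k)) = (D * cos t - X * sin t) / r.
    by field; rewrite !gt_eqF.
  apply: (mulIf rn0); rewrite mulfVK ?gt_eqF//.
  rewrite /D /X uE vE (_ : _ - _ = u' * r * (cos t ^+ 2 + sin t ^+ 2)); last by ring.
  by rewrite cs mulr1.
rewrite sinD cE sE.
have -> : D * k / r * (sin t / k + cos t * (X / D / k)) = (D * sin t + X * cos t) / r.
  by field; rewrite !gt_eqF.
apply: (mulIf rn0); rewrite mulfVK ?gt_eqF//.
rewrite /D /X uE vE (_ : _ + _ = v' * r * (cos t ^+ 2 + sin t ^+ 2)); last by ring.
by rewrite cs mulr1.
Qed.

Lemma polar_exists (u v : R) : 0 < u ^+ 2 + v ^+ 2 -> exists r t, polar u v r t.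
Proof.
move=> uv; pose r := Num.sqrt (u ^+ 2 + v ^+ 2); have r0 : 0 < r by rewrite sqrtr_gt0.
have r2 : r ^+ 2 = u ^+ 2 + v ^+ 2 by rewrite sqr_sqrtr// ltW.
have [|t [ct st]] := @unit_angle (u / r) (v / r).
  by rewrite !expr_div_n -mulrDl -r2 divff// sqrf_eq0 gt_eqF.
exists r, t; split; rewrite -?ct -?st//; by rewrite mulrC mulfVK// gt_eqF.
Qed.

Lemma uniform_dot_gt0 a b x y : a <= b -> continuous x -> continuous y ->
  (forall t, a <= t <= b -> 0 < x t ^+ 2 + y t ^+ 2) ->
  exists2 d, 0 < d & forall s t, a <= s <= b -> a <= t <= b -> `|t - s| < d ->
    0 < x s * x t + y s * y t.
Proof.
move=> ab xc yc xy.
have /compact_near_coveringP cK := @segment_compact R a b.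
have H : \forall d \near (0 : R)^'+, `[a, b]%classic `<=`
    (fun s => forall t, `|t - s| < d -> 0 < x s * x t + y s * y t).
  apply: cK => s; rewrite /= in_itv /= => sab.
  have h : continuous (fun p : R * R => x p.1 * x p.2 + y p.1 * y p.2).
    move=> p; apply: cvgD; apply: cvgM.
    - by apply: (cvg_comp fst x); [exact: cvg_fst|exact: xc].
    - by apply: (cvg_comp snd x); [exact: cvg_snd|exact: xc].
    - by apply: (cvg_comp fst y); [exact: cvg_fst|exact: yc].
    - by apply: (cvg_comp snd y); [exact: cvg_snd|exact: yc].
  have hs : 0 < x (s, s).1 * x (s, s).2 + y (s, s).1 * y (s, s).2 by have := xy s sab; rewrite !expr2.
  have : \forall p \near ((s, s) : R * R), 0 < x p.1 * x p.2 + y p.1 * y p.2.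
    exact: (@cvgr_gt R _ _ _ (fun p : R * R => x p.1 * x p.2 + y p.1 * y p.2) _ (h (s, s)) 0 hs).
  move=> /nbhs_ballP[e /= e0 eH].
  exists ([set u | `|s - u| < e / 2], [set d | d < e / 2]).
    split => /=.
      by apply/nbhs_ballP; exists (e / 2); [rewrite /=; lra|move=> u].
    by apply: nbhs_right_lt; lra.
  move=> [u d] /= [su de] t tu; apply: (eH (u, t)); split => /=.
    by rewrite /ball /=; lra.
  rewrite /ball /= (_ : s - t = (s - u) - (t - u)); last by ring.
  by apply: le_lt_trans (ler_normB _ _) _; lra.
have [d [d0 dH]] : exists d, 0 < d /\ (`[a, b]%classic `<=` fun s => forall t, `|t - s| < d -> 0 < x s * x t + y s * y t).
  have /filter_ex[d [dH d0]] : \forall d \near (0 : R)^'+, (`[a, b]%classic `<=` fun s => forall t, `|t - s| < d -> 0 < x s * x t + y s * y t) /\ 0 < d.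
    by apply: filterI => //; exact: nbhs_right_gt.
  by exists d.
exists d => // s t sab tab st; apply: dH => //=; rewrite in_itv /=.
Qed.

(** The segment from a to t is cut into n equal steps, with the same n for all t, and the small
    angle increments are added. Each increment is continuous in t, so no local branches have to be
    glued. *)
Lemma exists_arg a b x y : a <= b -> continuous x -> continuous y ->
  (forall t, a <= t <= b -> 0 < x t ^+ 2 + y t ^+ 2) ->
  exists theta, is_arg a b x y theta.
Proof.
move=> ab xc yc xy; have [d d0 dH] := uniform_dot_gt0 ab xc yc xy.
have [r0 [t0 P0]] : exists r t, polar (x a) (y a) r t.
  by apply: polar_exists; apply: xy; rewrite lexx.
pose n := (Num.trunc ((b - a) / d)).+1.
have n0 : 0 < n%:R :> R by rewrite ltr0n.
have nd : (b - a) / n%:R < d.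
  have bd : 0 <= (b - a) / d by rewrite divr_ge0 ?subr_ge0// ltW.
  have /andP[_] := Num.Theory.trunc_itv bd.
  by rewrite -/n ltr_pdivrMr// ltr_pdivrMr// mulrC.
pose c t := Num.max a (Num.min b t).
have cab t : a <= c t <= b.
  by rewrite /c le_max lexx /= ge_max ab /= ge_min lexx.
have cid t : a <= t <= b -> c t = t by move=> /andP[h1 h2]; rewrite /c min_r// max_r.
have cc : continuous c.
  move=> t; apply: (@continuous_max R R (fun=> a) (fun t => Num.min b t)); first exact: cvg_cst.
  by apply: (@continuous_min R R (fun=> b) id); [exact: cvg_cst|exact: cvg_id].
pose p i t := a + (c t - a) * (i%:R / n%:R).
have pab i t : (i <= n)%N -> a <= p i t <= b.
  move=> i_n; have /andP[c1 c2] := cab t.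
  have k0 : 0 <= i%:R / n%:R :> R by rewrite divr_ge0.
  have k1 : i%:R / n%:R <= 1 :> R by rewrite ler_pdivrMr// mul1r ler_nat.
  have h1 : 0 <= (c t - a) * (i%:R / n%:R) by rewrite mulr_ge0// subr_ge0.
  have h2 : (c t - a) * (i%:R / n%:R) <= (c t - a) * 1 by rewrite ler_wpM2l// subr_ge0.
  by rewrite /p; apply/andP; split; lra.
have pstep i t : `|p i.+1 t - p i t| < d.
  have /andP[c1 c2] := cab t.
  have -> : p i.+1 t - p i t = (c t - a) / n%:R.
    by rewrite /p -natr1; field; rewrite gt_eqF.
  rewrite ger0_norm; last by rewrite divr_ge0 ?subr_ge0// ltW.
  by apply: le_lt_trans nd; rewrite ler_pM2r ?invr_gt0//; lra.
have pc i : continuous (p i).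
  move=> t; apply: cvgD; first exact: cvg_cst.
  by apply: cvgM; [apply: cvgB; [exact: cc|exact: cvg_cst]|exact: cvg_cst].
pose D i t := x (p i t) * x (p i.+1 t) + y (p i t) * y (p i.+1 t).
pose X i t := x (p i t) * y (p i.+1 t) - y (p i t) * x (p i.+1 t).
pose th k t := t0 + \sum_(i < k) atan (X i t / D i t).
have D0 i t : (i < n)%N -> 0 < D i t.
  by move=> i_n; apply: dH; [exact/pab/ltnW|exact: pab|exact: pstep].
have xpc i : continuous (fun t => x (p i t)).
  by move=> t; apply: continuous_comp; [exact: pc|exact: xc].
have ypc i : continuous (fun t => y (p i t)).
  by move=> t; apply: continuous_comp; [exact: pc|exact: yc].
have thc k : (k <= n)%N -> continuous (th k).
  elim: k => [_|k IH kn] t.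
    by rewrite /th; under eq_fun do rewrite big_ord0; exact: cvg_cst.
  rewrite (_ : th k.+1 = fun t => th k t + atan (X k t / D k t)).
    apply: cvgD; first by apply: IH; exact: ltnW.
    apply: (continuous_comp (f := fun t => X k t / D k t)); last exact: continuous_atan.
    apply: cvgM.
      by apply: cvgB; apply: cvgM; (exact: xpc || exact: ypc).
    apply: cvgV; first by rewrite gt_eqF// D0.
    by apply: cvgD; apply: cvgM; (exact: xpc || exact: ypc).
  by apply/funext => s; rewrite /th big_ord_recr /= addrA.
exists (th n); split; first exact: thc.
move=> t tab.
have H k : (k <= n)%N -> exists r, polar (x (p k t)) (y (p k t)) r (th k t).
  elim: k => [_|k IH kn].
    by exists r0; rewrite /p mul0r mulr0 addr0 /th big_ord0 addr0.
  have [r Pr] := IH (ltnW kn).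
  rewrite /th big_ord_recr /= addrA.
  exact: polar_rotate Pr (D0 k t kn).
have := H n (leqnn n).
by rewrite /p divff ?gt_eqF// mulr1 cid// addrC subrK.
Qed.

(** The function stays between two neighbours of the lattice. Applied to a difference of arguments,
    the lattice of multiples of pi expresses that two directions are never parallel, and the odd
    multiples of pi that they are never opposite. *)
Lemma avoid_lattice a b psi (p c : R) : a <= b -> continuous psi -> 0 < p ->
  (forall t (m : int), a <= t <= b -> psi t <> c + p * m%:~R) ->
  `|psi b - psi a| < p.
Proof.
move=> ab pc p0 H; pose m := Num.floor ((psi a - c) / p).
have /andP[m1 m2] := real_floor_itv (num_real ((psi a - c) / p)).
rewrite -/m ler_pdivlMr// in m1; rewrite -/m ltr_pdivrMr// in m2.
have aab : a <= a <= b by rewrite lexx.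
have bab : a <= b <= b by rewrite lexx ab.
have m1' : c + p * m%:~R < psi a.
  rewrite lt_neqAle; apply/andP; split; first by apply/eqP => /esym; exact: H.
  by rewrite mulrC; lra.
have m2' : psi a < c + p * (m + 1)%:~R by rewrite mulrC; lra.
have b1 : c + p * m%:~R < psi b.
  rewrite ltNge; apply/negP => bm.
  have [||t] := @IVT R psi a b (c + p * m%:~R) ab; first exact: continuous_subspaceT.
    by rewrite ge_min le_max bm (ltW m1') orbT.
  by rewrite in_itv /= => tab; exact: H.
have b2 : psi b < c + p * (m + 1)%:~R.
  rewrite ltNge; apply/negP => bm.
  have [||t] := @IVT R psi a b (c + p * (m + 1)%:~R) ab; first exact: continuous_subspaceT.
    by rewrite ge_min le_max bm (ltW m2') orbT.
  by rewrite in_itv /= => tab; exact: H.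
move: m1' m2' b1 b2; rewrite intrD mulrDr mulr1 => *.
by rewrite ltr_norml; apply/andP; split; lra.
Qed.

Lemma polar_cross (u v u' v' r r' t t' : R) : polar u v r t -> polar u' v' r' t' ->
  u * v' - v * u' = r * r' * sin (t' - t) /\ u * u' + v * v' = r * r' * cos (t' - t).
Proof.
move=> [r0 -> ->] [r0' -> ->]; rewrite sinB cosB; split; ring.
Qed.

Lemma arg_diff_continuous a b x y x' y' theta phi : is_arg a b x y theta ->
  is_arg a b x' y' phi -> continuous (fun t => phi t - theta t).
Proof. by move=> [tc _] [pc _] t; apply: cvgB; [exact: pc|exact: tc]. Qed.

Lemma never_parallel a b x y x' y' theta phi : a <= b ->
  is_arg a b x y theta -> is_arg a b x' y' phi ->
  (forall t, a <= t <= b -> x t * y' t - y t * x' t != 0) ->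
  `|(phi b - phi a) - (theta b - theta a)| < pi.
Proof.
move=> ab xa ya H.
have := @avoid_lattice a b _ pi 0 ab (arg_diff_continuous xa ya) (pi_gt0 R).
rewrite (_ : phi b - theta b - (phi a - theta a) = phi b - phi a - (theta b - theta a)); last by ring.
apply=> t m tab; rewrite add0r => tm.
have [r Pr] := xa.2 t tab; have [r' Pr'] := ya.2 t tab.
have [cr _] := polar_cross Pr Pr'.
by have := H t tab; rewrite cr tm sinpi_int mulr0 eqxx.
Qed.

Lemma never_opposite a b x y x' y' theta phi : a <= b ->
  is_arg a b x y theta -> is_arg a b x' y' phi ->
  (forall t, a <= t <= b -> x t * y' t - y t * x' t = 0 -> 0 < x t * x' t + y t * y' t) ->
  `|(phi b - phi a) - (theta b - theta a)| < pi *+ 2.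
Proof.
move=> ab xa ya H.
have := @avoid_lattice a b _ (pi *+ 2) pi ab (arg_diff_continuous xa ya) _.
rewrite (_ : phi b - theta b - (phi a - theta a) = phi b - phi a - (theta b - theta a)); last by ring.
apply; first by rewrite mulrn_wgt0// pi_gt0.
move=> t m tab tm.
have [r Pr] := xa.2 t tab; have [r' Pr'] := ya.2 t tab.
have [cr dr] := polar_cross Pr Pr'.
have := H t tab; rewrite cr dr tm sinD2pi_int cosD2pi_int sinpi cospi mulr0 => /(_ erefl).
by case: Pr Pr' => r0 _ _ [r0' _ _]; have := mulr_gt0 r0 r0'; lra.
Qed.

Lemma arg_loop a b x y theta : a <= b -> is_arg a b x y theta -> x b = x a -> y b = y a ->
  exists m : int, theta b - theta a = pi *+ 2 * m%:~R.
Proof.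
move=> ab [_ H] xb yb; apply: cos_eq1.
have [r [r0 xE yE]] : exists r, polar (x a) (y a) r (theta a) by apply: H; rewrite lexx.
have [r' [r0' xE' yE']] : exists r, polar (x b) (y b) r (theta b) by apply: H; rewrite lexx ab.
have rn0 : r != 0 by rewrite gt_eqF.
have cs := cos2Dsin2 (theta a); have cs' := cos2Dsin2 (theta b).
have e1 : r' * cos (theta b) = r * cos (theta a) by rewrite -xE -xE'.
have e2 : r' * sin (theta b) = r * sin (theta a) by rewrite -yE -yE'.
have rr : r' = r.
  apply/eqP; rewrite -(eqrXn2 (n := 2))// ?ltW//; apply/eqP.
  rewrite -[LHS]mulr1 -cs' -[RHS]mulr1 -cs !mulrDr -!exprMn e1 e2; ring.
rewrite cosB; move: e1 e2; rewrite rr => /(mulfI rn0) -> /(mulfI rn0) ->.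
by rewrite -!expr2.
Qed.

(** Both total turnings are multiples of 2 pi, and they differ by less than 2 pi. *)
Lemma arg_loop_eq a b x y x' y' theta phi : a <= b ->
  is_arg a b x y theta -> is_arg a b x' y' phi ->
  x b = x a -> y b = y a -> x' b = x' a -> y' b = y' a ->
  (forall t, a <= t <= b -> 0 < x t * x' t + y t * y' t) ->
  phi b - phi a = theta b - theta a.
Proof.
move=> ab xa ya e1 e2 e3 e4 H.
have : `|(phi b - phi a) - (theta b - theta a)| < pi *+ 2.
  by apply: never_opposite xa ya _ => // t tab _; exact: H.
have [m ->] := arg_loop ab xa e1 e2; have [k ->] := arg_loop ab ya e3 e4.
have p2 : 0 < pi *+ 2 :> R by rewrite mulrn_wgt0// pi_gt0.
rewrite -mulrBr -intrB normrM gtr0_norm// -[X in _ < X]mulr1 ltr_pM2l//.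
rewrite -intr_norm (_ : 1 = 1%:~R)// ltr_int -[1]/(0 + 1 : int) ltzD1 normr_le0 subr_eq0.
by move=> /eqP ->.
Qed.

(** Otherwise theta would have a maximum before b, and just after it the positive cross product,
    with angles closer than pi, forces a larger value. *)
Lemma arg_loop_increasing a b x y theta : a < b -> is_arg a b x y theta ->
  (forall t, a <= t < b -> exists2 e, 0 < e & forall s, t < s < t + e -> s <= b ->
     0 < x t * y s - y t * x s) ->
  theta a < theta b.
Proof.
move=> ab [tc H] loc; rewrite ltNge; apply/negP => ba.
have [|c cI cm] := @EVT_max R theta a b (ltW ab); first exact: continuous_subspaceT.
(* A maximum at b can be moved to a, since theta b <= theta a is assumed for contradiction. *)
have {cI cm}[d [dab dm]] : exists d, a <= d < b /\ forall t, a <= t <= b -> theta t <= theta d.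
  move: cI; rewrite in_itv /= => /andP[ac]; rewrite le_eqVlt => /orP[/eqP cb|cb].
    exists a; split; first by rewrite lexx.
    by move=> t tab; apply: le_trans ba; rewrite -cb; apply: cm; rewrite in_itv.
  by exists c; split; [rewrite ac|move=> t tab; apply: cm; rewrite in_itv].
have [e e0 eH] := loc d dab; move/andP: dab => [ad db].
have : \forall s \near d, `|theta d - theta s| < pi.
  by have /cvgrPdist_lt/(_ _ (pi_gt0 R)) := tc d.
move=> /nbhs_ballP[f /= f0 fH].
pose g := Num.min (Num.min (e / 2) (f / 2)) (b - d).
have g0 : 0 < g by rewrite !lt_min; apply/andP; split; [apply/andP; split|]; lra.
have ge : g <= e / 2 by rewrite !ge_min lexx.
have gf : g <= f / 2 by rewrite !ge_min lexx orbT.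
have gb : g <= b - d by rewrite !ge_min lexx !orbT.
have sab : a <= d + g <= b by apply/andP; split; lra.
have dab : a <= d <= b by apply/andP; split; lra.
have cr : 0 < x d * y (d + g) - y d * x (d + g).
  by apply: eH; [apply/andP; split; lra|move/andP: sab => []].
have [r Pr] := H d dab; have [r' Pr'] := H _ sab.
have [crE _] := polar_cross Pr Pr'.
have := dm _ sab; have : `|theta d - theta (d + g)| < pi.
  by apply: fH; rewrite /ball /= opprD addNKr normrN gtr0_norm//; lra.
rewrite ltr_norml => /andP[h1 h2] h3.
have : 0 <= sin (theta d - theta (d + g)) by apply: sin_ge0_pi; apply/andP; split; lra.
move: cr; rewrite crE -opprB sinN.
case: Pr Pr' => r0 _ _ [r0' _ _]; rewrite pmulr_rgt0 ?mulr_gt0//; lra.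
Qed.

Lemma four_zeros a b x y theta : a <= b -> is_arg a b x y theta ->
  pi *+ 3 < theta b - theta a ->
  exists al (r : seq R), [/\ uniq r, size r = 4%N &
    forall t, t \in r -> a <= t <= b /\ x t * sin al - y t * cos al = 0].
Proof.
move=> ab [tc H] big.
(* Half of the excess over 3 pi, so that al and al + 3 pi lie at distance e inside the range between
   theta a and theta b. *)
pose e := (theta b - theta a - pi *+ 3) / 2.
pose al := theta a + e; exists al.
have e0 : 0 < e by rewrite /e; lra.
have p0 := pi_gt0 R.
have hit (k : nat) : (k < 4)%N -> exists2 t, a <= t <= b & theta t = al + pi * k%:R.
  move=> k4; have k3 : k%:R <= 3 :> R by rewrite ler_nat.
  have pk : pi * k%:R <= pi * 3 :> R by rewrite ler_pM2l.
  have pk0 : 0 <= pi * k%:R :> R by rewrite mulr_ge0// ltW.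
  have h1 : theta a <= al + pi * k%:R by rewrite /al; lra.
  have h2 : al + pi * k%:R <= theta b by rewrite /al /e; lra.
  have [||t] := @IVT R theta a b (al + pi * k%:R) ab; first exact: continuous_subspaceT.
    by rewrite ge_min le_max h1 h2 orbT.
  by rewrite in_itv /= => *; exists t.
have [t0 i0 E0] := hit 0%N erefl; have [t1 i1 E1] := hit 1%N erefl.
have [t2 i2 E2] := hit 2%N erefl; have [t3 i3 E3] := hit 3%N erefl.
exists [:: t0; t1; t2; t3]; split => //.
  have pn0 : pi != 0 :> R by rewrite gt_eqF.
  apply: (@map_uniq _ _ theta); rewrite /= E0 E1 E2 E3 !inE !(inj_eq (addrI al)).
  by rewrite !(inj_eq (mulfI pn0)) !eqr_nat.
have zero (k : nat) t : a <= t <= b -> theta t = al + pi * k%:R ->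
    a <= t <= b /\ x t * sin al - y t * cos al = 0.
  move=> tab tE; split=> //; have [r Pr] := H t tab.
  have P1 : polar (cos al) (sin al) 1 al by split; rewrite ?mul1r.
  have [-> _] := polar_cross Pr P1.
  rewrite tE opprD addNKr sinN (_ : k%:R = (k%:Z)%:~R)// sinpi_int.
  by rewrite oppr0 mulr0.
by move=> t; rewrite !inE => /or4P[] /eqP ->; [exact: zero E0|exact: zero E1|exact: zero E2|exact: zero E3].
Qed.

End Angles.

(** * The rotation number *)

Section Planar.
Context {R : realType}.
Implicit Types (x y e : 'cV[R]_3) (c g p q z w : 'cV[R]_4).

(* (plane1 x y, plane2 x y) is x_0^2 times the derivative in the direction y of
   the central projection x |-> (x_1 / x_0, x_2 / x_0). *)
Definition plane1 x y : R := x 0 0 * y 1 0 - y 0 0 * x 1 0.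
Definition plane2 x y : R := x 0 0 * y 2 0 - y 0 0 * x 2 0.

Lemma plane_cross x y e :
  plane1 x y * plane2 x e - plane2 x y * plane1 x e = x 0 0 * det3 x y e.
Proof. by rewrite /plane1 /plane2 /det3; ring. Qed.

(* If the two directions were opposite, y would be parallel to a positive
   combination of x and e, whose determinant with y and y' is positive. *)
Lemma plane_not_opposite x e y y' : 0 < x 0 0 -> 0 < e 0 0 ->
  0 < det3 e y y' -> 0 <= det3 x y y' -> plane1 x y ^+ 2 + plane2 x y ^+ 2 != 0 ->
  plane1 x y * plane2 e y - plane2 x y * plane1 e y = 0 ->
  0 < plane1 x y * plane1 e y + plane2 x y * plane2 e y.
Proof.
move=> x0 e0 de dx nz cr; rewrite ltNge; apply/negP => dle.
set A := _ + _ in nz; set D := _ + _ in dle.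
have A0 : 0 < A by rewrite lt_neqAle eq_sym nz addr_ge0 ?sqr_ge0.
have c1 : A * plane1 e y - D * plane1 x y = 0.
  transitivity (- plane2 x y * (plane1 x y * plane2 e y - plane2 x y * plane1 e y)).
    by rewrite /A /D; ring.
  by rewrite cr mulr0.
have c2 : A * plane2 e y - D * plane2 x y = 0.
  transitivity (plane1 x y * (plane1 x y * plane2 e y - plane2 x y * plane1 e y)).
    by rewrite /A /D; ring.
  by rewrite cr mulr0.
have : 0 < (A * e 0 0 - D * x 0 0) * (A * det3 e y y' - D * det3 x y y').
  have n0 : 0 <= - D by rewrite oppr_ge0.
  by rewrite -!mulNr mulr_gt0// ltr_pwDl ?mulr_gt0// mulr_ge0// ltW.
rewrite (_ : _ * _ = (A * plane1 e y - D * plane1 x y) *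
    (y' 2 0 * (A * e 0 0 - D * x 0 0) - y' 0 0 * (A * e 2 0 - D * x 2 0)) -
  (A * plane2 e y - D * plane2 x y) *
    (y' 1 0 * (A * e 0 0 - D * x 0 0) - y' 0 0 * (A * e 1 0 - D * x 1 0))).
  by rewrite c1 c2 !mul0r subr0 ltxx.
by rewrite /det3 /plane1 /plane2; ring.
Qed.

(** Coordinates in the frame of q, that is, the inverse of the rotation [Pi3 q]: the pole [frame1 q]
    goes to the first axis. *)
Definition rot q x : 'cV[R]_3 := vec3 (dot (frame1 q) x, dot (frame2 q) x, dot (frame3 q) x).

Lemma rotD q x y : rot q (x + y) = rot q x + rot q y.
Proof. by apply: vec3P; rewrite /rot !entryE !vec3E dotDr. Qed.

Lemma rotZ q a x : rot q (a *: x) = a *: rot q x.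
Proof. by apply: vec3P; rewrite /rot !entryE !vec3E dotZr. Qed.

Lemma rot_frame q z : [/\ rot q (frame1 z) = frame1 (qmul (qconj q) z),
  rot q (frame2 z) = frame2 (qmul (qconj q) z) &
  rot q (frame3 z) = frame3 (qmul (qconj q) z)].
Proof.
by split; apply: vec3P; rewrite /rot !vec3E !dotE3 ?frame1E ?frame2E ?frame3E /qmul /qconj !(vec3E, quatE); ring.
Qed.

Lemma det3_rot q x y e : sphere q -> det3 (rot q x) (rot q y) (rot q e) = det3 x y e.
Proof.
move=> q1; transitivity (det3 (frame1 q) (frame2 q) (frame3 q) * det3 x y e); last first.
  by rewrite det3_frame q1 expr1n mul1r.
by rewrite /rot /det3 !vec3E !dotE3; ring.
Qed.

Lemma sdual_qmulr p q c : sphere c -> sdual (qmul p c) (qmul q c) = sdual p q.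
Proof. by move=> c1; rewrite /sdual qconjM qmulA -(qmulA q c) qmul_conj// qmul1. Qed.

(* The determinant is the squared norm of the cross product of the imaginary
   parts. *)
Lemma det3_sdual_imag_ge0 p q : 0 <= det3 (sdual p q) (imag_part p) (imag_part q).
Proof.
rewrite (_ : det3 _ _ _ = (p 2 0 * q 3 0 - p 3 0 * q 2 0) ^+ 2 +
  (p 3 0 * q 1 0 - p 1 0 * q 3 0) ^+ 2 + (p 1 0 * q 2 0 - p 2 0 * q 1 0) ^+ 2).
  by rewrite !addr_ge0// sqr_ge0.
by rewrite /det3 /sdual !imag_partE !vec3E /qmul /qconj !quatE; ring.
Qed.

(** Right multiplication by c^-1 does not change [sdual] and reduces to c = 1, where [sdual c] is
    the imaginary part. *)
Lemma det3_sdual_ge0 c p q : sphere c -> 0 <= det3 (sdual p q) (sdual c p) (sdual c q).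
Proof.
move=> c1; have cc : dot (qconj c) (qconj c) = 1.
  by rewrite -c1 !dotE4 /qconj !quatE; ring.
by have := det3_sdual_imag_ge0 (qmul p (qconj c)) (qmul q (qconj c)); rewrite sdual_qmulr.
Qed.

(** After right multiplication by c^-1 the first column is the unit quaternion, and the minor of
    imaginary parts remains. *)
Lemma det4_det3_sdual c q p r : sphere c ->
  det4 c q p r = det3 (sdual c q) (sdual c p) (sdual c r).
Proof.
move=> c1; have cc : dot (qconj c) (qconj c) = 1.
  by rewrite -c1 !dotE4 /qconj !quatE; ring.
have := det4_qmul2r (qconj c) c q p r; rewrite cc expr1n mul1r => <-.
by rewrite qmul_conj// /det4 /det3 /sdual !imag_partE !vec3E /qone !quatE; ring.
Qed.

Lemma dot_sdual x c p : dot x (sdual c p) = dot (qmul (imag_quat x) c) p.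
Proof. by rewrite dotE3 dotE4 /sdual imag_partE /qmul /imag_quat /qconj !(vec3E, quatE); ring. Qed.

Lemma dot_qmull p q z : dot (qmul p q) z = dot q (qmul (qconj p) z).
Proof. by rewrite !dotE4 /qmul /qconj !quatE; ring. Qed.

Lemma imag_frame3 z : imag_quat (frame3 z) = qmul (qmul z qk) (qconj z).
Proof. by apply: quatP; rewrite frame3E /imag_quat /qmul /qconj /qk !(vec3E, quatE); ring. Qed.

Lemma qmulrN p q : qmul p (- q) = - qmul p q.
Proof. by apply: quatP; rewrite /qmul !(entryE, quatE); ring. Qed.

Lemma conj_qk_mul p : qmul (qconj qk) p = - qmul qk p.
Proof. by apply: quatP; rewrite /qmul /qconj /qk !entryE !quatE; ring. Qed.

(** The bridge from S^2 to S^3: [frame3 z] is z k z^-1, and moving it to the other side of the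
    product with z w^-1 gives z k w^-1, the fourth Frenet vector. Tangency of the projected chord
    thus becomes incidence of c with the osculating hyperplane. *)
Lemma dot_frame3_sdual z w c :
  dot (frame3 z) (sdual c (Pi4 (z, w) qone)) = - (dot z z * dot c (Pi4 (z, w) qk)).
Proof.
rewrite dot_sdual imag_frame3 /Pi4 /= qmul1 -!qmulA dot_qmul2l -mulrN; congr (_ * _).
rewrite [LHS]dot_qmull [LHS]dot_qmull qconjK conj_qk_mul qmulrN.
by rewrite dotC dotNl dotC.
Qed.

Lemma frame1_surjective x : sphere x -> 0 < x 0 0 -> exists2 q, sphere q & frame1 q = x.
Proof.
rewrite /sphere /= dotE3 => x1 x0; pose s := Num.sqrt ((1 + x 0 0) / 2).
have s0 : 0 < s by rewrite sqrtr_gt0; lra.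
have s2 : s ^+ 2 = (1 + x 0 0) / 2 by rewrite sqr_sqrtr//; lra.
have xs : x 1 0 ^+ 2 + x 2 0 ^+ 2 = s ^+ 2 * 4 * (1 - s ^+ 2).
  by rewrite s2; apply/eqP; rewrite -subr_eq0; apply/eqP; move: x1; rewrite -!expr2; lra.
have sn0 : s != 0 by rewrite gt_eqF.
have e2 (a : R) : a ^+ 2 = (a / (s *+ 2)) ^+ 2 * (s ^+ 2 * 4) by field.
(* The rotation about the cross product of the first axis and x; s is the cosine of half the angle
   between them. *)
exists (quat s 0 (- x 2 0 / (s *+ 2)) (x 1 0 / (s *+ 2))).
  rewrite dotE4 !quatE.
  transitivity (s ^+ 2 + (x 1 0 ^+ 2 + x 2 0 ^+ 2) / (s ^+ 2 * 4)); first by field.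
  by rewrite xs; field.
apply: vec3P; rewrite frame1E !vec3E !quatE; [|by field|by field].
transitivity (s ^+ 2 - (x 1 0 ^+ 2 + x 2 0 ^+ 2) / (s ^+ 2 * 4)); first by field.
rewrite xs mulrAC divff ?mul1r ?s2; first by lra.
by rewrite -s2 mulf_neq0// expf_neq0.
Qed.

End Planar.

Section ContinuousRing.
Context {R : realType}.
Implicit Types f g : R -> R.

Lemma continuous_addr f g : continuous f -> continuous g -> continuous (fun t => f t + g t).
Proof. by move=> fc gc t; apply: cvgD; [exact: fc|exact: gc]. Qed.

Lemma continuous_mulr f g : continuous f -> continuous g -> continuous (fun t => f t * g t).
Proof. by move=> fc gc t; apply: cvgM; [exact: fc|exact: gc]. Qed.

Lemma continuous_oppr f : continuous f -> continuous (fun t => - f t).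
Proof. by move=> fc t; apply: cvgN; exact: fc. Qed.

Lemma continuous_mulrn f n : continuous f -> continuous (fun t => f t *+ n).
Proof. by move=> fc t; apply: cvgMn; exact: fc. Qed.

Lemma eq_continuous f g : f =1 g -> continuous f -> continuous g.
Proof. by move=> /funext ->. Qed.

End ContinuousRing.

Ltac continuous_ring :=
  repeat lazymatch goal with
  | |- continuous (fun t => @GRing.add _ (@?a t) (@?b t)) => apply: continuous_addr
  | |- continuous (fun t => @GRing.mul _ (@?a t) (@?b t)) => apply: continuous_mulr
  | |- continuous (fun t => @GRing.opp _ (@?a t)) => apply: continuous_oppr
  | |- continuous (fun t => @GRing.natmul _ (@?a t) _) => apply: continuous_mulrn
  end.

Section ContinuousFrames.
Context {R : realType}.
Implicit Types f g : R -> R.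

Lemma continuous_frame (z : R -> 'cV[R]_4) : (forall i, continuous (fun t => z t i 0)) ->
  [/\ forall i, continuous (fun t => frame1 (z t) i 0),
      forall i, continuous (fun t => frame2 (z t) i 0) &
      forall i, continuous (fun t => frame3 (z t) i 0)].
Proof.
move=> zc; split; apply: ord3P;
  (eapply eq_continuous;
    [by move=> t; rewrite ?frame1E ?frame2E ?frame3E vec3E ?expr2; reflexivity
    |by continuous_ring; exact: zc]).
Qed.

Lemma continuous_plane (x y : R -> 'cV[R]_3) : (forall i, continuous (fun t => x t i 0)) ->
  (forall i, continuous (fun t => y t i 0)) ->
  continuous (fun t => plane1 (x t) (y t)) /\ continuous (fun t => plane2 (x t) (y t)).
Proof.
move=> xc yc; rewrite /plane1 /plane2; split;
  by continuous_ring; (exact: xc || exact: yc).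
Qed.

Lemma has_deriv01_gt0_right f t l : 0 <= t < 1 -> has_deriv01 f t l -> 0 < l -> f t = 0 ->
  exists2 e, 0 < e & forall s, t < s < t + e -> s <= 1 -> 0 < f s.
Proof.
move=> /andP[t0 t1] fl l0 ft.
have : \forall s \near within unit_itv t^', 0 < diff_quotient f t s.
  exact: (@cvgr_gt R _ _ _ (diff_quotient f t) l fl 0 l0).
rewrite /within /= => /nbhs_ballP[e /= e0 eH]; exists e => // s /andP[ts se] s1.
have : 0 < diff_quotient f t s.
  apply: eH; last by apply/unit_itvP; apply/andP; split; lra.
    by rewrite /ball /= distrC gtr0_norm; lra.
  by rewrite gt_eqF.
by rewrite /diff_quotient ft subr0 pmulr_rgt0// invr_gt0 subr_gt0.
Qed.

Lemma is_arg_sub a b a' b' (x y theta : R -> R) : a <= a' -> b' <= b ->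
  is_arg a b x y theta -> is_arg a' b' x y theta.
Proof.
move=> aa bb [tc H]; split=> // t /andP[at_ tb].
by apply: H; apply/andP; split; [exact: le_trans at_|exact: le_trans bb].
Qed.

Lemma is_arg_sqr a b (x y theta : R -> R) : is_arg a b x y theta ->
  is_arg a b (fun t => (x t ^+ 2 - y t ^+ 2) *+ 2) (fun t => (x t * y t) *+ 4)
    (fun t => theta t + theta t).
Proof.
move=> [tc H]; split; first exact: continuous_addr.
move=> t /H[r [r0 -> ->]]; exists (r ^+ 2 *+ 2); split.
- by rewrite mulrn_wgt0// exprn_gt0.
- by rewrite cosD; ring.
- by rewrite sinD; ring.
Qed.

Lemma is_arg_ext a b (x y x' y' theta : R -> R) :
  (forall t, a <= t <= b -> x t = x' t /\ y t = y' t) ->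
  is_arg a b x y theta -> is_arg a b x' y' theta.
Proof. by move=> E [tc H]; split=> // t tab; have [<- <-] := E t tab; exact: H. Qed.

Lemma sqr_norm_gt0 (a b : R) : a ^+ 2 + b ^+ 2 != 0 -> 0 < a ^+ 2 + b ^+ 2.
Proof. by move=> n; rewrite lt_neqAle eq_sym n addr_ge0 ?sqr_ge0. Qed.

Lemma cross_neq0 (a b c d : R) : a * d - b * c != 0 ->
  a ^+ 2 + b ^+ 2 != 0 /\ c ^+ 2 + d ^+ 2 != 0.
Proof.
by move=> n; split; apply: contra n; rewrite paddr_eq0 ?sqr_ge0// !sqrf_eq0 => /andP[/eqP-> /eqP->];
  rewrite !(mul0r, mulr0) subr0.
Qed.

Lemma has_deriv01_dot n (f h : R -> 'cV[R]_n) t (f' h' : 'cV[R]_n) :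
  has_deriv01 f t f' -> has_deriv01 h t h' ->
  has_deriv01 (fun s => dot (f s) (h s)) t (dot f' (h t) + dot (f t) h').
Proof.
move=> /has_deriv01_coordP fd /has_deriv01_coordP hd; rewrite /dot -big_split /=.
by apply: has_deriv01_sum => i; exact: has_deriv01M.
Qed.

(** Put x = [frame1 z] and y = [frame2 z]. The last two left-hand sides are (1 + x_0)^2 times the
    derivative of x_i / (1 + x_0) in the direction y, so the stereographic velocity is a positive
    multiple of the square of the complex number with parts z_0 and z_1. The first three identities
    give its inner product with the central velocity. *)
Lemma plane_frame (z : 'cV[R]_4) : sphere z ->
  [/\ plane1 (frame1 z) (frame2 z) = frame3 z 2 0,
   plane2 (frame1 z) (frame2 z) = - frame3 z 1 0,
   frame2 z 1 0 * frame3 z 2 0 - frame2 z 2 0 * frame3 z 1 0 = frame1 z 0 0,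
   1 + frame1 z 0 0 = (z 0 0 ^+ 2 + z 1 0 ^+ 2) *+ 2 &
   frame2 z 1 0 + plane1 (frame1 z) (frame2 z) = (z 0 0 ^+ 2 - z 1 0 ^+ 2) *+ 2 /\
   frame2 z 2 0 + plane2 (frame1 z) (frame2 z) = (z 0 0 * z 1 0) *+ 4].
Proof.
move=> z1; have p1 : plane1 (frame1 z) (frame2 z) = dot z z * frame3 z 2 0.
  by rewrite /plane1 frame1E frame2E frame3E !vec3E dotE4; ring.
have p2 : plane2 (frame1 z) (frame2 z) = dot z z * - frame3 z 1 0.
  by rewrite /plane2 frame1E frame2E frame3E !vec3E dotE4; ring.
have p3 : frame2 z 1 0 * frame3 z 2 0 - frame2 z 2 0 * frame3 z 1 0 = dot z z * frame1 z 0 0.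
  by rewrite frame1E frame2E frame3E !vec3E dotE4; ring.
rewrite p1 p2 p3 z1 !mul1r; split=> //.
  by rewrite -z1 dotE4 frame1E vec3E; ring.
by split; rewrite frame2E frame3E !vec3E; ring.
Qed.

Lemma has_deriv01_plane (p r : R -> 'cV[R]_3) t (p' r' : 'cV[R]_3) :
  (forall i, has_deriv01 (fun s => p s i 0) t (p' i 0)) ->
  (forall i, has_deriv01 (fun s => r s i 0) t (r' i 0)) ->
  has_deriv01 (fun s => plane1 (p s) (r s)) t (plane1 p' (r t) + plane1 (p t) r') /\
  has_deriv01 (fun s => plane2 (p s) (r s)) t (plane2 p' (r t) + plane2 (p t) r').
Proof.
move=> dp dr; have D i j := has_deriv01M (dp i) (dr j).
have N (f : R -> R) (f' : R) : has_deriv01 f t f' -> has_deriv01 (fun s => - f s) t (- f').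
  move=> /(has_deriv01M (has_deriv01_cst (-1 : R) t)) H.
  by apply: has_deriv01_congr H => [s|]; rewrite ?(mul0r, add0r) mulN1r.
have D' i j : has_deriv01 (fun s => p s 0 0 * r s i 0 - r s 0 0 * p s j 0) t
    (p' 0 0 * r t i 0 + p t 0 0 * r' i 0 - (p' j 0 * r t 0 0 + p t j 0 * r' 0 0)).
  apply: has_deriv01_congr (has_deriv01D (D 0 i) (N _ _ (D j 0))) => // s.
  by rewrite (mulrC (r s 0 0)).
by split; [apply: has_deriv01_congr (D' 1 1)|apply: has_deriv01_congr (D' 2 2)] => //;
  rewrite /plane1 /plane2; ring.
Qed.

Lemma planexx (p : 'cV[R]_3) : plane1 p p = 0 /\ plane2 p p = 0.
Proof. by rewrite /plane1 /plane2 !subrr. Qed.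

Lemma det3_frame12 (z : 'cV[R]_4) x : det3 (frame1 z) (frame2 z) x = dot z z * dot (frame3 z) x.
Proof. by rewrite /det3 dotE3 dotE4 frame1E frame2E frame3E !vec3E; ring. Qed.

Lemma det3Zl (a : R) (x y z : 'cV[R]_3) : det3 (a *: x) y z = a * det3 x y z.
Proof. by rewrite /det3 !entryE; ring. Qed.

End ContinuousFrames.

(** * Turning of the centrally projected left part *)

Section Turning.
Context {R : realType} (gamma : R -> 'cV[R]_4) (G : R -> 'cV[R]_4 * 'cV[R]_4).
Context (glc : Defs.locally_convex gamma) (gconvex : globally_convex gamma).
Context (lift : lifted_frenet4 gamma G) (loop : (G 1).1 = (G 0).1).
Context (q : 'cV[R]_4) (q1 : sphere q).
Context (pole : forall t, unit_itv t -> 0 < dot (frame1 q) (frame1 (G t).1)).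
Implicit Types (s t : R).

Let gsmooth : smooth01 gamma. Proof. by case: glc => -[]. Qed.
Let gsphere t : unit_itv t -> sphere (gamma t). Proof. by case: glc => -[_ +] _; exact. Qed.
Let g k := deriv01n k gamma.
Let l k := deriv01n k (left_part G).
Let I0 : unit_itv (0 : R). Proof. by apply/unit_itvP; rewrite lexx ler01. Qed.
Let I1 : unit_itv (1 : R). Proof. by apply/unit_itvP; rewrite lexx ler01. Qed.

(** Sharpens [left_part_jet]: differentiating the constant norm removes the component of the
    velocity along the curve itself. *)
Lemma left_part_frame t : unit_itv t -> exists b11 b02 b12 b22,
  [/\ 0 < b11, 0 < b22, l 1 t = b11 *: frame2 (G t).1 &
    l 2 t = b02 *: frame1 (G t).1 + b12 *: frame2 (G t).1 + b22 *: frame3 (G t).1].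
Proof.
move=> It; have [z1 _] := sphere_lift lift It.
have [b01 [b11 [b02 [b12 [b22 [p1 p2 E1 E2]]]]]] := left_part_jet gsmooth gsphere lift It.
exists b11, b02, b12, b22; split=> //.
have L1 s : unit_itv s -> dot (l 0 s) (l 0 s) = 1.
  by move=> Is; have [zs _] := sphere_lift lift Is; have [[]] := frame_orthonormal zs.
have dL := @smooth01_has_deriv R _ 0%N _ _ (left_part_smooth gsmooth gsphere lift) It.
have d1 := deriv01_eq It (has_deriv01_dot dL dL).
have d0 : deriv01 (fun s => dot (l 0 s) (l 0 s)) t = 0.
  apply: (deriv01_eq It); apply: (has_deriv01_ext It _ (has_deriv01_cst (1 : R) t)).
  by move=> s /set_mem Is; rewrite L1.
have [[f1 _ _] [f12 _ _]] := frame_orthonormal z1.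
have : b01 = 0.
  have d2 : 0 = dot (l 1 t) (frame1 (G t).1) + dot (frame1 (G t).1) (l 1 t).
    by rewrite -[LHS]d0; exact: d1.
  move: d2; rewrite [l 1 t]E1 !(dotDl, dotDr, dotZl, dotZr) (dotC (frame2 _)) f12 f1; lra.
by rewrite [l 1 t]E1 => ->; rewrite scale0r add0r.
Qed.

(** The left lift in coordinates where the pole is the first axis. Its frame (x, y, n) is the
    rotated Frenet frame of the left part. *)
Definition turned t := qmul (qconj q) (G (clamp01 t)).1.
Let x t := frame1 (turned t).
Let y t := frame2 (turned t).
Let n t := frame3 (turned t).

Lemma turned_sphere t : sphere (turned t).
Proof.
have [z1 _] := sphere_lift lift (clamp01_itv t).
by rewrite /sphere /= dot_qmul2l z1 mulr1 -q1 !dotE4 /qconj !quatE; ring.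
Qed.

Lemma turned_rot t : unit_itv t -> [/\ rot q (frame1 (G t).1) = x t,
  rot q (frame2 (G t).1) = y t & rot q (frame3 (G t).1) = n t].
Proof. by move=> It; rewrite /x /y /n /turned clamp01_id//; exact: rot_frame. Qed.

Lemma turned_pole t : 0 < x t 0 0.
Proof.
rewrite /x; have [<- _ _] := rot_frame q (G (clamp01 t)).1.
by rewrite /rot vec3E; exact/pole/clamp01_itv.
Qed.

Lemma turned_continuous i : continuous (fun t => turned t i 0).
Proof.
have c j := (lift_continuous j lift).1.
move: i; apply: ord4P; (eapply eq_continuous;
  [by move=> t; rewrite /turned /qmul quatE; reflexivity
  |by continuous_ring; (exact: c || (move=> ?; exact: cvg_cst))]).
Qed.

Let xc : forall i, continuous (fun t => x t i 0).
Proof. by have [] := continuous_frame turned_continuous. Qed.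
Let yc : forall i, continuous (fun t => y t i 0).
Proof. by have [] := continuous_frame turned_continuous. Qed.

Lemma turned_loop : turned 1 = turned 0.
Proof. by rewrite /turned !clamp01_id// loop. Qed.

Lemma plane_xy_gt0 t : 0 < plane1 (x t) (y t) ^+ 2 + plane2 (x t) (y t) ^+ 2.
Proof.
have [p1 p2 p3 _ _] := plane_frame (turned_sphere t).
apply: sqr_norm_gt0; rewrite /x /y p1 p2 sqrrN; apply: contraTneq (turned_pole t) => /eqP.
rewrite paddr_eq0 ?sqr_ge0// !sqrf_eq0 => /andP[/eqP e2 /eqP e1].
by rewrite /x -p3 e1 e2 !mulr0 subrr ltxx.
Qed.

(** The two coordinates do not vanish together, because twice the sum of their squares is 1 + x_0,
    with x_0 > 0 by the pole condition. *)
Lemma exists_half_arg : exists psi,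
  is_arg 0 1 (fun t => turned t 0 0) (fun t => turned t 1 0) psi.
Proof.
apply: exists_arg ler01 _ _ _; [exact: turned_continuous|exact: turned_continuous|].
move=> t _; have [_ _ _ e _] := plane_frame (turned_sphere t).
by have := turned_pole t; rewrite /x; lra.
Qed.

Let chord c t := rot q (sdual c (gamma (clamp01 t))).

Lemma chord_continuous c i : continuous (fun t => chord c t i 0).
Proof.
have gc j : continuous (fun t => gamma (clamp01 t) j 0).
  apply: (@has_deriv01_continuous_clamp R (fun t => gamma t j 0) (fun t => g 1 t j 0)) => t It.
  by have /has_deriv01_coordP := @smooth01_has_deriv R _ 0%N _ _ gsmooth It.
have c' w : continuous (fun t => dot w (sdual c (gamma (clamp01 t)))).
  under eq_fun do rewrite dot_sdual dotE4.
  do 3 (apply: continuous_addr; last (apply: continuous_mulr; [by move=> ?; exact: cvg_cst|exact: gc])).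
  by apply: continuous_mulr; [by move=> ?; exact: cvg_cst|exact: gc].
by move: i; apply: ord3P; rewrite /chord /rot; under eq_fun do rewrite vec3E; exact: c'.
Qed.

(** Up to sign the determinant is the inner product of gamma s with the fourth Frenet vector at t.
    The hyperplane orthogonal to that vector has contact 3 with gamma at t, so a zero would add up
    to 3 + 1. *)
Lemma chord_not_tangent s t : 0 < s < 1 -> 0 < t < 1 -> s != t ->
  det3 (x t) (y t) (chord (gamma s) t) != 0.
Proof.
move=> s01 t01 st; have It := itv01W t01.
have [z1 w1] := sphere_lift lift It.
have [<- <- _] := turned_rot It.
rewrite /chord det3_rot// det3_frame12 z1 mul1r clamp01_id//.
have [a01 [a11 [a02 [a12 [a22 [_ [_ [_ [_ [_ H0 H1 H2 _]]]]]]]]]] := jet_frame gsphere lift It.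
rewrite -[gamma t]/(g 0 t) /g H0 (surjective_pairing (G t)) dot_frame3_sdual z1 mul1r oppr_eq0.
rewrite -surjective_pairing; apply/eqP => c0.
have [qo qi_ qj_ qk_] := @sphere_qbasis R.
have o (p : 'cV[R]_4) : dot qk p = 0 -> dot (Pi4 (G t) qk) (Pi4 (G t) p) = 0.
  by rewrite (surjective_pairing (G t)) dot_Pi4.
have [k0 k1 k2] : [/\ dot qk (qone : 'cV[R]_4) = 0, dot qk (qi : 'cV[R]_4) = 0 &
    dot qk (qj : 'cV[R]_4) = 0].
  by rewrite !dotE4 /qone /qi /qj /qk !quatE; split; ring.
have a0 : Pi4 (G t) qk != 0 by apply: (frame_neq0 lift It).
have := @contact_le R gamma gconvex (Pi4 (G t) qk) [:: s; t] (fun u => if u == t then 3%N else 1%N) a0.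
rewrite /= inE st !big_cons big_nil (negbTE st) eqxx => /(_ erefl) H.
suff : (1 + (3 + 0) <= 3)%N by [].
apply: H => u; rewrite !inE => /orP[] /eqP ->.
  rewrite (negbTE st); split; first exact: s01.
  by split=> // -[|j] // _; rewrite dotC.
rewrite eqxx; split; first exact: t01.
split=> // -[|[|[|j]]] // _; rewrite -/(g _ _) /g ?H0 ?H1 ?H2 ?(dotDr, dotZr) ?o ?mulr0 ?addr0//.
Qed.

(** The last argument is the derivative of the chord in t. At x s the determinant is a positive
    multiple of [contact s t]; at x t it is a squared norm up to a positive factor. These are the
    sign conditions of [plane_not_opposite]. *)
Lemma chord_det_gt0 s t : 0 < s -> s < t -> t < 1 ->
  0 < det3 (x s) (chord (gamma s) t) (rot q (sdual (gamma s) (g 1 t))) /\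
  0 <= det3 (x t) (chord (gamma s) t) (rot q (sdual (gamma s) (g 1 t))).
Proof.
move=> s0 st t1; have Is : unit_itv s by apply/unit_itvP/andP; split; lra.
have It : unit_itv t by apply/unit_itvP/andP; split; lra.
have E u : unit_itv u -> exists2 k, 0 < k & x u = k *: rot q (sdual (gamma u) (g 1 u)).
  move=> Iu; exists (isd gamma u); first exact: (isd_gt0 gsphere lift).
  have [<- _ _] := turned_rot Iu.
  by rewrite -rotZ -(left_partE gsphere lift Iu).
rewrite /chord clamp01_id//; split.
  have [k k0 ->] := E s Is.
  rewrite -rotZ det3_rot// det3Zl -det4_det3_sdual; last exact: gsphere.
  by rewrite mulr_gt0//; exact: (contact_gt0 glc gconvex).
have [k k0 ->] := E t It.
rewrite -rotZ det3_rot// det3Zl.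
by rewrite mulr_ge0 ?(ltW k0)//; apply: det3_sdual_ge0; exact: gsphere.
Qed.

(** Being parallel to the direction al is a linear condition on p. It is not trivial: its dual
    vector w has the components e_0 sin al and - e_0 cos al along [frame2 q] and [frame3 q]. *)
Lemma functional_neq0 (e : 'cV[R]_3) (al : R) (c : 'cV[R]_4) : 0 < e 0 0 -> sphere c ->
  exists2 a : 'cV[R]_4, a != 0 & forall p, dot a p =
    plane1 e (rot q (sdual c p)) * sin al - plane2 e (rot q (sdual c p)) * cos al.
Proof.
move=> e0 c1; have [[f1 f2 f3] [f12 f13 f23]] := frame_orthonormal q1.
pose w := sin al *: (e 0 0 *: frame2 q - e 1 0 *: frame1 q)
  - cos al *: (e 0 0 *: frame3 q - e 2 0 *: frame1 q).
exists (qmul (imag_quat w) c); last first.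
  by move=> p; rewrite -dot_sdual /w !(dotNl, dotDl, dotZl) /plane1 /plane2 /rot !vec3E; ring.
apply/eqP => wc.
have : dot (qmul (imag_quat w) c) (qmul (imag_quat w) c) = 0 by rewrite wc dot0r.
rewrite dot_qmul2r c1 mul1r => ww.
have w0 : w = 0.
  by apply: dot_eq0; rewrite -ww dotE3 dotE4 /imag_quat !quatE mul0r add0r.
have E2 : dot (frame2 q) w = sin al * e 0 0.
  by rewrite dotC /w !(dotNl, dotDl, dotZl) f2 (dotC (frame3 _)) f23 f12; ring.
have E3 : dot (frame3 q) w = - cos al * e 0 0.
  by rewrite dotC /w !(dotNl, dotDl, dotZl) f3 f23 f13; ring.
have := cos2Dsin2 al.
rewrite w0 !dot0r in E2 E3; move/esym/eqP: E2; move/esym/eqP: E3.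
rewrite !mulf_eq0 oppr_eq0 !(gt_eqF e0) !orbF => /eqP -> /eqP ->.
by rewrite expr0n addr0 => /esym/eqP; rewrite oner_eq0.
Qed.

Lemma chord_turning s t1 t2 theta : 0 < s -> s < t1 -> t1 <= t2 -> t2 < 1 ->
  is_arg t1 t2 (fun t => plane1 (x s) (chord (gamma s) t))
    (fun t => plane2 (x s) (chord (gamma s) t)) theta ->
  theta t2 - theta t1 <= pi *+ 3.
Proof.
move=> s0 st t12 t21 th; have Is : unit_itv s by apply/unit_itvP/andP; split; lra.
rewrite leNgt; apply/negP => /(four_zeros t12 th)[al [r [ur sr H]]].
have [a a0 aE] := @functional_neq0 (x s) al (gamma s) (turned_pole s) (gsphere Is).
have := @contact_le R gamma gconvex a r (fun=> 1%N) a0 ur.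
rewrite sum1_size sr => K; suff : (4 <= 3)%N by []. 
apply: K => t /H[/andP[tl tr] E]; have t01 : 0 < t < 1 by apply/andP; split; lra.
split; first exact: t01.
split=> // -[|j] // _; rewrite aE -E /chord clamp01_id//; exact: itv01W.
Qed.

Lemma tangent_turning s t1 t2 theta : 0 < s -> s < t1 -> t1 <= t2 -> t2 < 1 ->
  is_arg t1 t2 (fun t => plane1 (x t) (y t)) (fun t => plane2 (x t) (y t)) theta ->
  theta t2 - theta t1 < pi *+ 6.
Proof.
move=> s0 st t12 t21 th.
have cc i := @chord_continuous (gamma s) i.
have [pc1 pc2] := continuous_plane xc cc.
have ec i : continuous (fun _ : R => x s i 0) by move=> ?; exact: cvg_cst.
have [qc1 qc2] := continuous_plane ec cc.
have cr t : t1 <= t <= t2 ->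
    plane1 (x t) (y t) * plane2 (x t) (chord (gamma s) t) -
    plane2 (x t) (y t) * plane1 (x t) (chord (gamma s) t) != 0.
  move=> /andP[tl tr]; rewrite plane_cross mulf_neq0//; first by rewrite gt_eqF// turned_pole.
  by apply: chord_not_tangent; [apply/andP; split; lra|apply/andP; split; lra|rewrite lt_eqF//; lra].
have dt t : t1 <= t <= t2 ->
    0 < det3 (x s) (chord (gamma s) t) (rot q (sdual (gamma s) (g 1 t))) /\
    0 <= det3 (x t) (chord (gamma s) t) (rot q (sdual (gamma s) (g 1 t))).
  by move=> /andP[tl tr]; apply: chord_det_gt0; lra.
have nz t : t1 <= t <= t2 ->
    plane1 (x t) (chord (gamma s) t) ^+ 2 + plane2 (x t) (chord (gamma s) t) ^+ 2 != 0.
  by move=> /cr/cross_neq0[].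
have [ph1 P1] : exists phi, is_arg t1 t2 (fun t => plane1 (x t) (chord (gamma s) t))
    (fun t => plane2 (x t) (chord (gamma s) t)) phi.
  by apply: exists_arg t12 pc1 pc2 _ => t tt; apply: sqr_norm_gt0; exact: nz.
have [ph2 P2] : exists phi, is_arg t1 t2 (fun t => plane1 (x s) (chord (gamma s) t))
    (fun t => plane2 (x s) (chord (gamma s) t)) phi.
  apply: exists_arg t12 qc1 qc2 _ => t tt; apply: sqr_norm_gt0.
  have [d0 _] := dt t tt; have := plane_cross (x s) (chord (gamma s) t) (rot q (sdual (gamma s) (g 1 t))).
  move=> E; have : x s 0 0 * det3 (x s) (chord (gamma s) t) (rot q (sdual (gamma s) (g 1 t))) != 0.
    by rewrite mulf_neq0// gt_eqF// turned_pole.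
  by rewrite -E => /cross_neq0[].
have h1 := never_parallel t12 th P1 cr.
have h2 : `|(ph2 t2 - ph2 t1) - (ph1 t2 - ph1 t1)| < pi *+ 2.
  apply: never_opposite t12 P1 P2 _ => t tt E; have [d0 d1] := dt t tt.
  exact: plane_not_opposite (turned_pole t) (turned_pole s) d0 d1 (nz t tt) E.
have h3 := chord_turning s0 st t12 t21 P2.
move: h1 h2; rewrite !ltr_norml => /andP[h11 h12] /andP[h21 h22].
by move: h11 h12 h21 h22 h3; rewrite ?mulr2n ?mulrS; lra.
Qed.

Lemma tangent_turning_loop theta :
  is_arg 0 1 (fun t => plane1 (x t) (y t)) (fun t => plane2 (x t) (y t)) theta ->
  theta 1 - theta 0 < pi *+ 8.
Proof.
move=> th; have p0 := pi_gt0 R; have tc := th.1.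
have [t1 [t10 t11 d1]] : exists t1, [/\ 0 < t1, t1 < 1 / 2 & `|theta 0 - theta t1| < pi].
  have /cvgrPdist_lt/(_ _ p0) := tc 0.
  move=> /nbhs_ballP[e /= e0 eH]; pose d := Num.min (e / 2) (1 / 4).
  have d0 : 0 < d by rewrite lt_min; apply/andP; split; lra.
  have de : d <= e / 2 by rewrite ge_min lexx.
  have d4 : d <= 1 / 4 by rewrite ge_min lexx orbT.
  exists d; split=> //; first by lra.
  by apply: eH; rewrite /ball /= sub0r normrN gtr0_norm//; lra.
have [t2 [t20 t21 d2]] : exists t2, [/\ 1 / 2 < t2, t2 < 1 & `|theta 1 - theta t2| < pi].
  have /cvgrPdist_lt/(_ _ p0) := tc 1.
  move=> /nbhs_ballP[e /= e0 eH]; pose d := Num.min (e / 2) (1 / 4).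
  have d0 : 0 < d by rewrite lt_min; apply/andP; split; lra.
  have de : d <= e / 2 by rewrite ge_min lexx.
  have d4 : d <= 1 / 4 by rewrite ge_min lexx orbT.
  exists (1 - d); split; [by lra|by lra|].
  by apply: eH; rewrite /ball /= opprB addrCA subrr addr0 gtr0_norm//; lra.
have h : theta t2 - theta t1 < pi *+ 6.
  (* The base point lies strictly before t1, since the chord from gamma s vanishes at t = s. *)
  apply: (@tangent_turning (t1 / 2)); [lra|lra|lra|lra|].
  by apply: is_arg_sub th; lra.
move: d1 d2; rewrite !ltr_norml => /andP[h11 h12] /andP[h21 h22].
by move: h; rewrite ?mulrS; lra.
Qed.

Lemma tangent_turning_gt0 theta :
  is_arg 0 1 (fun t => plane1 (x t) (y t)) (fun t => plane2 (x t) (y t)) theta ->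
  theta 0 < theta 1.
Proof.
move=> th; apply: arg_loop_increasing ltr01 th _ => t t01.
have It : unit_itv t by apply/unit_itvP; move/andP: t01 => [a b]; rewrite a ltW.
have [b11 [b02 [b12 [b22 [p1 p2 E1 E2]]]]] := left_part_frame It.
(* [y] comes from the lift, which is only continuous. Derivatives are taken on [L], whose first
   derivative is a positive multiple of [y]. *)
pose L k s := rot q (l k s).
have Ld k i : has_deriv01 (fun s => L k s i 0) t (L k.+1 t i 0).
  have dl := @smooth01_has_deriv R _ k _ _ (left_part_smooth gsmooth gsphere lift) It.
  by move: i; apply: ord3P; rewrite /L /rot; under eq_fun do rewrite vec3E; rewrite vec3E;
    exact: has_deriv01_dotr.
have L0 s : unit_itv s -> L 0%N s = x s by move=> Is; have [] := turned_rot Is.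
have L1 s : unit_itv s -> exists2 b, 0 < b & L 1%N s = b *: y s.
  move=> Is; have [c11 [_ [_ [_ [c0 _ E _]]]]] := left_part_frame Is.
  by exists c11 => //; rewrite /L E rotZ; have [_ -> _] := turned_rot Is.
have L2 : L 2%N t = b02 *: x t + b12 *: y t + b22 *: n t.
  by rewrite /L E2 !rotD !rotZ; have [-> -> ->] := turned_rot It.
set A := plane1 (x t) (y t); set B := plane2 (x t) (y t).
(* A positive multiple of the cross product of the directions at t and at s. It vanishes at s = t,
   with derivative x_0 times the determinant of x, y and the second derivative of the left part. *)
pose f s := A * plane2 (L 0%N s) (L 1%N s) - B * plane1 (L 0%N s) (L 1%N s).
have fd : has_deriv01 f t (A * plane2 (L 0%N t) (L 2%N t) - B * plane1 (L 0%N t) (L 2%N t)).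
  have cM (a : R) h h' : has_deriv01 h t h' -> has_deriv01 (fun s => a * h s) t (a * h').
    move=> hd; apply: has_deriv01_congr (has_deriv01M (has_deriv01_cst a t) hd) => //.
    by rewrite mul0r add0r.
  have [D1 D2] := has_deriv01_plane (Ld 0%N) (Ld 1%N).
  have D := has_deriv01D (cM A _ _ D2) (cM (- B) _ _ D1).
  apply: has_deriv01_congr D => [s|]; first by rewrite /f mulNr.
  by have [-> ->] := planexx (L 1%N t); rewrite !add0r mulNr.
have f1 : 0 < A * plane2 (L 0%N t) (L 2%N t) - B * plane1 (L 0%N t) (L 2%N t).
  rewrite L0// plane_cross mulr_gt0 ?turned_pole// L2.
  rewrite (_ : det3 _ _ _ = b22 * det3 (x t) (y t) (n t)).
    by rewrite mulr_gt0// det3_frame turned_sphere expr1n.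
  by rewrite /det3 !entryE; ring.
have f0 : f t = 0.
  rewrite /f L0//; have [b _ ->] := L1 t It.
  by rewrite /A /B /plane1 /plane2 !entryE; ring.
have [e e0 eH] := has_deriv01_gt0_right t01 fd f1 f0.
exists e => // s st s1; have := eH s st s1.
have Is : unit_itv s.
  by apply/unit_itvP; move/andP: t01 st => [a _] /andP[b _]; rewrite s1 andbT; lra.
rewrite /f L0//; have [b b0 ->] := L1 s Is.
rewrite (_ : _ - _ = b * (A * plane2 (x s) (y s) - B * plane1 (x s) (y s))).
  by rewrite pmulr_rgt0.
by rewrite /plane1 /plane2 !entryE; ring.
Qed.

Lemma half_turning psi :
  is_arg 0 1 (fun t => turned t 0 0) (fun t => turned t 1 0) psi -> psi 1 - psi 0 = pi *+ 2.
Proof.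
move=> ps; have [pc1 pc2] := continuous_plane xc yc.
have [th tha] := exists_arg ler01 pc1 pc2 (fun t _ => plane_xy_gt0 t).
have psq : is_arg 0 1 (fun t => y t 1 0 + plane1 (x t) (y t))
    (fun t => y t 2 0 + plane2 (x t) (y t)) (fun t => psi t + psi t).
  apply: is_arg_ext (is_arg_sqr ps) => t _.
  by have [_ _ _ _ [-> ->]] := plane_frame (turned_sphere t).
(* The inner product of the stereographic and central velocities is x_0 plus the squared norm of the
   latter, hence positive. *)
have E : psi 1 + psi 1 - (psi 0 + psi 0) = th 1 - th 0.
  apply: (arg_loop_eq ler01 tha psq); rewrite ?/x ?/y ?turned_loop// => t _.
  have [p1 p2 p3 _ _] := plane_frame (turned_sphere t).
  have := turned_pole t; have := plane_xy_gt0 t; rewrite /x /y p1 p2 -p3 sqrrN; lra.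
have [d dE] := arg_loop ler01 ps (congr1 (fun z : 'cV[R]_4 => z 0 0) turned_loop)
  (congr1 (fun z : 'cV[R]_4 => z 1 0) turned_loop).
(* With psi 1 - psi 0 = 2 pi d, the total turning 4 pi d lies strictly between 0 and 8 pi, which
   leaves d = 1. *)
have up := tangent_turning_loop tha; have lo := tangent_turning_gt0 tha.
have p0 := pi_gt0 R.
have l1 : 0 < pi * d%:~R :> R by move: dE; rewrite ?mulrS; lra.
have u1 : pi * d%:~R < pi * 2 :> R by move: dE up; rewrite ?mulrS; lra.
rewrite pmulr_rgt0// ltr0z in l1; rewrite ltr_pM2l// (_ : 2 = 2%:~R :> R)// ltr_int in u1.
by rewrite dE (_ : d = 1) ?mulr1//; move: l1 u1; case: d {dE} => [[|[|k]]|k].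
Qed.

End Turning.

(** * The stereographic velocity and the conclusion *)

Section RotationNumber.
Context {R : realType}.

(** On positive functions the inverse is the square of the inverse square root, whose derivative is
    known. *)
Lemma has_deriv01V (f : R -> R) t (l : R) : unit_itv t ->
  (forall s, unit_itv s -> 0 < f s) -> has_deriv01 f t l ->
  has_deriv01 (fun s => (f s)^-1) t (- l / f t ^+ 2).
Proof.
move=> It f0 fd; have rE s : unit_itv s -> (Num.sqrt (f s))^-1 * (Num.sqrt (f s))^-1 = (f s)^-1.
  by move=> Is; rewrite -invfM -expr2 sqr_sqrtr// ltW// f0.
have rd := has_deriv01_rsqrt (f0 t It) fd.
apply: (has_deriv01_ext It (f := fun s => (Num.sqrt (f s))^-1 * (Num.sqrt (f s))^-1)).
  by move=> s /set_mem Is; exact: rE.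
apply: has_deriv01_congr (has_deriv01M rd rd) => //.
rewrite -exprVn -(rE t It); move: (Num.sqrt _)^-1 => r.
by field.
Qed.

Lemma sphere_circle (a : R) : sphere (\col_i [:: cos a; sin a]`_i : 'cV[R]_2).
Proof. by rewrite /sphere /= /dot !big_ord_recl big_ord0 !mxE /= addr0 -!expr2 cos2Dsin2. Qed.

Context (gamma : R -> 'cV[R]_4) (G : R -> 'cV[R]_4 * 'cV[R]_4).
Context (glc : Defs.locally_convex gamma) (gconvex : globally_convex gamma).
Context (lift : lifted_frenet4 gamma G) (loop : (G 1).1 = (G 0).1).
Context (q : 'cV[R]_4) (q1 : sphere q).
Context (pole : forall t, unit_itv t -> 0 < dot (frame1 q) (frame1 (G t).1)).

Let gsmooth : smooth01 gamma. Proof. by case: glc => -[]. Qed.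
Let gsphere t : unit_itv t -> sphere (gamma t). Proof. by case: glc => -[_ +] _; exact. Qed.
Let eta := stereographic (frame2 q) (- frame3 q) (frame1 q) \o left_part G.

(** The second axis is [- frame3 q], as the negative orientation of the basis requires; this
    conjugates the square in [plane_frame] and turns the angle 2 psi into its opposite. *)
Lemma deriv01_stereographic psi t :
  is_arg 0 1 (fun t => turned G q t 0 0) (fun t => turned G q t 1 0) psi -> unit_itv t ->
  exists2 k, 0 < k & deriv01 eta t =
    k *: \col_i [:: cos (- (psi t + psi t)); sin (- (psi t + psi t))]`_i.
Proof.
move=> ps It; have [b [_ [_ [_ [b0 _ lE _]]]]] := left_part_frame glc lift It.
have z1 := turned_sphere lift q1 t.
have [xE yE _] := turned_rot G q It.
have [_ _ _ _ [e1 e2]] := plane_frame z1.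
have /is_arg_sqr[_ /(_ t)] := ps.
have /unit_itvP t01 := It => /(_ t01)[r [r0 c1 c2]].
pose L s := rot q (left_part G s).
have x0 s : unit_itv s -> 0 < 1 + L s 0 0.
  by move=> Is; rewrite ltr_pwDl// /L /rot vec3E ltW//; exact: pole.
have Ld i : has_deriv01 (fun s => L s i 0) t (b * frame2 (turned G q t) i 0).
  rewrite -yE -entryZ -rotZ -lE.
  have dl := @smooth01_has_deriv R _ 0%N _ _ (left_part_smooth gsmooth gsphere lift) It.
  by move: i; apply: ord3P; rewrite /L /rot; under eq_fun do rewrite vec3E; rewrite vec3E;
    exact: has_deriv01_dotr.
have ld0 : has_deriv01 (fun s => 1 + L s 0 0) t (b * frame2 (turned G q t) 0 0).
  apply: has_deriv01_congr (has_deriv01D (has_deriv01_cst (1 : R) t) (Ld 0)) => //.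
  by rewrite add0r.
have Q i := has_deriv01M (has_deriv01V It x0 ld0) (Ld i).
have x0t := x0 t It; have LE : L t = frame1 (turned G q t) by [].
rewrite LE in x0t Q.
have x0n : 1 + frame1 (turned G q t) 0 0 != 0 by rewrite gt_eqF.
set k := b / (1 + frame1 (turned G q t) 0 0) ^+ 2.
have k0 : 0 < k by rewrite divr_gt0// exprn_gt0.
exists (k * r); first exact: mulr_gt0.
apply: deriv01_eq It _; apply/has_deriv01_coordP => i.
rewrite entryZ mxE cosN sinN; case: i => -[|[|//]] i2 /=.
- apply: has_deriv01_congr (Q 1) => [s|].
    by rewrite /eta /= /stereographic entryZ [X in _ = _ * X]mxE /= /L /rot !vec3E.
  rewrite -(mulrA k r) -c1 -e1 /plane1 /k; field.
  exact: x0n.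
- have QN := has_deriv01M (has_deriv01_cst (-1 : R) t) (Q 2).
  apply: has_deriv01_congr QN => [s|].
    by rewrite /eta /= /stereographic entryZ [X in _ = _ * X]mxE /= /L /rot !vec3E dotNl; ring.
  rewrite (mulrN (k * r)) -(mulrA k r) -c2 -e2 /plane2 /k; field.
  by rewrite LE x0n.
Qed.

Lemma left_part_plane_rotation : plane_rotation_number eta (- 2).
Proof.
have [psi ps] := exists_half_arg lift q1 pole.
have D := @deriv01_stereographic psi _ ps.
split.
- by rewrite /eta /= /left_part loop.
- move=> t It; have [k k0 ->] := D t It.
  rewrite scaler_eq0 negb_or gt_eqF//=; apply/eqP => c0.
  by have := sphere_circle (- (psi t + psi t)); rewrite c0 /sphere /= dot0r => /esym/eqP; rewrite oner_eq0.
exists (fun t => - (psi t + psi t)); split.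
- by apply: continuous_subspaceT; apply: continuous_oppr; apply: continuous_addr; exact: ps.1.
- by move=> t It; have [k k0 ->] := D t It; rewrite normalizeZ//; exact: sphere_circle.
- have := half_turning glc gconvex lift loop q1 pole ps.
  by rewrite -mulr_natr; lra.
Qed.

End RotationNumber.

Theorem theoremD (R : realType) (gamma : R -> 'cV[R]_4)
    (G : R -> 'cV[R]_4 * 'cV[R]_4) :
  LS3 qone (- qone) gamma ->
  lifted_frenet4 gamma G ->
  globally_convex gamma ->
  [/\ LS2 qone (left_part G),
      exists2 h : 'cV[R]_3, sphere h &
        left_part G @` unit_itv `<=` open_hemisphere h &
      rotation_number (left_part G) 2].
Proof.
move=> [glc F0 [G' lift' G'1]] lift gconvex.
have [[gsmooth gsphere] _] := glc.
have [_ G0 _ _] := lift.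
have I0 : unit_itv (0 : R) by apply/unit_itvP; rewrite lexx ler01.
(* The end value is given for some lift; uniqueness transfers it to G. *)
have G1 : G 1 = (qone, - qone) by rewrite (lift_unique lift lift').
have loop : (G 1).1 = (G 0).1 by rewrite G1 G0.
have lc := lift_continuous _ lift.
have [glcont _ _] := continuous_frame (fun i => (lc i).1).
have [grcont _ _] := continuous_frame (fun i => (lc i).2).
have gl1 t : unit_itv t -> sphere (frame1 (G t).1).
  by move=> It; have [z1 _] := sphere_lift lift It; have [[]] := frame_orthonormal z1.
have gr1 t : unit_itv t -> sphere (frame1 (G t).2).
  by move=> It; have [_ w1] := sphere_lift lift It; have [[]] := frame_orthonormal w1.
have [h0 h01 h0P] := @strict_pole R (fun t => frame1 (G t).1) (fun t => frame1 (G t).2)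
  gl1 gr1 glcont grcont (congr1 frame1 loop) (dual_gap_gt0 glc gconvex lift).
split.
- split.
  + exact: left_part_locally_convex gsmooth gsphere lift.
  + rewrite (frenet_left_part gsmooth gsphere lift I0) G0 /=.
    apply/matrixP => i j; rewrite !mxE; move: i j.
    by apply: ord3P; apply: ord3P; rewrite /= ?frame1E ?frame2E ?frame3E !vec3E /qone !quatE; ring.
  + exists (fun t => (G t).1); last by rewrite G1.
    split; [|by rewrite G0|by move=> t /(sphere_lift lift)[]|].
      have [Gc _ _ _] := lift => t; apply: (@cvg_comp _ _ _ G fst); [exact: Gc|exact: cvg_fst].
    by move=> t It h; exact: (frenet_left_part_Pi3 gsmooth gsphere lift).
- exists h0 => // _ [t It <-]; split; [exact: gl1|exact: h0P].
- have [b1 bP] := barycenter_pole gl1 glcont h01 h0P.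
  rewrite /rotation_number -[left_part G]/(fun t => frame1 (G t).1).
  set h := barycenter _ in b1 bP *.
  (* The left part starts at the first basis vector, so that h_0 is the product of the pole with a
     point of the curve. *)
  have h00 : 0 < h 0 0.
    have := bP 0 I0; rewrite G0 /= dotE3 frame1E !vec3E /qone !quatE; lra.
  have [q q1 qh] := frame1_surjective b1 h00.
  split.
    split=> // _ [t It <-]; split; [exact: gl1|exact/ltW/bP].
  exists (frame2 q), (- frame3 q); split.
  + have [[f1 f2 f3] [f12 f13 f23]] := frame_orthonormal q1.
    have E (A : 'M[R]_3) i j : (A^T *m A) i j = dot (col i A) (col j A).
      by rewrite mxE /dot; apply: eq_bigr => k _; rewrite !mxE.
    have C (vs : seq 'cV[R]_3) i : col i (cols vs) = vs`_i.
      by apply/colP => k; rewrite !mxE.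
    apply/matrixP => i j; rewrite E !C -qh mxE; move: i j.
    by apply: ord3P; apply: ord3P; rewrite /= ?(dotNl, dotC _ (- _)) ?f1 ?f2 ?f3 ?(dotC (frame2 q) (frame1 q)) ?(dotC (frame3 q)) ?f12 ?f13 ?f23 ?oppr0 ?opprK.
  + rewrite det_cols3 -qh (_ : det3 _ _ _ = - det3 (frame1 q) (frame2 q) (frame3 q)).
      by rewrite det3_frame q1 expr1n.
    by rewrite /det3 !entryE; ring.
  + have pole t : unit_itv t -> 0 < dot (frame1 q) (frame1 (G t).1) by rewrite qh; exact: bP.
    by have := left_part_plane_rotation glc gconvex lift loop q1 pole; rewrite qh.
Qed.
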